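(* Let $X=X^*$ be a self-adjoint element of a $\mathcal B$-valued $C^*$-probability space, and let $S$ be a $\mathcal B$-valued centered semicircular element of invertible variance $\eta$ such that $X$ and $S$ are free over $\mathcal B$. Denote $$G(\eta,b)=\mu_{X+S}\left[(b-\mathcal X)^{-1}\right]=\mathbb E\left[(b-(X+S))^{-1}\right],\qquad \Im b>0 .$$ Then $$\frac{\partial G(\eta,b)}{\partial\eta}(\rho)+\frac{\partial G(\eta,b)}{\partial b}\bigl(\rho(G(\eta,b))\bigr)=0,$$ where $\rho\in\mathcal{CP}(\mathcal B)$, $\eta\in\mathrm{Int}(\mathcal{CP}(\mathcal B))$ (with $\eta$ invertible as a linear map $\mathcal B\to\mathcal B$) and $\Im b>0$. The derivative with respect to $b$ is in the Fr\'echet sense, and the derivative with respect to $\eta$ (in the direction $\rho$) is in the G\^ateaux sense.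
   Context: $\mathcal B$ is a fixed unital $C^*$-algebra. For $b\in\mathcal B$, $\Im b=(b-b^* )/2i$, and $\Im b>0$ means $\Im b\ge\varepsilon\cdot1$ for some $\varepsilon>0$. $\mathcal{CP}(\mathcal B)$ is the cone of completely positive $\mathbb C$-linear maps $\mathcal B\to\mathcal B$, and $\mathrm{Int}(\mathcal{CP}(\mathcal B))$ is its interior in the real normed space of bounded linear maps $T:\mathcal B\to\mathcal B$ with $T(b^* )=T(b)^*$. Invertibility of $\eta$ is as a linear map $\mathcal B\to\mathcal B$. A $\mathcal B$-valued $C^*$-probability space is a pair $(\mathcal M,\mathbb E)$ with $\mathcal M\supseteq\mathcal B$ a $C^*$-algebra and $\mathbb E:\mathcal M\to\mathcal B$ a unital positive $\mathcal B$-bimodule map. Self-adjoint elements are free over $\mathcal B$ if the $*$-subalgebras $\mathcal M_1,\dots,\mathcal M_k$ they generate together with $\mathcal B$ satisfy: $\mathbb E[X_1X_2\cdots X_n]=0$ whenever $X_i\in\mathcal M_{j(i)}$, $\mathbb E[X_i]=0$ and $j(i)\ne j(i+1)$ for all $i$. $NC(n)$ is the set of non-crossing partitions of $\{1,\dots,n\}$. For a sequence $F=(F^{[n]})_{n\ge1}$ with $F^{[1]}\in\mathcal B$ and $F^{[n]}:\mathcal B^{n-1}\to\mathcal B$ multilinear, and $\pi\in NC(n)$, the multilinear map $F^{[\pi]}:\mathcal B^{n-1}\to\mathcal B$ is obtained by reading the string $W_1b_1W_2b_2\cdots b_{n-1}W_n$ as a parenthesized expression, where: if $m$ is the minimum of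 a block $V$ with $|V|=k\ge2$ then $W_m$ is ''$F^{[k]}($''; if $m$ is the maximum of a block with at least 2 elements then $W_m$ is ''$)$''; if $m\in V$ with $\min V<m<\max V$ then $W_m$ is a comma; if $\{m\}$ is a block then $W_m$ is ''$F^{[1]}$''. A $\mathcal B$-valued centered semicircular element of variance $\eta\in\mathcal{CP}(\mathcal B)$ is a self-adjoint $S$ whose moments are $\mathbb E[Sb_1S\cdots b_{n-1}S]=\sum_{\pi\in NC(n)}F^{[\pi]}(b_1,\dots,b_{n-1})$ with $F^{[2]}=\eta$ and $F^{[n]}=0$ for $n\ne2$. The distribution of $X$ over $\mathcal B$ is fixed; since the $\mathcal B$-valued distribution $\mu_{X+S}$ of $X+S$ depends only on that of $X$ and on $\eta$, $G(\eta,b)$ is a function of $\eta\in\mathcal{CP}(\mathcal B)$ and $b$, and the derivative $\frac{\partial G(\eta,b)}{\partial\eta}(\rho)$ is $\lim_{t\to0}\frac{G(\eta+t\rho,b)-G(\eta,b)}{t}$. *)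

(* Defs.v *)
(* MathComp + MathComp-Analysis; the complex field is R[i] for R : realType. *)
From HB Require Import structures.
From mathcomp Require Import all_boot all_order all_algebra.
From mathcomp Require Import complex.
From mathcomp Require Import all_classical all_reals all_analysis.

Set Implicit Arguments.
Unset Strict Implicit.
Unset Printing Implicit Defensive.

Import Order.TTheory GRing.Theory Num.Theory.
Import numFieldNormedType.Exports.

Local Open Scope complex_scope.
Local Open Scope ring_scope.

(* Norms of R[i]-spaces take their (nonnegative real) values in R[i], as the
   library norm does.  Classically every nonzero ring is a unitRingType, so
   asking for a unitAlgType only makes x^-1 available. *)
HB.mixin Record isPreCStarAlgebra (R : realType) A
    of GRing.UnitAlgebra R[i] A := {
  star : A -> A ;
  cnorm : A -> R[i] ;
  starK : forall x, star (star x) = x ;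
  starD : forall x y, star (x + y) = star x + star y ;
  starZ : forall (c : R[i]) x, star (c *: x) = (Num.conj c) *: star x ;
  starM : forall x y, star (x * y) = star y * star x ;
  ler_cnormD : forall x y, cnorm (x + y) <= cnorm x + cnorm y ;
  cnormZ : forall (c : R[i]) x, cnorm (c *: x) = `|c| * cnorm x ;
  cnorm0_eq0 : forall x, cnorm x = 0 -> x = 0 ;
  ler_cnormM : forall x y, cnorm (x * y) <= cnorm x * cnorm y ;
  cnorm_star_mul : forall x, cnorm (star x * x) = cnorm x ^+ 2
}.

#[short(type="preCStarAlgType")]
HB.structure Definition PreCStarAlgebra (R : realType) :=
  { A of isPreCStarAlgebra R A & GRing.UnitAlgebra R[i] A }.

(* The library's hierarchy has no join of unitRingType and normedModType below
   numDomainType, so the normed space structure sits on an alias. *)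
Definition cstar_space (R : realType) (A : preCStarAlgType R) : Type := A.

HB.instance Definition _ (R : realType) (A : preCStarAlgType R) :=
  GRing.Lmodule.on (cstar_space A).
HB.instance Definition _ (R : realType) (A : preCStarAlgType R) :=
  Lmodule_isNormed.Build R[i] (cstar_space A)
    (@ler_cnormD R A) (@cnormZ R A) (@cnorm0_eq0 R A).

HB.mixin Record isCompleteCStar (R : realType) A of PreCStarAlgebra R A := {
  cstar_cauchy_cvg : forall F : set_system (cstar_space A),
    ProperFilter F -> cauchy F -> cvg F
}.

#[short(type="cstarAlgType")]
HB.structure Definition CStarAlgebra (R : realType) :=
  { A of isCompleteCStar R A & PreCStarAlgebra R A }.

HB.instance Definition _ (R : realType) (A : cstarAlgType R) :=
  Uniform_isComplete.Build (cstar_space A) (@cstar_cauchy_cvg R A).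

Section Positivity.
Context {R : realType}.
Implicit Types A B : cstarAlgType R.

Definition cstar_pos A (a : A) : Prop := exists c : A, a = star c * c.

Definition cstar_im A (a : A) : A := (2 * 'i)^-1 *: (a - star a).

(* Im a > 0, i.e. Im a >= e . 1 for some e > 0 *)
Definition im_pos A (a : A) : Prop :=
  exists2 e : R, 0 < e & cstar_pos (cstar_im a - e%:C *: 1).

Definition mx_star A n (a : 'M[A]_n) : 'M[A]_n := (map_mx star a)^T.

Definition mx_pos A n (a : 'M[A]_n) : Prop :=
  exists c : 'M[A]_n, a = mx_star c *m c.

Definition completely_positive B (f : B -> B) : Prop :=
  linear f /\ forall n (a : 'M[B]_n), mx_pos a -> mx_pos (map_mx f a).

(* The real normed space of bounded linear maps T with T(b^* ) = T(b)^* . *)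
Definition bounded_hermitian B (f : B -> B) : Prop :=
  [/\ linear f,
      exists K : R, forall b, cnorm (f b) <= K%:C * cnorm b
    & forall b, f (star b) = star (f b)].

(* Interior of CP(B) in that space: some ball around f, for the operator norm,
   consists of completely positive maps. *)
Definition cp_interior B (f : B -> B) : Prop :=
  bounded_hermitian f /\
  exists2 e : R, 0 < e &
    forall g : B -> B, bounded_hermitian g ->
      (forall b, cnorm (g b - f b) <= e%:C * cnorm b) -> completely_positive g.

End Positivity.

(* The inclusion of B in the algebra is a unital injective *-homomorphism
   [incl] (automatically isometric). *)
Record cstar_prob_space (R : realType) (B : cstarAlgType R) := CStarProbSpace {
  ps_alg :> cstarAlgType R ;
  incl : {lrmorphism B -> ps_alg} ;
  incl_star : forall b, incl (star b) = star (incl b) ;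
  incl_inj : injective incl ;
  cexp : {linear ps_alg -> B} ;
  cexp1 : cexp 1 = 1 ;
  cexp_pos : forall m : ps_alg, cstar_pos m -> cstar_pos (cexp m) ;
  cexp_bimod : forall b m c, cexp (incl b * m * incl c) = b * cexp m * c
}.
Arguments incl {R B} _.
Arguments cexp {R B} _.

Section NonCrossing.

Definition noncrossing n (P : {set {set 'I_n}}) : bool :=
  finset.partition P [set: 'I_n] &&
  [forall V in P, forall W in P, (V != W) ==>
    ~~ [exists a in V, exists b in W, exists c in V, exists d in W,
        [&& (a < b)%N, (b < c)%N & (c < d)%N]]].

(* The letters of the string W_1 b_1 W_2 b_2 ... b_(n-1) W_n: "F^[k](", ")",
   ",", "F^[1]" and the b_i. *)
Inductive letter (B : Type) : Type :=
  | LOpen | LClose | LComma | LOne | LArg of B.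
Arguments LOpen {B}.
Arguments LClose {B}.
Arguments LComma {B}.
Arguments LOne {B}.

Definition letter_at (B : Type) n (P : {set {set 'I_n}}) (m : 'I_n) : letter B :=
  let V := finset.pblock P m in
  if V == [set m] then LOne
  else if [forall j in V, (m <= j)%N] then LOpen
  else if [forall j in V, (j <= m)%N] then LClose
  else LComma.

Fixpoint interleave (B : Type) (ws : seq (letter B)) (bs : seq B) :=
  match ws, bs with
  | w :: ws', b :: bs' => w :: LArg b :: interleave ws' bs'
  | _, _ => ws
  end.

Context {R : realType} {B : cstarAlgType R}.

(* Evaluation of a parenthesized string.  [cur] is the product read so far at
   the current nesting level, [args] the arguments already completed there, and
   [stack] holds the (args, cur) of the enclosing levels.  F^[n] is the
   restriction of F to lists of length n - 1, so F [::] is F^[1]; the index k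
   of "F^[k](" is recovered as the number of arguments plus one. *)
Fixpoint eval_string (F : seq B -> B) (stack : seq (seq B * B))
    (args : seq B) (cur : B) (s : seq (letter B)) : B :=
  match s with
  | [::] => cur
  | LOpen :: s' => eval_string F ((args, cur) :: stack) [::] 1 s'
  | LComma :: s' => eval_string F stack (rcons args cur) 1 s'
  | LOne :: s' => eval_string F stack args (cur * F [::]) s'
  | LArg b :: s' => eval_string F stack args (cur * b) s'
  | LClose :: s' =>
      if stack is (args', cur') :: stack' then
        eval_string F stack' args' (cur' * F (rcons args cur)) s'
      else 0 (* not reached on strings coming from non-crossing partitions *)
  end.

(* F^[pi](b_1, ..., b_(n-1)) for pi in NC(n), with bs = [:: b_1; ...; b_(n-1)] *)
Definition partition_eval (F : seq B -> B) n (P : {set {set 'I_n}})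
    (bs : seq B) : B :=
  eval_string F [::] [::] 1
    (interleave [seq letter_at B P m | m <- enum 'I_n] bs).

(* F^[2] = eta and F^[n] = 0 for n <> 2 *)
Definition semicircular_cumulants (eta : B -> B) (bs : seq B) : B :=
  if bs is [:: b] then eta b else 0.

End NonCrossing.

Section FreeProbability.
Context {R : realType} {B : cstarAlgType R}.
Implicit Types M N : cstar_prob_space B.

(* E[X b_1 X ... b_(n-1) X] with bs = [:: b_1; ...; b_(n-1)] *)
Definition moment M (X : M) (bs : seq B) : B :=
  cexp M (foldl (fun m b => m * incl M b * X) X bs).

(* Moments with outer factors b_0 and b_n follow by the bimodule property. *)
Definition same_distribution M N (X : M) (Y : N) : Prop :=
  forall bs : seq B, moment X bs = moment Y bs.

Definition semicircular M (eta : B -> B) (S : M) : Prop :=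
  star S = S /\
  forall bs : seq B,
    moment S bs =
    \sum_(P : {set {set 'I_(size bs).+1}} | noncrossing P)
       partition_eval (semicircular_cumulants eta) P bs.

Inductive gen_star_alg M (X : M) : M -> Prop :=
  | gen_base b : gen_star_alg X (incl M b)
  | gen_elt : gen_star_alg X X
  | gen_add m m' : gen_star_alg X m -> gen_star_alg X m' ->
      gen_star_alg X (m + m')
  | gen_scale (c : R[i]) m : gen_star_alg X m -> gen_star_alg X (c *: m)
  | gen_mul m m' : gen_star_alg X m -> gen_star_alg X m' ->
      gen_star_alg X (m * m')
  | gen_star m : gen_star_alg X m -> gen_star_alg X (star m).

Definition free_over M (I : eqType) (Y : I -> M) : Prop :=
  forall w : seq (I * M),
    (0 < size w)%N ->
    (forall p, p \in w -> gen_star_alg (Y p.1) p.2 /\ cexp M p.2 = 0) ->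
    sorted (fun p q => p.1 != q.1) w ->
    cexp M (\prod_(p <- w) p.2) = 0.

Definition free_pair M (X S : M) : Prop :=
  free_over (fun i : bool => if i then X else S).

(* E[(b - X)^-1] *)
Definition cauchy_transform M (X : M) (b : B) : B := cexp M ((incl M b - X)^-1).

(* [G] is the function (eta, b) |-> mu_(X+S)[(b - X)^-1], on CP(B) and
   {Im b > 0}.  Only the distribution of X matters, so the semicircular element
   of each variance may live in a space of its own, with a copy of X; G is
   unconstrained for other arguments. *)
Definition semicircular_flow M (X : M) (G : (B -> B) -> B -> B) : Prop :=
  forall eta : B -> B, completely_positive eta ->
    exists (N : cstar_prob_space B) (Y S : N),
      [/\ star Y = Y,
          same_distribution X Y,
          semicircular eta S,
          free_pair Y S
        & forall b, im_pos b -> G eta b = cauchy_transform (Y + S) b].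

End FreeProbability.

(* Main.v *)
From Pilot Require Import Defs.
From HB Require Import structures.
From mathcomp Require Import all_boot all_order all_algebra.
From mathcomp Require Import complex.
From mathcomp Require Import all_classical all_reals all_analysis.
From mathcomp Require Import ring lra zify.

(** Write [G (eta, b)] for the Cauchy transform at [b] of [Y + S], where [Y] is a copy
    of [X] and [S] is semicircular of variance [eta] and free from [Y].  Everything
    follows from the flow equation ([flow_equation]), for [eta0] and [rho] completely
    positive,
      [G (eta0 + rho, b) = G (eta0, b - rho (G (eta0 + rho, b)))].

    Used between [eta] and [eta + t rho] (in this order when [t > 0], in the other
    order when [t < 0], where [eta + t rho] is completely positive because [eta] is
    interior), together with a Lipschitz bound for [G] in [b], it gives
      [G (eta + t rho, b) = G (eta, b - t rho (G (eta, b))) + O (t ^ 2)]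
    ([flow_second_order]), and the theorem is the chain rule for the right-hand side,
    [G (eta, .)] being differentiable with derivative [h |-> - E [R h R]], [R] the
    resolvent of [Y + S] at [b] ([cauchy_differentiable]).

    The elements attached to different variances live in different spaces, and only
    their distributions can be compared.  This is done far from the real axis, where
    resolvents are limits of polynomials.  There [Y + S] is subordinated to [Y],
      [G_(Y+S) (w) = G_Y (w - eta (G_(Y+S) (w)))]
    ([subordination_large]): indeed [(w - eta (G) - Y)^-1 - (w - Y - S)^-1] is a product
    [Q (eta (G) - S) R], and [E [Q S R] = E [Q eta (E R) R]] is the Schwinger-Dyson
    equation ([schwinger_dyson]).  That equation comes from the sum over non-crossing
    partitions, which is the vacuum expectation of a word in Fock space ([nc_sum_fock])
    and therefore satisfies a first-return recursion ([fock_pop]); freeness carries it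
    over to words that also contain [Y].  Both sides of the flow equation then solve
    the same fixed point problem [g = G_Y (w' - eta0 (g))], which is a contraction far
    from the real axis ([flow_large]).

    Both sides of the flow equation are analytic along [K |-> b + i K], [K >= 0], so the
    equation descends to [K = 0] by the identity theorem ([analytic_halfline]).  This
    uses that [Im a >= e > 0] makes [a] invertible with [||a^-1|| <= 1 / e], hence
    the order structure of a C*-algebra, and in the end the positivity of the elements
    [star x * x] for the metric notion of positivity ([npos_starM]). *)

Set Implicit Arguments.
Unset Strict Implicit.
Unset Printing Implicit Defensive.

Import Order.TTheory GRing.Theory Num.Theory.
Import numFieldNormedType.Exports.
(* [incl] is to denote the inclusion of [B], not the homonym imported above. *)
Import Pilot.Defs.

Local Open Scope complex_scope.
Local Open Scope ring_scope.

(** * Noncommutative polynomial identities *)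

(** Syntax of noncommutative polynomials with scalar coefficients, to decide
    identities in an algebra by comparing coefficients of monomials. *)
Inductive ncexpr (K : Type) : Type :=
  | NCvar of nat
  | NCadd of ncexpr K & ncexpr K
  | NCopp of ncexpr K
  | NCmul of ncexpr K & ncexpr K
  | NCscale of K & ncexpr K
  | NCone
  | NCzero.
Arguments NCvar {K}.
Arguments NCone {K}.
Arguments NCzero {K}.

Section NCPoly.
Context {K : comNzRingType} {A : algType K}.

Fixpoint nc_eval (env : seq A) (e : ncexpr K) : A :=
  match e with
  | NCvar i => nth 0 env i
  | NCadd a b => nc_eval env a + nc_eval env b
  | NCopp a => - nc_eval env a
  | NCmul a b => nc_eval env a * nc_eval env b
  | NCscale c a => c *: nc_eval env a
  | NCone => 1
  | NCzero => 0
  end.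

Fixpoint nc_map (f : K * seq nat -> K * seq nat) (p : seq (K * seq nat)) :=
  match p with [::] => [::] | m :: p' => f m :: nc_map f p' end.

Fixpoint nc_cat (T : Type) (p q : seq T) :=
  match p with [::] => q | m :: p' => m :: nc_cat p' q end.

Fixpoint nc_prod (p q : seq (K * seq nat)) :=
  match p with
  | [::] => [::]
  | m :: p' => nc_cat (nc_map (fun m' => (m.1 * m'.1, nc_cat m.2 m'.2)) q)
                      (nc_prod p' q)
  end.

Fixpoint nc_norm (e : ncexpr K) : seq (K * seq nat) :=
  match e with
  | NCvar i => [:: (1, [:: i])]
  | NCadd a b => nc_cat (nc_norm a) (nc_norm b)
  | NCopp a => nc_map (fun m => (- m.1, m.2)) (nc_norm a)
  | NCmul a b => nc_prod (nc_norm a) (nc_norm b)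
  | NCscale c a => nc_map (fun m => (c * m.1, m.2)) (nc_norm a)
  | NCone => [:: (1, [::])]
  | NCzero => [::]
  end.

Fixpoint nc_eqm (m n : seq nat) : bool :=
  match m, n with
  | [::], [::] => true
  | i :: m', j :: n' => if PeanoNat.Nat.eqb i j then nc_eqm m' n' else false
  | _, _ => false
  end.

Fixpoint nc_insert (c : K) (m : seq nat) (p : seq (K * seq nat)) :=
  match p with
  | [::] => [:: (c, m)]
  | (c', m') :: p' =>
      if nc_eqm m m' then (c' + c, m') :: p' else (c', m') :: nc_insert c m p'
  end.

Fixpoint nc_collect (p : seq (K * seq nat)) :=
  match p with [::] => [::] | (c, m) :: p' => nc_insert c m (nc_collect p') end.

Fixpoint nc_zero (p : seq (K * seq nat)) : Prop :=
  match p with [::] => True | (c, m) :: p' => c = 0 /\ nc_zero p' end.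

Definition nc_mon (env : seq A) (m : seq nat) : A := \prod_(i <- m) nth 0 env i.
Definition nc_den (env : seq A) (p : seq (K * seq nat)) : A :=
  \sum_(m <- p) m.1 *: nc_mon env m.2.

Lemma nc_catE (T : Type) (p q : seq T) : nc_cat p q = p ++ q.
Proof. by elim: p => //= m p ->. Qed.

Lemma nc_den_cat env p q : nc_den env (nc_cat p q) = nc_den env p + nc_den env q.
Proof. by rewrite /nc_den nc_catE big_cat. Qed.

Lemma nc_den_cons env m p : nc_den env (m :: p) = m.1 *: nc_mon env m.2 + nc_den env p.
Proof. by rewrite /nc_den big_cons. Qed.

Lemma nc_normP env e : nc_den env (nc_norm e) = nc_eval env e.
Proof.
elim: e => /= [i|a <- b <-|a <-|a <- b <-|c a <-||].
- by rewrite nc_den_cons /nc_den big_nil addr0 scale1r /nc_mon big_seq1.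
- exact: nc_den_cat.
- elim: (nc_norm a) => [|m p IH] /=; first by rewrite /nc_den big_nil oppr0.
  by rewrite !nc_den_cons IH scaleNr opprD.
- elim: (nc_norm a) => [|m p IH] /=; first by rewrite /nc_den big_nil mul0r.
  rewrite nc_den_cat IH nc_den_cons mulrDl; congr (_ + _).
  elim: (nc_norm b) => [|m' q IHq] /=; first by rewrite /nc_den big_nil mulr0.
  rewrite !nc_den_cons IHq mulrDr; congr (_ + _) => /=.
  by rewrite /nc_mon nc_catE big_cat /= -scalerAl -scalerAr scalerA.
- elim: (nc_norm a) => [|m p IH] /=; first by rewrite /nc_den big_nil scaler0.
  by rewrite !nc_den_cons IH scalerDr scalerA.
- by rewrite nc_den_cons /nc_den big_nil addr0 scale1r /nc_mon big_nil.
- by rewrite /nc_den big_nil.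
Qed.

Lemma nc_eqmP m n : nc_eqm m n -> m = n.
Proof.
elim: m n => [|i m IH] [|j n] //=.
by case: (PeanoNat.Nat.eqb_spec i j) => // -> /IH ->.
Qed.

Lemma nc_collectP env p : nc_den env (nc_collect p) = nc_den env p.
Proof.
elim: p => [//|[c m] p IH] /=; rewrite nc_den_cons -IH /=.
elim: (nc_collect p) => [|[c' m'] q IHq] /=; first by rewrite nc_den_cons.
case: (boolP (nc_eqm m m')) => [mm'|_]; rewrite !nc_den_cons /=.
  by rewrite (nc_eqmP mm') scalerDl addrCA addrA.
by rewrite IHq addrCA.
Qed.

Lemma nc_solve env e1 e2 :
  nc_zero (nc_collect (nc_norm (NCadd e1 (NCopp e2)))) ->
  nc_eval env e1 = nc_eval env e2.
Proof.
move=> z; apply/eqP; rewrite -subr_eq0; apply/eqP.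
rewrite -[LHS]/(nc_eval env (NCadd e1 (NCopp e2))) -nc_normP -nc_collectP.
move: (nc_collect _) z => p; elim: p => [|[c m] p IH] /=.
  by rewrite /nc_den big_nil.
by move=> [-> /IH]; rewrite nc_den_cons /= scale0r add0r.
Qed.

End NCPoly.

Ltac nc_index x l :=
  lazymatch l with
  | cons x _ => constr:(O)
  | cons _ ?l' => let i := nc_index x l' in constr:(S i)
  end.
Ltac nc_add x l :=
  let rec mem l0 :=
    lazymatch l0 with
    | nil => constr:(false) | cons x _ => constr:(true) | cons _ ?l' => mem l' end in
  let b := mem l in
  lazymatch b with true => l | false => constr:(x :: l) end.
Ltac nc_vars t l :=
  lazymatch t with
  | (?a + ?b)%R => let l1 := nc_vars a l in nc_vars b l1
  | (- ?a)%R => nc_vars a l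
  | (?a * ?b)%R => let l1 := nc_vars a l in nc_vars b l1
  | (_ *: ?a)%R => nc_vars a l
  | 1%R => l
  | 0%R => l
  | _ => nc_add t l
  end.
Ltac nc_reify K t l :=
  lazymatch t with
  | (?a + ?b)%R =>
      let a' := nc_reify K a l in let b' := nc_reify K b l in constr:(@NCadd K a' b')
  | (- ?a)%R => let a' := nc_reify K a l in constr:(@NCopp K a')
  | (?a * ?b)%R =>
      let a' := nc_reify K a l in let b' := nc_reify K b l in constr:(@NCmul K a' b')
  | (?c *: ?a)%R => let a' := nc_reify K a l in constr:(@NCscale K c a')
  | 1%R => constr:(@NCone K)
  | 0%R => constr:(@NCzero K)
  | _ => let i := nc_index t l in constr:(@NCvar K i)
  end.

(** Reduces an identity in [A] to the vanishing of the coefficients in [R[i]] of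
    the difference of the two sides; local definitions count as atoms. *)
Ltac nc_coeffs R A :=
  lazymatch goal with
  | |- ?x = ?y =>
      let l := nc_vars x (@nil A) in
      let l := nc_vars y l in
      let a := nc_reify (complex R) x l in
      let b := nc_reify (complex R) y l in
      refine (@nc_solve (complex R) A l a b _);
      cbv [nc_zero nc_collect nc_norm nc_map nc_cat nc_prod nc_insert nc_eqm
           PeanoNat.Nat.eqb fst snd]
  end.
Ltac ncring R A := nc_coeffs R A; repeat split; ring.

(** * The real-valued norm of a C*-algebra *)

Lemma gt0_complex (R : realType) (d : R[i]) :
  0 < d -> exists2 r : R, 0 < r & d = r%:C.
Proof.
by case: d => dr di; rewrite ltcE /= => /andP[/eqP -> ?]; exists dr.
Qed.

Section RealNorm.
Local Open Scope classical_set_scope.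
Local Open Scope ring_scope.
Context {R : realType} {A : cstarAlgType R}.
Implicit Types (x y a b u v h k : A) (r s t : R) (c : R[i]).

Definition nrm x : R := complex.Re (cnorm x).

Lemma cnormE x : cnorm x = (nrm x)%:C.
Proof.
have := normr_ge0 (x : cstar_space A); rewrite /Num.norm/= => /ger0_real x_real.
by rewrite /nrm RRe_real.
Qed.

Lemma nrm_ge0 x : 0 <= nrm x.
Proof.
have := normr_ge0 (x : cstar_space A); rewrite /Num.norm/=.
by rewrite cnormE ler0c.
Qed.

Lemma nrmD x y : nrm (x + y) <= nrm x + nrm y.
Proof. by have := ler_cnormD x y; rewrite !cnormE -rmorphD lecR. Qed.

Lemma nrmM x y : nrm (x * y) <= nrm x * nrm y.
Proof. by have := ler_cnormM x y; rewrite !cnormE -rmorphM lecR. Qed.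

Lemma nrmZ c x : nrm (c *: x) = complex.Re `|c| * nrm x.
Proof.
have := cnormZ c x; rewrite !cnormE normc_def /= -rmorphM => /complexI ->.
by [].
Qed.

Lemma nrmZr r x : nrm (r%:C *: x) = `|r| * nrm x.
Proof. by rewrite nrmZ normc_def /= expr0n/= addr0 sqrtr_sqr. Qed.

Lemma nrmZp r x : 0 <= r -> nrm (r%:C *: x) = r * nrm x.
Proof. by move=> r0; rewrite nrmZr ger0_norm. Qed.

Lemma nrmZi x : nrm ('i *: x) = nrm x.
Proof. by rewrite nrmZ normc_def /= expr0n/= add0r expr1n sqrtr1 mul1r. Qed.

Lemma nrm0 : nrm (0 : A) = 0.
Proof. by rewrite -(scale0r (0 : A)) (nrmZr 0) normr0 mul0r. Qed.

Lemma nrm_eq0 x : nrm x = 0 -> x = 0.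
Proof. by move=> x0; apply: cnorm0_eq0; rewrite cnormE x0. Qed.

Lemma nrmN x : nrm (- x) = nrm x.
Proof.
have -> : - x = (-1)%:C *: x by rewrite rmorphN1 scaleN1r.
by rewrite nrmZr normrN1 mul1r.
Qed.

Lemma nrmB x y : nrm (x - y) <= nrm x + nrm y.
Proof. by rewrite -(nrmN y) nrmD. Qed.

Lemma nrmBC x y : nrm (x - y) = nrm (y - x).
Proof. by rewrite -[LHS]nrmN opprB. Qed.

Lemma nrm_starM x : nrm (star x * x) = nrm x ^+ 2.
Proof. by have := cnorm_star_mul x; rewrite !cnormE -rmorphXn => /complexI. Qed.

Lemma nrm_star x : nrm (star x) = nrm x.
Proof.
have le z : nrm z <= nrm (star z).
  have [->|z0] := eqVneq (nrm z) 0; first exact: nrm_ge0.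
  have zp : 0 < nrm z by rewrite lt_def z0 nrm_ge0.
  by rewrite -(ler_pM2r zp) -expr2 -nrm_starM nrmM.
by apply/eqP; rewrite eq_le le -{2}(starK x) le.
Qed.

Lemma star0 : star (0 : A) = 0.
Proof. by have := starZ 0 (0 : A); rewrite rmorph0 !scale0r. Qed.
Lemma starN x : star (- x) = - star x.
Proof. by apply/eqP; rewrite -addr_eq0 -starD addNr star0. Qed.
Lemma starB x y : star (x - y) = star x - star y.
Proof. by rewrite starD starN. Qed.
Lemma star1 : star (1 : A) = 1.
Proof. by have := starM (star (1 : A)) 1; rewrite mulr1 starK mulr1. Qed.
Lemma starZr r x : star (r%:C *: x) = r%:C *: star x.
Proof. by rewrite starZ; congr (_ *: _); exact: conjc_real. Qed.
Lemma starZi x : star ('i *: x) = - ('i *: star x).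
Proof.
rewrite starZ -scaleNr; congr (_ *: _); rewrite -[LHS]/(conjc _) /=.
by congr (_ +i* _); rewrite oppr0.
Qed.

Lemma nrm1 : nrm (1 : A) = 1.
Proof.
have := nrm_starM (1 : A); rewrite star1 mulr1 expr2.
have [/nrm_eq0/eqP|n0] := eqVneq (nrm (1 : A)) 0; first by rewrite oner_eq0.
by rewrite -{1}(mulr1 (nrm 1)) => /(mulfI n0).
Qed.

Lemma nrmA r : nrm (r%:C%:A : A) = `|r|.
Proof. by rewrite nrmZr nrm1 mulr1. Qed.

Lemma nrm_sum (I : Type) (s : seq I) (F : I -> A) :
  nrm (\sum_(i <- s) F i) <= \sum_(i <- s) nrm (F i).
Proof.
elim/big_ind2: _ => [|x1 r1 x2 r2 h1 h2|//]; first by rewrite nrm0.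
exact: le_trans (nrmD _ _) (lerD h1 h2).
Qed.

Lemma nrmX x n : nrm (x ^+ n) <= nrm x ^+ n.
Proof.
elim: n => [|n IH]; first by rewrite !expr0 nrm1.
by rewrite !exprS (le_trans (nrmM _ _))// ler_wpM2l ?nrm_ge0.
Qed.

Lemma nrmM_le x y r s : nrm x <= r -> nrm y <= s -> nrm (x * y) <= r * s.
Proof. by move=> h1 h2; rewrite (le_trans (nrmM _ _))// ler_pM ?nrm_ge0. Qed.

Lemma nrmD_le x y r s : nrm x <= r -> nrm y <= s -> nrm (x + y) <= r + s.
Proof. by move=> h1 h2; rewrite (le_trans (nrmD _ _))// lerD. Qed.

Lemma nrm_small x : (forall d, 0 < d -> nrm x <= d) -> x = 0.
Proof.
move=> H; apply: nrm_eq0; apply/eqP; rewrite eq_le nrm_ge0 andbT.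
by apply/ler_addgt0Pr => e e0; rewrite add0r H.
Qed.

(** Completeness in terms of the real norm, with an explicit rate. *)
Lemma cauchy_seq_lim (u : nat -> A) (e : nat -> R) :
    (forall n m, (n <= m)%N -> nrm (u m - u n) <= e n) ->
    (forall d, 0 < d -> exists n, e n <= d) ->
  exists l, forall n, nrm (u n - l) <= e n.
Proof.
move=> ue e0.
pose v : nat -> cstar_space A := u.
have : cauchy (v @ \oo).
  apply/cauchy_ballP => d d0.
  have [d' d'0 dd'] := gt0_complex d0.
  have [n en] := e0 (d' / 3) (divr_gt0 d'0 (ltr0n _ 3)).
  exists ([set z | exists2 m, (n <= m)%N & z = v m], [set z | exists2 m, (n <= m)%N & z = v m]).
    by split; exists n => // m /= nm; exists m.
  move=> [z1 z2] /= [[m1 nm1 ->] [m2 nm2 ->]].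
  rewrite -ball_normE /ball_ /= dd' {1}/Num.norm/= cnormE ltcR.
  have -> : v m1 - v m2 = (u m1 - u n) - (u m2 - u n) by rewrite opprB addrA subrK.
  apply: (@le_lt_trans _ _ (d' / 3 + d' / 3)); last by lra.
  apply: (le_trans (nrmB _ _)); apply: lerD; apply: le_trans en; exact: ue.
move=> /(@cstar_cauchy_cvg R A _ _)/cvg_ex [l ul].
exists l => n; apply/ler_addgt0Pr => d d0.
have : \forall m \near \oo, (n <= m)%N /\ `|(l : cstar_space A) - v m| < d%:C.
  near=> m; split; first by near: m; exact: nbhs_infty_ge.
  near: m; apply: (cvgr_dist_lt (K := R[i]) (V := cstar_space A)) => //.
  by rewrite ltcR.
move=> /filter_ex [m [nm]]; rewrite {1}/Num.norm/= cnormE ltcR => dm.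
have -> : u n - l = - (u m - u n) - (l - u m).
  by rewrite !opprB addrA subrK.
by rewrite (le_trans (nrmB _ _))// nrmN lerD ?ue// ltW.
Unshelve. all: by end_near.
Qed.

End RealNorm.

(** * Neumann series and square roots *)

Lemma expr_small (R : realType) (q d : R) :
  0 <= q < 1 -> 0 < d -> exists n, q ^+ n <= d.
Proof.
move=> /andP[q0 q1] d0.
have /cvgrPdist_le/(_ d d0) : ((fun n => q ^+ n) @ \oo --> (0 : R))%classic.
  by apply: cvg_expr; rewrite ger0_norm.
move=> /filter_ex[n]; rewrite sub0r normrN ger0_norm ?exprn_ge0// => ?.
by exists n.
Qed.

Section Positive.
Context {R : realType} {A : cstarAlgType R}.
Implicit Types (x y a b u v h k : A) (r s t d : R) (c : R[i]).

Lemma comm_lim (u : nat -> A) (e : nat -> R) (l y : A) :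
    (forall n, nrm (u n - l) <= e n) -> (forall d, 0 < d -> exists n, e n <= d) ->
    (forall n, y * u n = u n * y) -> y * l = l * y.
Proof.
move=> ul e0 yu; apply/eqP; rewrite -subr_eq0; apply/eqP/nrm_small => d d0.
have p : 0 < 2 * (nrm y + 1) by have := nrm_ge0 y; lra.
have [n en] := e0 _ (divr_gt0 d0 p).
have -> : y * l - l * y = (u n - l) * y - y * (u n - l).
  by rewrite mulrBl mulrBr yu; ncring R A.
have ule := le_trans (ul n) en.
apply: le_trans (nrmB _ _) _.
have -> : d = d / (2 * (nrm y + 1)) * (nrm y + 1) + (nrm y + 1) * (d / (2 * (nrm y + 1))).
  by field; have := nrm_ge0 y; lra.
by apply: lerD; apply: nrmM_le => //; lra.
Qed.

Lemma neumann_unit x : nrm x < 1 -> 1 - x \is a GRing.unit.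
Proof.
move=> x1; set q := nrm x in x1; have q0 : 0 <= q := nrm_ge0 x.
have q1 : 0 < 1 - q by lra.
have e0 d : 0 < d -> exists n, q ^+ n / (1 - q) <= d.
  move=> d0; have [|n hn] := @expr_small _ q (d * (1 - q)) _ (mulr_gt0 d0 q1).
    by rewrite q0.
  by exists n; rewrite ler_pdivrMr.
pose u n : A := \sum_(k < n) x ^+ k.
have uS n : u n.+1 = u n + x ^+ n by rewrite /u big_ord_recr.
have ue n m : (n <= m)%N -> nrm (u m - u n) <= (q ^+ n - q ^+ m) / (1 - q).
  elim: m => [|m IH]; first by rewrite leqn0 => /eqP ->; rewrite !subrr nrm0 mul0r.
  rewrite leq_eqVlt => /predU1P[->|]; first by rewrite !subrr nrm0 mul0r.
  rewrite ltnS => /IH {}IH; rewrite uS addrAC.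
  apply: le_trans (nrmD_le IH (nrmX _ _)) _; rewrite -/q.
  by rewrite ler_pdivlMr// mulrDl divfK ?gt_eqF// exprS; lra.
have [] := @cauchy_seq_lim _ _ u (fun n => q ^+ n / (1 - q)).
- move=> n m /ue/le_trans; apply; rewrite ler_pM2r ?invr_gt0//.
  by have := exprn_ge0 m q0; lra.
- exact: e0.
move=> l ul.
have xl : x * l = l * x.
  apply: comm_lim ul e0 _ => n; rewrite /u mulr_sumr mulr_suml.
  by apply: eq_bigr => k _; rewrite -exprS -exprSr.
have xu n : (1 - x) * u n = 1 - x ^+ n.
  by rewrite /u -opprB mulNr -subrX1 opprB.
have l1 : (1 - x) * l = 1.
  apply/eqP; rewrite -subr_eq0; apply/eqP/nrm_small => d d0.
  have [n en] := e0 _ (divr_gt0 d0 (ltr0n _ 3)).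
  have -> : (1 - x) * l - 1 = - ((1 - x) * (u n - l)) - x ^+ n.
    by rewrite mulrBr xu; ncring R A.
  apply: le_trans (nrmB _ _) _; rewrite nrmN.
  have en' : q ^+ n <= d / 3.
    apply: le_trans en; rewrite ler_peMr ?exprn_ge0// invf_ge1 ?lra//; lra.
  have -> : d = 2 * (d / 3) + d / 3 by field.
  apply: lerD; last exact: le_trans (nrmX _ _) en'.
  apply: nrmM_le; last exact: le_trans (ul n) en.
  by apply: le_trans (nrmB _ _) _; rewrite nrm1; lra.
apply/unitrP; exists l; split=> //.
by rewrite -[RHS]l1 mulrBl mulrBr xl mul1r mulr1.
Qed.

(** Solving [w * w = 1 - x] by [w = 1 - y] amounts to the fixed point equation
    [y = (x + y * y) / 2], of which these are the iterates from [0]. *)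
Fixpoint sqrt_iter x n : A :=
  if n is m.+1 then (2^-1)%:C *: (x + sqrt_iter x m * sqrt_iter x m) else 0.

(** The same iteration for the number [x = 1], where it converges to [1]; it
    dominates the iteration for every [x] of norm at most [1]. *)
Fixpoint sqrt_maj n : R := if n is m.+1 then (1 + sqrt_maj m ^+ 2) / 2 else 0.

Lemma sqrt_maj_itv n : 0 <= sqrt_maj n <= 1.
Proof.
elim: n => [|n /andP[h0 h1]] /=; first by rewrite lexx ler01.
by apply/andP; split; nra.
Qed.

Lemma sqrt_maj_gap n : 1 - sqrt_maj n <= 2 / n.+2%:R.
Proof.
elim: n => [|n IH] /=; first by rewrite subr0 divff.
have n2 : (2 : R) <= n.+2%:R by rewrite ler_nat.
have n2p : (0 : R) < n.+2%:R by [].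
have /andP[] := sqrt_maj_itv n; move: (sqrt_maj n) IH => s sn s0 s1.
rewrite -[n.+3]addn1 natrD; set N := n.+2%:R in n2 n2p sn *.
have i1 : N^-1 * N = 1 by rewrite mulVf// gt_eqF.
rewrite ler_pdivlMr; last lra.
have i2 : 0 < N^-1 by rewrite invr_gt0.
have i3 : N^-1 <= 2^-1 by rewrite lef_pV2// posrE.
move: (N^-1) i1 i2 i3 sn => i i1 i2 i3 sn.
have h : 1 - (1 + s ^+ 2) / 2 <= 2 * i - 2 * i ^+ 2.
  (* monotonicity of [t - t ^ 2 / 2] between [1 - s] and [2 i] *)
  have : 0 <= (2 * i - (1 - s)) * (2 - 2 * i - (1 - s)).
    by rewrite mulr_ge0//; lra.
  by nra.
have N1 : 0 <= N + 1 by lra.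
apply: le_trans (ler_wpM2r N1 h) _.
have -> : (2 * i - 2 * i ^+ 2) * (N + 1) = 2 * (i * N) * (1 - i) + 2 * i * (1 - i).
  by ring.
by rewrite i1; nra.
Qed.

Lemma sqrt_iter_comm x y n : y * x = x * y -> y * sqrt_iter x n = sqrt_iter x n * y.
Proof.
move=> yx; elim: n => [|n IH] /=; first by rewrite mulr0 mul0r.
rewrite -scalerAr -scalerAl mulrDr mulrDl yx; congr (_ *: (_ + _)).
by rewrite mulrA IH -mulrA IH mulrA.
Qed.

Lemma sqrt_iter_step x n : nrm x <= 1 ->
  nrm (sqrt_iter x n) <= sqrt_maj n /\
  nrm (sqrt_iter x n.+1 - sqrt_iter x n) <= sqrt_maj n.+1 - sqrt_maj n.
Proof.
move=> x1; elim: n => [|n [IH1 IH2]].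
  rewrite /= nrm0 mulr0 addr0 subr0 nrmZp; last by rewrite invr_ge0.
  by split=> //; rewrite expr0n/=; lra.
have IH1' : nrm (sqrt_iter x n.+1) <= sqrt_maj n.+1.
  have -> : sqrt_iter x n.+1 = sqrt_iter x n + (sqrt_iter x n.+1 - sqrt_iter x n).
    by ncring R A.
  by apply: le_trans (nrmD_le IH1 IH2) _; rewrite addrC subrK.
split=> //.
set y1 := sqrt_iter x n.+1 in IH1' IH2 *; set y0 := sqrt_iter x n in IH1 IH2.
have c01 : y0 * y1 = y1 * y0.
  by apply: sqrt_iter_comm; rewrite -sqrt_iter_comm.
have -> : sqrt_iter x n.+2 - y1 = (2^-1)%:C *: ((y1 - y0) * (y1 + y0)).
  have -> : (y1 - y0) * (y1 + y0) = y1 * y1 - y0 * y0.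
    by rewrite mulrDr !mulrBl c01; ncring R A.
  have e1 : y1 = (2^-1)%:C *: (x + y0 * y0) by [].
  have -> : sqrt_iter x n.+2 = (2^-1)%:C *: (x + y1 * y1) by [].
  by rewrite [X in _ - X = _]e1; ncring R A.
rewrite nrmZp ?invr_ge0//.
have -> : sqrt_maj n.+2 - sqrt_maj n.+1
   = 2^-1 * ((sqrt_maj n.+1 - sqrt_maj n) * (sqrt_maj n.+1 + sqrt_maj n)).
  by rewrite -[LHS]/((1 + sqrt_maj n.+1 ^+ 2) / 2 - (1 + sqrt_maj n ^+ 2) / 2); field.
rewrite ler_pM2l ?invr_gt0//.
exact: nrmM_le IH2 (nrmD_le IH1' IH1).
Qed.

Lemma sqrt_iter_cauchy x n m : nrm x <= 1 -> (n <= m)%N ->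
  nrm (sqrt_iter x m - sqrt_iter x n) <= sqrt_maj m - sqrt_maj n.
Proof.
move=> x1; elim: m => [|m IH]; first by rewrite leqn0 => /eqP ->; rewrite !subrr nrm0.
rewrite leq_eqVlt => /predU1P[->|]; first by rewrite !subrr nrm0.
rewrite ltnS => /IH {}IH.
have -> : sqrt_iter x m.+1 - sqrt_iter x n =
    (sqrt_iter x m.+1 - sqrt_iter x m) + (sqrt_iter x m - sqrt_iter x n).
  by ncring R A.
by apply: le_trans (nrmD_le (sqrt_iter_step m x1).2 IH) _; lra.
Qed.

Lemma inv_nat_small d : 0 < d -> exists n, 2 / n.+2%:R <= d.
Proof.
move=> d0; pose n := Num.truncn (2 / d); exists n.
rewrite ler_pdivrMr// -ler_pdivrMl// mulrC.
apply: ltW; apply: lt_le_trans (truncnS_gt _) _.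
by rewrite ler_nat ltnS leqnSn.
Qed.

Lemma star_lim (u : nat -> A) (e : nat -> R) (l : A) :
    (forall n, nrm (u n - l) <= e n) -> (forall d, 0 < d -> exists n, e n <= d) ->
    (forall n, star (u n) = u n) -> star l = l.
Proof.
move=> ul e0 us; apply/eqP; rewrite -subr_eq0; apply/eqP/nrm_small => d d0.
have [n en] := e0 _ (divr_gt0 d0 (ltr0n _ 2)).
have -> : star l - l = (u n - l) - star (u n - l) by rewrite starB us; ncring R A.
apply: le_trans (nrmB _ _) _; rewrite nrm_star [d]splitr.
by apply: lerD; apply: le_trans (ul n) en.
Qed.

(** The bound by [sqrt_maj] makes the iteration converge up to the boundary case
    [nrm x = 1], at the rate [1 / n]. *)
Lemma sqrt_sub1 x : star x = x -> nrm x <= 1 ->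
  exists w, [/\ star w = w, w * w = 1 - x, nrm (1 - w) <= 1
    & forall y, y * x = x * y -> y * w = w * y].
Proof.
move=> xs x1.
have e0 d : 0 < d -> exists n, 1 - sqrt_maj n <= d.
  by move=> /inv_nat_small[n hn]; exists n; apply: le_trans (sqrt_maj_gap n) hn.
have [||l ul] := @cauchy_seq_lim _ _ (sqrt_iter x) (fun n => 1 - sqrt_maj n).
- move=> n m nm; apply: le_trans (sqrt_iter_cauchy x1 nm) _.
  by rewrite lerD2r; have /andP[] := sqrt_maj_itv m.
- exact: e0.
have lx : x + l * l - 2%:C *: l = 0.
  apply: nrm_small => d d0.
  have [n en] := e0 _ (divr_gt0 d0 (ltr0n _ 8)).
  have un := sqrt_iter_cauchy x1 (leqnSn n).
  have bn := (sqrt_iter_step n x1).1; have ln := ul n.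
  have /andP[m1 m1'] := sqrt_maj_itv n; have /andP[m2 m2'] := sqrt_maj_itv n.+1.
  set u := sqrt_iter x n in bn ln; set u1 := sqrt_iter x n.+1 in un.
  have l2 : nrm l <= 2.
    have -> : l = u - (u - l) by ncring R A.
    by apply: le_trans (nrmB _ _) _; lra.
  have -> : x + l * l - 2%:C *: l
     = 2%:C *: (u1 - u) - (2%:C *: (l - u) - (l * (l - u) + (l - u) * u)).
    have -> : u1 = (2^-1)%:C *: (x + u * u) by [].
    by nc_coeffs R A; repeat split; field.
  have lu : nrm (l - u) <= d / 8 by rewrite nrmBC (le_trans ln en).
  have t1 : nrm (2%:C *: (u1 - u)) <= 2 * (d / 8).
    by rewrite nrmZp// ler_pM2l//; lra.
  have t2 : nrm (2%:C *: (l - u)) <= 2 * (d / 8) by rewrite nrmZp// ler_pM2l//.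
  have t3 : nrm (l * (l - u)) <= 2 * (d / 8) by apply: nrmM_le.
  have t4 : nrm ((l - u) * u) <= d / 8 * 1 by apply: nrmM_le => //; lra.
  have := nrmB (2%:C *: (u1 - u)) (2%:C *: (l - u) - (l * (l - u) + (l - u) * u)).
  have := nrmB (2%:C *: (l - u)) (l * (l - u) + (l - u) * u).
  have := nrmD (l * (l - u)) ((l - u) * u).
  lra.
exists (1 - l); split.
- rewrite starB star1; congr (_ - _); apply: star_lim ul e0 _.
  elim=> [|n IH] /=; first exact: star0.
  by rewrite starZr starD starM xs IH.
- by apply/eqP; rewrite -subr_eq0 -[X in _ == X]lx; apply/eqP; ncring R A.
- have -> : 1 - (1 - l) = l by ncring R A.
  by have := ul 0%N; rewrite /= sub0r nrmN subr0.
- move=> y yx; rewrite mulrBr mulrBl mulr1 mul1r; congr (_ - _).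
  by apply: comm_lim ul e0 _ => n; apply: sqrt_iter_comm.
Qed.

End Positive.

(** * Positive elements *)

Section CStarOrder.
Context {R : realType} {A : cstarAlgType R}.
Implicit Types (x y a b u v w g h k p : A) (r s t l d : R) (c : R[i]).

(** Positivity in metric terms: the spectrum of [h] lies in [[0, 2 t]].  In this
    form it is obvious that sums of positive elements are positive. *)
Definition npos h : Prop := star h = h /\ exists2 t : R, 0 <= t & nrm (t%:C%:A - h) <= t.

Lemma starA r : star (r%:C%:A : A) = r%:C%:A.
Proof. by rewrite starZr star1. Qed.

Lemma nposD h k : npos h -> npos k -> npos (h + k).
Proof.
move=> [hs [s s0 hs']] [ks [t t0 kt]]; split; first by rewrite starD hs ks.
exists (s + t); first exact: addr_ge0.
have -> : (s + t)%:C%:A - (h + k) = (s%:C%:A - h) + (t%:C%:A - k) by ncring R A.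
exact: nrmD_le.
Qed.

Lemma nposZ r h : 0 <= r -> npos h -> npos (r%:C *: h).
Proof.
move=> r0 [hs [s s0 hs']]; split; first by rewrite starZr hs.
exists (r * s); first exact: mulr_ge0.
have -> : (r * s)%:C%:A - r%:C *: h = r%:C *: (s%:C%:A - h) by ncring R A.
by rewrite nrmZp// ler_wpM2l.
Qed.

Lemma nposA r : 0 <= r -> npos (r%:C%:A).
Proof.
by move=> r0; split; [exact: starA | exists r; rewrite ?subrr ?nrm0].
Qed.

Lemma npos_bound r h : star h = h -> nrm h <= r -> npos (r%:C%:A - h).
Proof.
move=> hs hr; split; first by rewrite starB starA hs.
exists r; first exact: le_trans (nrm_ge0 _) hr.
by have -> : r%:C%:A - (r%:C%:A - h) = h by ncring R A.
Qed.

Lemma mulii : ('i * 'i : R[i]) = -1.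
Proof. by rewrite -expr2 sqrCi. Qed.

Lemma nrm_re_le u : nrm ((2^-1)%:C *: (u + star u)) <= nrm u.
Proof.
rewrite nrmZp ?invr_ge0//; have := nrmD u (star u); rewrite nrm_star; lra.
Qed.

(** [k] is the real part of [u = k + i w], and [star u * u = k * k + w * w]
    when [k] and [w] commute. *)
Lemma sq_norm_le k w : star k = k -> star w = w -> k * w = w * k ->
  nrm k ^+ 2 <= nrm (k * k + w * w).
Proof.
move=> ks ws kw; pose u := k + 'i *: w.
have us : star u = k - 'i *: w by rewrite starD starZi ks ws.
have -> : k * k + w * w = star u * u.
  have -> : star u * u = k * k + w * w - ('i * 'i + 1) *: (w * w) + 'i *: (k * w - w * k).
    by rewrite us /u; ncring R A.
  by rewrite mulii kw; ncring R A.
rewrite nrm_starM ler_sqr ?nnegrE ?nrm_ge0//.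
have {1}-> : k = (2^-1)%:C *: (u + star u).
  by rewrite us /u; nc_coeffs R A; repeat split; field.
exact: nrm_re_le.
Qed.

(** With [w * w = 1 - k * k], the element [k + i w] is unitary. *)
Lemma nrm_1Bsqr k : star k = k -> nrm k <= 1 -> nrm (1 - k * k) <= 1.
Proof.
move=> ks k1.
have [||w [ws ww _ wc]] := @sqrt_sub1 _ _ (k * k).
- by rewrite starM ks.
- by have := nrmM_le k1 k1; rewrite mulr1.
have wk : w * k = k * w by rewrite wc ?mulrA.
have := sq_norm_le ws ks wk; rewrite ww subrK nrm1 => w1.
by rewrite -ww (le_trans (nrmM w w))// -expr2.
Qed.

Lemma npos_sq k : star k = k -> npos (k * k).
Proof.
move=> ks; have [k0|k0] := eqVneq (nrm k) 0.
  by rewrite (nrm_eq0 k0) mulr0; have := nposA (lexx 0); rewrite scale0r.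
have kp : 0 < nrm k by rewrite lt_def k0 nrm_ge0.
pose k' := (nrm k)^-1%:C *: k.
have k1 : nrm k' <= 1 by rewrite nrmZp ?invr_ge0 ?nrm_ge0// mulVf.
have := nrm_1Bsqr _ k1; rewrite starZr ks => /(_ erefl) b1.
split; first by rewrite starM ks.
exists (nrm k ^+ 2); first exact: sqr_ge0.
have -> : (nrm k ^+ 2)%:C%:A - k * k = (nrm k ^+ 2)%:C *: (1 - k' * k').
  rewrite /k' -scalerAl -scalerAr scalerA scalerBr scalerA -!rmorphM /=.
  have -> : nrm k ^+ 2 * ((nrm k)^-1 * (nrm k)^-1) = 1 by field.
  by rewrite rmorph1 scale1r.
by rewrite nrmZp ?sqr_ge0// ler_piMr// sqr_ge0.
Qed.

Lemma npos_sqrt h : npos h -> exists k, [/\ star k = k, k * k = h, npos k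
  & forall y, y * h = h * y -> y * k = k * y].
Proof.
move=> [hs [t t0 ht]]; move: t0; rewrite le_eqVlt => /predU1P[t0|t0].
  have h0 : h = 0.
    apply: nrm_eq0; apply/eqP; rewrite eq_le nrm_ge0 andbT.
    by move: ht; rewrite -t0 scale0r sub0r nrmN.
  exists 0; rewrite h0; split; rewrite ?star0 ?mulr0//.
  by have := nposA (lexx 0); rewrite scale0r.
have tC : t%:C != 0 :> R[i] by rewrite (fmorph_eq0 (real_complex R)) gt_eqF.
have x1 : nrm (1 - t^-1%:C *: h) <= 1.
  have -> : 1 - t^-1%:C *: h = t^-1%:C *: (t%:C%:A - h).
    by rewrite fmorphV; nc_coeffs R A; repeat split; field.
  by rewrite nrmZp ?invr_ge0 ?(ltW t0)// ler_pdivrMl// mulr1.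
have [|w [ws ww w1 wc]] := sqrt_sub1 _ x1; first by rewrite starB star1 starZr hs.
have s0 : 0 <= Num.sqrt t := sqrtr_ge0 t.
have sC : (Num.sqrt t)%:C * (Num.sqrt t)%:C = t%:C :> R[i].
  by rewrite -rmorphM -expr2 sqr_sqrtr// ltW.
exists ((Num.sqrt t)%:C *: w); split.
- by rewrite starZr ws.
- rewrite -scalerAl -scalerAr ww scalerA sC fmorphV.
  by nc_coeffs R A; repeat split; field.
- split; first by rewrite starZr ws.
  exists (Num.sqrt t) => //.
  have -> : (Num.sqrt t)%:C%:A - (Num.sqrt t)%:C *: w = (Num.sqrt t)%:C *: (1 - w).
    by ncring R A.
  by rewrite nrmZp// ler_piMr.
- move=> y yh; rewrite -scalerAl -scalerAr; congr (_ *: _); apply: wc.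
  by rewrite mulrBr mulrBl -scalerAl -scalerAr yh mulr1 mul1r.
Qed.

Lemma unitZ c a : c != 0 -> (c *: a \is a GRing.unit) = (a \is a GRing.unit).
Proof.
move=> c0; have cu : c%:A \is a @GRing.unit A by rewrite scaler_unit ?unitr1// unitfE.
by rewrite -mulr_algl unitrMr.
Qed.

Lemma unit_big l g : nrm g < l -> l%:C%:A - g \is a GRing.unit.
Proof.
move=> gl; have l0 : 0 < l := le_lt_trans (nrm_ge0 _) gl.
have lC : l%:C != 0 :> R[i] by rewrite (fmorph_eq0 (real_complex R)) gt_eqF.
have -> : l%:C%:A - g = l%:C *: (1 - l^-1%:C *: g).
  by rewrite fmorphV; nc_coeffs R A; repeat split; field.
rewrite unitZ//; apply: neumann_unit.
by rewrite nrmZp ?invr_ge0 ?(ltW l0)// ltr_pdivrMl// mulr1.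
Qed.

Lemma npos_unit h l : npos h -> 0 < l -> l%:C%:A + h \is a GRing.unit.
Proof.
move=> [hs [t t0 ht]] l0.
have -> : l%:C%:A + h = (t + l)%:C%:A - (t%:C%:A - h) by ncring R A.
by apply: unit_big; apply: le_lt_trans ht _; rewrite ltrDl.
Qed.

Lemma starV a : a \is a GRing.unit -> star a^-1 = (star a)^-1.
Proof.
move=> au; have sau : star a \is a GRing.unit.
  by apply/unitrP; exists (star a^-1); rewrite -!starM mulVr ?mulrV ?star1.
by apply: (mulrI sau); rewrite mulrV// -starM mulVr// star1.
Qed.

(** The spectral radius of a self-adjoint element is its norm.  If
    [p = r ^ 2 - g * g], [r = nrm g], were invertible, then so would be its square root
    [w], and with [c = nrm p^-1] the positive element [c p - 1] would be a square [y * y]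
    with [y] commuting with [g]; then [c g * g + y * y = c r ^ 2 - 1] forces
    [c r ^ 2 <= c r ^ 2 - 1]. *)
Lemma nrm_in_spectrum g : star g = g -> 0 < nrm g ->
  (nrm g ^+ 2)%:C%:A - g * g \isn't a GRing.unit.
Proof.
move=> gs; set r := nrm g => r0; apply/negP; set p := _ - _ => pu.
have ps : star p = p by rewrite starB starA starM gs.
have gp : g * p = p * g by rewrite /p; ncring R A.
have : npos p.
  split=> //; exists (r ^+ 2); first exact: sqr_ge0.
  have -> : (r ^+ 2)%:C%:A - p = g * g by rewrite /p; ncring R A.
  by rewrite expr2 nrmM.
move=> /npos_sqrt[w [ws ww _ wc]].
have gw : g * w = w * g by apply: wc.
set c := nrm p^-1.
have pc : r ^+ 2 * c >= 1.
  rewrite -(nrm1 (A := A)) -(mulrV pu); apply: nrmM_le => //.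
  have wp := sq_norm_le ws gs (esym gw).
  rewrite -{1}ww (le_trans (nrmM _ _))// -expr2 (le_trans wp)// ww.
  have -> : p + g * g = (r ^+ 2)%:C%:A by rewrite /p; ncring R A.
  by rewrite nrmA ger0_norm ?sqr_ge0.
have ps' : star p^-1 = p^-1 by rewrite starV// ps.
have [z [zs zz _ zc]] := npos_sqrt (npos_bound ps' (lexx _)).
have c0 : 0 <= c by exact: nrm_ge0.
have comz y : y * p = p * y -> y * z = z * y.
  move=> yp; apply: zc.
  have yp' : y * p^-1 = p^-1 * y.
    by apply: (mulrI pu); rewrite !mulrA -yp mulrV// mul1r mulrK.
  by rewrite mulrBr mulrBl yp' -/c mulr_algl mulr_algr.
have wp : w * p = p * w by rewrite -ww mulrA.
have wz := comz _ wp; have gz := comz _ gp.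
pose y := w * z.
have ys : star y = y by rewrite starM ws zs -wz.
pose g' := (Num.sqrt c)%:C *: g.
have g's : star g' = g' by rewrite starZr gs.
have gy : g' * y = y * g'.
  by rewrite /g' /y -scalerAl -scalerAr mulrA gw -mulrA gz mulrA.
have := sq_norm_le g's ys gy.
have -> : g' * g' + y * y = (r ^+ 2 * c - 1)%:C%:A.
  have -> : y * y = p * (c%:C%:A - p^-1).
    by rewrite /y -zz -ww !mulrA -(mulrA w z w) -wz mulrA.
  rewrite mulrBr mulrV// /g' -scalerAl -scalerAr scalerA -rmorphM -expr2 sqr_sqrtr//.
  by rewrite /p; ncring R A.
rewrite nrmA nrmZp ?sqrtr_ge0// exprMn sqr_sqrtr// -/r ger0_norm ?subr_ge0//.
lra.
Qed.

(** Otherwise [s = nrm (r - g) > r = nrm g], and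
    [s ^ 2 - (r - g) * (r - g) = (s - r + g) * (s + r - g)] would be invertible. *)
Lemma npos_of_unit g : star g = g ->
  (forall l, 0 < l -> l%:C%:A + g \is a GRing.unit) -> npos g.
Proof.
move=> gs gu; split=> //; exists (nrm g); first exact: nrm_ge0.
set r := nrm g; rewrite leNgt; apply/negP; set k := _ - g => rs.
have ks : star k = k by rewrite starB starA gs.
have s0 : 0 < nrm k by exact: le_lt_trans (nrm_ge0 _) rs.
have /negP := nrm_in_spectrum ks s0; apply.
have -> : (nrm k ^+ 2)%:C%:A - k * k
    = ((nrm k - r)%:C%:A + g) * ((nrm k + r)%:C%:A - g).
  by rewrite {2 3}/k; ncring R A.
rewrite unitrMl; first by apply: gu; rewrite subr_gt0.
by apply: unit_big; rewrite -/r ltrDr.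
Qed.

Lemma npos_opp_eq0 g : npos g -> npos (- g) -> g = 0.
Proof.
move=> gp gn; apply: nrm_eq0; apply/eqP; apply: contraT => g0.
have r0 : 0 < nrm g by rewrite lt_def g0 nrm_ge0.
have /negP[] := nrm_in_spectrum gp.1 r0.
have -> : (nrm g ^+ 2)%:C%:A - g * g = ((nrm g)%:C%:A + g) * ((nrm g)%:C%:A - g).
  by ncring R A.
by rewrite unitrMl; apply: npos_unit.
Qed.

(** [x y] and [y x] have the same spectrum away from [0]. *)
Lemma unit_swap x y l : 0 < l ->
  l%:C%:A + x * y \is a GRing.unit -> l%:C%:A + y * x \is a GRing.unit.
Proof.
move=> l0 /unitrP[z [zl zr]].
have lC : l%:C != 0 :> R[i] by rewrite (fmorph_eq0 (real_complex R)) gt_eqF.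
have e1 : z * x * y = 1 - l%:C *: z by rewrite -zl; ncring R A.
have e2 : x * y * z = 1 - l%:C *: z by rewrite -zr; ncring R A.
apply/unitrP; exists (l^-1%:C *: (1 - y * z * x)); split.
- have -> : l^-1%:C *: (1 - y * z * x) * (l%:C%:A + y * x)
     = l^-1%:C *: (l%:C%:A + y * x - l%:C *: (y * z * x) - y * (z * x * y) * x).
    by ncring R A.
  by rewrite e1 fmorphV; nc_coeffs R A; repeat split; field.
- have -> : (l%:C%:A + y * x) * (l^-1%:C *: (1 - y * z * x))
     = l^-1%:C *: (l%:C%:A + y * x - l%:C *: (y * z * x) - y * (x * y * z) * x).
    by ncring R A.
  by rewrite e2 fmorphV; nc_coeffs R A; repeat split; field.
Qed.

(** The theorem of Fukamiya and Kaplansky.  Let [h = star x * x], let [m] be the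
    square root of [h * h], and let [n = m - h], which is twice the negative part of [h].
    For [y = x * n] one finds [star y * y = - n ^ 3 / 2 <= 0].  But [y * star y] is
    then positive, because [star y * y + y * star y] is a sum of squares, and it has the
    same spectrum as [star y * y] away from [0]; hence [n ^ 3 = 0], [n = 0], [h = m]. *)
Lemma npos_starM x : npos (star x * x).
Proof.
set h := star x * x; have hs : star h = h by rewrite starM starK.
have [m [ms mm mp mc]] := npos_sqrt (npos_sq hs).
have hm : h * m = m * h by apply: mc; rewrite mulrA.
pose n := m - h.
have ns : star n = n by rewrite starB ms hs.
have pn : (m + h) * n = 0.
  by rewrite mulrDl !mulrBr mm hm; ncring R A.
have np : n * (m + h) = 0.
  by rewrite mulrBl !mulrDr mm hm; ncring R A.
have n_pos : npos n.
  apply: npos_of_unit => // l l0.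
  have u2 : l%:C *: ((l%:C)%:A + 2%:C *: m) \is a GRing.unit.
    rewrite unitZ; last by rewrite (fmorph_eq0 (real_complex R)) gt_eqF.
    by apply: npos_unit => //; apply: nposZ.
  have e1 : (l%:C%:A + (m + h)) * (l%:C%:A + n) = l%:C *: ((l%:C)%:A + 2%:C *: m).
    have -> : (l%:C%:A + (m + h)) * (l%:C%:A + n) =
       l%:C *: (l%:C%:A + (m + h) + n) + (m + h) * n by ncring R A.
    by rewrite pn /n; ncring R A.
  have e2 : (l%:C%:A + n) * (l%:C%:A + (m + h)) = l%:C *: ((l%:C)%:A + 2%:C *: m).
    have -> : (l%:C%:A + n) * (l%:C%:A + (m + h)) =
       l%:C *: (l%:C%:A + (m + h) + n) + n * (m + h) by ncring R A.
    by rewrite np /n; ncring R A.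
  move: u2; rewrite -e1 unitrM_comm; last by rewrite /GRing.comm e1 e2.
  by case/andP.
have [q [qs qq _ _]] := npos_sqrt n_pos.
pose g := (2^-1)%:C *: (n * n * n).
have g_pos : npos g.
  apply: nposZ; first by rewrite invr_ge0.
  have -> : n * n * n = (q * n) * (q * n).
    have qn : q * n = n * q by rewrite -qq mulrA.
    by rewrite -{2}qq !mulrA -qn -(mulrA q n q) -qn mulrA.
  apply: npos_sq; rewrite starM ns qs.
  by rewrite -qq mulrA.
pose y := x * n.
have yy : star y * y = - g.
  rewrite /y starM ns mulrA -(mulrA n) -/h /g.
  have hE : h = (2^-1)%:C *: ((m + h) - n).
    by rewrite /n; nc_coeffs R A; repeat split; field.
  rewrite {1}hE -scalerAr -scalerAl (mulrBr n (m + h) n) np sub0r mulNr scalerN.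
  by [].
have yy' : npos (y * star y).
  pose a := (2^-1)%:C *: (y + star y).
  pose b := (2^-1)%:C *: ('i *: (star y - y)).
  have asa : star a = a by rewrite starZr starD starK addrC.
  have bsa : star b = b.
    by rewrite starZr starZi starB starK; congr (_ *: _); rewrite -scalerN opprB.
  have -> : y * star y = 2%:C *: (a * a + b * b) + g.
    have -> : g = - (star y * y) by rewrite yy opprK.
    have -> : b * b = (4^-1)%:C *: (('i * 'i) *: ((star y - y) * (star y - y))).
      by rewrite /b; nc_coeffs R A; repeat split; field.
    by rewrite mulii /a; nc_coeffs R A; repeat split; field.
  by apply: nposD => //; apply: nposZ => //; apply: nposD; apply: npos_sq.
have g_neg : npos (- g).
  rewrite -yy; apply: npos_of_unit; first by rewrite starM starK.
  by move=> l l0; apply: unit_swap => //; apply: npos_unit.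
have g0 : n * n * n = 0.
  have := npos_opp_eq0 g_pos g_neg; rewrite /g => /(congr1 (fun z => 2%:C *: z)).
  rewrite scalerA scaler0 -rmorphM mulfV// => <-.
  by rewrite rmorph1 scale1r.
have n0 : n = 0.
  have n2 : n * n = 0.
    apply: nrm_eq0; apply/eqP; rewrite -sqrf_eq0 -nrm_starM starM ns.
    by rewrite mulrA g0 mul0r nrm0.
  apply: nrm_eq0; apply/eqP; rewrite -sqrf_eq0 -nrm_starM ns.
  by rewrite n2 nrm0.
by have -> : h = m by apply/eqP; rewrite eq_sym -subr_eq0 -/n n0.
Qed.

Lemma cstar_posE h : cstar_pos h <-> npos h.
Proof.
split=> [[x ->]|/npos_sqrt[k [ks <- _ _]]]; first exact: npos_starM.
by exists k; rewrite ks.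
Qed.

End CStarOrder.

(** * Order, imaginary parts and resolvents *)

Section Resolvent.
Context {R : realType} {A : cstarAlgType R}.
Implicit Types (x y a b u v w g h k p q : A) (r s t e d K : R) (c : R[i]).

(** [(r + x) * (r - x)] is a product of commuting positive elements, hence a square,
    and [x * x] plus this square is [r ^ 2]. *)
Lemma nrm_pm r x : 0 <= r -> star x = x ->
  npos (r%:C%:A + x) -> npos (r%:C%:A - x) -> nrm x <= r.
Proof.
move=> r0 es /npos_sqrt[k [ks kk _ kc]] /npos_sqrt[l [ls ll _ lc]].
have ek : x * k = k * x by apply: kc; ncring R A.
have el : x * l = l * x by apply: lc; ncring R A.
have kl : k * l = l * k.
  by apply: lc; rewrite mulrBr mulrBl -ek mulr_algl mulr_algr.
have := @sq_norm_le _ _ x (k * l) es _ _.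
rewrite starM ks ls -kl mulrA ek -!mulrA el => /(_ erefl erefl).
have -> : x * x + k * (l * (k * l)) = (r ^+ 2)%:C%:A.
  rewrite (mulrA l k l) -kl -mulrA ll mulrA kk; ncring R A.
rewrite nrmA ger0_norm ?sqr_ge0//.
by rewrite ler_sqr ?nnegrE ?nrm_ge0.
Qed.

Lemma nrm_le_npos r h : 0 <= r -> npos h -> npos (r%:C%:A - h) -> nrm h <= r.
Proof.
move=> r0 hp hr; apply: nrm_pm => //; first exact: hp.1.
by apply: nposD => //; apply: nposA.
Qed.

Lemma nrm_mono p q : npos p -> npos q -> nrm p <= nrm (p + q).
Proof.
move=> pp qp; apply: nrm_le_npos => //; first exact: nrm_ge0.
have -> : (nrm (p + q))%:C%:A - p = ((nrm (p + q))%:C%:A - (p + q)) + q.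
  by ncring R A.
by apply: nposD => //; apply: npos_bound => //; exact: (nposD pp qp).1.
Qed.

Lemma npos_conj h u : npos h -> npos (star u * h * u).
Proof.
move=> /npos_sqrt[k [ks <- _ _]].
have -> : star u * (k * k) * u = star (k * u) * (k * u) by rewrite starM ks !mulrA.
exact: npos_starM.
Qed.

Lemma cstar_imE a : cstar_im a = (2^-1)%:C *: ('i *: (star a - a)).
Proof.
rewrite /cstar_im -opprB scalerN -scaleNr scalerA; congr (_ *: _).
have i0 : (2 * 'i : R[i]) != 0 by rewrite mulf_neq0// neq0Ci.
apply: (mulfI i0); rewrite mulrN mulfV// mulrACA mulii fmorphV rmorph_nat.
by rewrite divff ?mul1r// pnatr_eq0.
Qed.

Lemma im_sa a : star (cstar_im a) = cstar_im a.
Proof.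
rewrite cstar_imE starZr starZi starB starK; congr (_ *: _).
by rewrite -scalerN opprB.
Qed.

Lemma imD a b : cstar_im (a + b) = cstar_im a + cstar_im b.
Proof. by rewrite !cstar_imE starD; ncring R A. Qed.

Lemma imN a : cstar_im (- a) = - cstar_im a.
Proof. by rewrite !cstar_imE starN; ncring R A. Qed.

Lemma im_star a : cstar_im (star a) = - cstar_im a.
Proof. by rewrite !cstar_imE starK; ncring R A. Qed.

Lemma im_conj a u : cstar_im (star u * a * u) = star u * cstar_im a * u.
Proof. by rewrite !cstar_imE !starM starK; ncring R A. Qed.

Lemma im_sa0 a : star a = a -> cstar_im a = 0.
Proof. by rewrite cstar_imE => ->; rewrite subrr !scaler0. Qed.

Lemma im_i K : cstar_im (('i * K%:C) *: (1 : A)) = K%:C%:A.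
Proof.
rewrite cstar_imE -scalerA starZi starA.
have -> : - ('i *: K%:C%:A) - 'i *: (K%:C%:A : A) = - 2%:C *: ('i *: K%:C%:A).
  by ncring R A.
rewrite !scalerA; congr (_ *: _).
transitivity (- ('i * 'i) * K%:C : R[i]); first by field.
by rewrite mulii opprK mul1r.
Qed.

Lemma nrm_im a : nrm (cstar_im a) <= nrm a.
Proof.
rewrite cstar_imE nrmZp ?invr_ge0// nrmZi.
by have := nrmB (star a) a; rewrite nrm_star; lra.
Qed.

(** [Im a >= e 1]; [e] may be negative. *)
Definition im_ge e a := npos (cstar_im a - e%:C%:A).

Lemma im_posE a : im_pos a <-> exists2 e : R, 0 < e & im_ge e a.
Proof. by split=> -[e e0 /cstar_posE ?]; exists e. Qed.

Lemma im_ge_pert e d a h : im_ge e a -> nrm h <= d -> im_ge (e - d) (a + h).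
Proof.
move=> ea hd; rewrite /im_ge imD.
have -> : cstar_im a + cstar_im h - (e - d)%:C%:A =
    (cstar_im a - e%:C%:A) + (d%:C%:A - cstar_im (- h)) by rewrite imN; ncring R A.
apply: nposD => //; apply: npos_bound; first exact: im_sa.
by rewrite (le_trans (nrm_im _))// nrmN.
Qed.

Lemma im_geD e a h : im_ge e a -> npos (cstar_im h) -> im_ge e (a + h).
Proof.
move=> ea hp; rewrite /im_ge imD addrAC; exact: nposD.
Qed.

Lemma im_ge_shift e K a : im_ge e a -> im_ge (e + K) (a + ('i * K%:C) *: 1).
Proof.
rewrite /im_ge imD im_i; congr npos; ncring R A.
Qed.

Lemma im_ge_weak e d a : d <= e -> im_ge e a -> im_ge d a.
Proof.
move=> de ea; have := @im_ge_pert e (e - d) a 0 ea.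
by rewrite nrm0 subr_ge0 addr0 subKr => /(_ de).
Qed.

(** [Im (star u * a * u) >= e star u * u], and the norm is monotone on positive
    elements. *)
Lemma im_ge_lower e a u : 0 <= e -> im_ge e a -> e * nrm u <= nrm (a * u).
Proof.
move=> e0 ea; have [u0|u0] := eqVneq (nrm u) 0; first by rewrite u0 mulr0 nrm_ge0.
have up : 0 < nrm u by rewrite lt_def u0 nrm_ge0.
rewrite -(ler_pM2l up) -[X in _ <= X * _]nrm_star.
apply: le_trans (nrmM _ _).
rewrite mulrA; apply: le_trans (nrm_im _); rewrite im_conj.
have -> : star u * cstar_im a * u =
   e%:C *: (star u * u) + star u * (cstar_im a - e%:C%:A) * u by ncring R A.
apply: le_trans (nrm_mono _ _); last exact: npos_conj.
  by rewrite nrmZp// nrm_starM mulrCA expr2.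
by apply: nposZ => //; apply: npos_starM.
Qed.

Lemma nrmi_le K : nrm (('i * K%:C) *: (1 : A)) = `|K|.
Proof. by rewrite -scalerA nrmZi nrmA. Qed.

Lemma im_ge_nrmV e a : 0 < e -> im_ge e a -> a \is a GRing.unit -> nrm a^-1 <= e^-1.
Proof.
move=> e0 ea au; have := im_ge_lower a^-1 (ltW e0) ea.
by rewrite mulrV// nrm1 -ler_pdivlMl// mulr1.
Qed.

(** Invertibility propagates from [a + i K], [K] large, down to [a] in steps of
    length [e / 2], since the inverses met on the way are bounded by [1 / e]. *)
Lemma im_ge_unit e a : 0 < e -> im_ge e a -> a \is a GRing.unit.
Proof.
move=> e0 ea; pose b n := a + ('i * (n%:R * (e / 2))%:C) *: (1 : A).
have step n : b n.+1 \is a GRing.unit -> b n \is a GRing.unit.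
  move=> bu.
  have -> : b n = b n.+1 * (1 - (b n.+1)^-1 * (('i * (e / 2)%:C) *: 1)).
    rewrite mulrBr mulr1 mulrA mulrV// /b mul1r -[n.+1]addn1 natrD.
    by ncring R A.
  rewrite unitrMl; last first.
    apply: neumann_unit; apply: le_lt_trans (nrmM _ _) _.
    rewrite nrmi_le ger0_norm; last by rewrite ltW// divr_gt0.
    have bn : nrm (b n.+1)^-1 <= e^-1.
      apply: im_ge_nrmV => //.
      apply: im_ge_weak (im_ge_shift _ ea); rewrite lerDl mulr_ge0//.
      by rewrite ltW// divr_gt0.
    apply: le_lt_trans (ler_wpM2r _ bn) _; first by rewrite ltW// divr_gt0.
    by rewrite mulrA mulVf ?gt_eqF//; lra.
  by [].
have [n nb] : exists n, b n \is a GRing.unit.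
  pose n := Num.truncn (nrm a / (e / 2)); exists n.+1.
  have e2 : 0 < e / 2 by rewrite divr_gt0.
  have an : nrm a < n.+1%:R * (e / 2).
    by rewrite -ltr_pdivrMr// truncnS_gt.
  rewrite /b; set K := _ * (e / 2) in an *.
  have -> : a + ('i * K%:C) *: 1 = 'i *: (K%:C%:A - 'i *: a).
    have -> : 'i *: (K%:C%:A - 'i *: a) = ('i * K%:C)%:A - ('i * 'i) *: a.
      by ncring R A.
    by rewrite mulii; ncring R A.
  by rewrite unitZ ?neq0Ci//; apply: unit_big; rewrite nrmZi.
have : forall m, b (n - m)%N \is a GRing.unit.
  elim=> [|m IH]; first by rewrite subn0.
  have [nm|nm] := leqP n m.
    by move: IH; have -> : (n - m = n - m.+1)%N by lia.
  by apply: step; have -> : (n - m.+1).+1 = (n - m)%N by lia.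
by move=> /(_ n); rewrite subnn /b mul0r rmorph0 mulr0 scale0r addr0.
Qed.

Lemma im_ge_bound e a : 0 < e -> im_ge e a -> nrm a^-1 <= e^-1.
Proof. by move=> e0 ea; apply: im_ge_nrmV (im_ge_unit e0 ea). Qed.

Lemma im_inv e a : 0 < e -> im_ge e a -> npos (- cstar_im a^-1).
Proof.
move=> e0 ea; have au := im_ge_unit e0 ea.
have -> : - cstar_im a^-1 = e%:C *: (star a^-1 * a^-1)
     + star a^-1 * (cstar_im a - e%:C%:A) * a^-1.
  have -> : - cstar_im a^-1 = star a^-1 * cstar_im a * a^-1.
    by rewrite -im_conj -mulrA mulrV// mulr1 im_star.
  by ncring R A.
apply: nposD; last exact: npos_conj.
by apply: nposZ (ltW e0) _; apply: npos_starM.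
Qed.

Lemma resolvent_sub a b : a \is a GRing.unit -> b \is a GRing.unit ->
  a^-1 - b^-1 = a^-1 * (b - a) * b^-1.
Proof. by move=> au bu; rewrite mulrBr mulVr// mulrBl mul1r mulrK. Qed.

End Resolvent.

(** * Positive linear maps *)

Section PositiveMap.
Context {R : realType} {A A' : cstarAlgType R} (T : A -> A').
Hypothesis T_lin : linear T.
Hypothesis T_pos : forall a, cstar_pos a -> cstar_pos (T a).

Lemma lin0 : T 0 = 0.
Proof. by have := T_lin (-1) 0 0; rewrite !scaleN1r !addNr. Qed.
Lemma linD a b : T (a + b) = T a + T b.
Proof. by have := T_lin 1 a b; rewrite !scale1r. Qed.
Lemma linZ c a : T (c *: a) = c *: T a.
Proof. by have := T_lin c a 0; rewrite !addr0 lin0 addr0. Qed.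
Lemma linN a : T (- a) = - T a.
Proof. by rewrite -scaleN1r linZ scaleN1r. Qed.
Lemma linB a b : T (a - b) = T a - T b.
Proof. by rewrite linD linN. Qed.

Lemma pos_npos a : npos a -> npos (T a).
Proof. by move=> /cstar_posE/T_pos/cstar_posE. Qed.

(** [- nrm a <= a <= nrm a] gives [- nrm a T 1 <= T a <= nrm a T 1]. *)
Lemma pos_sa_bound a : star a = a -> star (T a) = T a /\ nrm (T a) <= nrm (T 1) * nrm a.
Proof.
move=> as_.
have pos1 : npos (T 1) by apply: pos_npos; have := @nposA R A 1 ler01; rewrite rmorph1 scale1r.
have h1 : npos (T ((nrm a)%:C%:A - a)) by apply/pos_npos/npos_bound.
have h2 : npos (T ((nrm a)%:C%:A + a)).
  by rewrite -[X in _ + X]opprK; apply/pos_npos/npos_bound; rewrite ?starN ?as_// nrmN.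
rewrite linD linZ in h2; rewrite linB linZ in h1.
have sa : star (T a) = T a.
  have -> : T a = ((nrm a)%:C *: T 1 + T a) - (nrm a)%:C *: T 1 by ncring R A'.
  by rewrite starB h2.1 starZr pos1.1.
split=> //.
have c : npos ((nrm (T 1) * nrm a)%:C%:A - (nrm a)%:C *: T 1).
  have -> : (nrm (T 1) * nrm a)%:C%:A - (nrm a)%:C *: T 1 =
     (nrm a)%:C *: ((nrm (T 1))%:C%:A - T 1) by ncring R A'.
  by apply: nposZ (nrm_ge0 _) _; apply: npos_bound (lexx _); exact: pos1.1.
apply: nrm_pm => //; first by rewrite mulr_ge0// nrm_ge0.
- have -> : (nrm (T 1) * nrm a)%:C%:A + T a = ((nrm (T 1) * nrm a)%:C%:A
     - (nrm a)%:C *: T 1) + ((nrm a)%:C *: T 1 + T a) by ncring R A'.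
  exact: nposD.
- have -> : (nrm (T 1) * nrm a)%:C%:A - T a = ((nrm (T 1) * nrm a)%:C%:A
     - (nrm a)%:C *: T 1) + ((nrm a)%:C *: T 1 - T a) by ncring R A'.
  exact: nposD.
Qed.

Lemma pos_star a : T (star a) = star (T a).
Proof.
pose x := (2^-1)%:C *: (a + star a); pose y := cstar_im a.
have xs : star x = x by rewrite starZr starD starK addrC.
have ys : star y = y := im_sa a.
have ax : a = x + 'i *: y.
  rewrite /x /y cstar_imE.
  have -> : 'i *: ((2^-1)%:C *: ('i *: (star a - a))) =
     ((2^-1)%:C * ('i * 'i)) *: (star a - a) by ncring R A.
  by rewrite mulii; nc_coeffs R A; repeat split; field.
have [Tx _] := pos_sa_bound xs; have [Ty _] := pos_sa_bound ys.
move: x y xs ys ax Tx Ty => x y xs ys -> Tx Ty.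
by rewrite starD starZi xs ys !linD linN !linZ starD starZi Tx Ty.
Qed.

Lemma pos_bound a : nrm (T a) <= 2 * nrm (T 1) * nrm a.
Proof.
pose x := (2^-1)%:C *: (a + star a); pose y := cstar_im a.
have xs : star x = x by rewrite starZr starD starK addrC.
have ys : star y = y := im_sa a.
have ax : a = x + 'i *: y.
  rewrite /x /y cstar_imE.
  have -> : 'i *: ((2^-1)%:C *: ('i *: (star a - a))) =
     ((2^-1)%:C * ('i * 'i)) *: (star a - a) by ncring R A.
  by rewrite mulii; nc_coeffs R A; repeat split; field.
have [_ Tx] := pos_sa_bound xs; have [_ Ty] := pos_sa_bound ys.
have h1 := nrm_re_le a; have h2 := nrm_im a; rewrite -/x -/y in h1 h2.
have t0 := nrm_ge0 (T 1).
move: x y {xs ys} ax Tx Ty h1 h2 => x y ax Tx Ty h1 h2.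
rewrite {1}ax linD linZ; apply: le_trans (nrmD _ _) _; rewrite nrmZi.
have := ler_wpM2l t0 h1; have := ler_wpM2l t0 h2; lra.
Qed.

End PositiveMap.

(** * Non-crossing pair partitions *)

Section PairPartitions.
Context {n : nat}.
Implicit Types (P Q : {set {set 'I_n}}) (V W : {set 'I_n}) (m i j s : 'I_n)
  (st : seq 'I_n) (k : nat).
Local Open Scope nat_scope.

Definition opener P m :=
  (finset.pblock P m != [set m]) && [forall j in finset.pblock P m, (m <= j)%N].
Definition closer P m :=
  (finset.pblock P m != [set m]) && [forall j in finset.pblock P m, (j <= m)%N].
(** Having only openers and closers means that all blocks have two elements. *)
Definition nc_pairing P := noncrossing P && [forall m, opener P m || closer P m].

Lemma noncrossing_partition P : noncrossing P -> finset.partition P [set: 'I_n].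
Proof. by case/andP. Qed.

Lemma mem_block P m : finset.partition P [set: 'I_n] -> m \in finset.pblock P m.
Proof. by move=> pP; rewrite finset.mem_pblock (finset.cover_partition pP) inE. Qed.

Lemma block_in P m : finset.partition P [set: 'I_n] -> finset.pblock P m \in P.
Proof. by move=> pP; apply: finset.pblock_mem; rewrite (finset.cover_partition pP) inE. Qed.

Lemma same_block P m j : finset.partition P [set: 'I_n] ->
  j \in finset.pblock P m -> finset.pblock P j = finset.pblock P m.
Proof. by case/and3P=> _ tP _; apply: finset.same_pblock. Qed.

Lemma block_def P V m : finset.partition P [set: 'I_n] ->
  V \in P -> m \in V -> finset.pblock P m = V.
Proof. by case/and3P=> _ tP _; apply: finset.def_pblock. Qed.

Lemma other_in_block P m : finset.partition P [set: 'I_n] ->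
  finset.pblock P m != [set m] -> exists2 p, p \in finset.pblock P m & p != m.
Proof.
move=> pP ne; apply/exists_inP; apply: contraR ne.
rewrite negb_exists_in => /forall_inP H; apply/eqP/setP => x; rewrite inE.
apply/idP/eqP => [xm|->]; last exact: mem_block.
by have /negPn/eqP := H x xm.
Qed.

Lemma closer_block P m : nc_pairing P -> closer P m ->
  exists2 p : 'I_n, p < m & finset.pblock P m = [set p; m].
Proof.
move=> /andP[/noncrossing_partition pP /forallP oc] /andP[ne /forall_inP mx].
have [p pm pne] := other_in_block pP ne.
have plt : p < m by rewrite ltn_neqAle pne mx.
exists p => //; apply/setP => x; rewrite !inE.
apply/idP/orP => [xm|[/eqP ->|/eqP ->]] //; last exact: mem_block.
have three (a b : 'I_n) : a \in finset.pblock P m -> b \in finset.pblock P m -> a < b -> b < m -> False.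
  move=> am bm ab bm'; have := oc b; rewrite /opener /closer (same_block pP bm).
  case/orP => /andP[_ /forall_inP H].
    by have := H _ am; rewrite leqNgt ab.
  by have := H m (mem_block _ pP); rewrite leqNgt bm'.
have [xp|xp|/val_inj ->] := ltngtP x p; last by left.
  by case: (three _ _ xm pm xp plt).
have := mx _ xm; rewrite leq_eqVlt => /predU1P[/val_inj ->|xlt]; first by right.
by case: (three _ _ pm xm xp xlt).
Qed.

(** State of a left-to-right scan stopped before position [k]: [Q] are the pairs
    already closed and [st] the positions still open, innermost first. *)
Record scan_inv k Q st : Prop := ScanInv {
  inv_pair : forall V, V \in Q -> exists a b : 'I_n, [/\ a < b, b < k & V = [set a; b]];
  inv_triv : forall V W i, V \in Q -> W \in Q -> i \in V -> i \in W -> V = W;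
  inv_cov : forall i, i < k -> i \in st \/ exists2 V, V \in Q & i \in V;
  inv_stk : forall s V, s \in st -> V \in Q -> s \notin V;
  inv_lt : forall s, s \in st -> s < k;
  inv_sort : sorted (fun a b : 'I_n => b < a) st;
  inv_nc : forall V W (a b c d : 'I_n), V \in Q -> W \in Q -> V != W ->
    a \in V -> b \in W -> c \in V -> d \in W -> a < b -> b < c -> c < d -> False;
  inv_open : forall V (a c s : 'I_n), V \in Q -> a \in V -> c \in V -> s \in st ->
    a < s -> s < c -> False
}.

(** [P] is a possible completion of the scan state. *)
Definition extends k Q st P :=
  (Q \subset P) && all (fun s => [forall j in finset.pblock P s, (j < k) ==> (j == s)]) st.

Lemma extendsP k Q st P : reflect
  ((forall V, V \in Q -> V \in P) /\
   (forall s j, s \in st -> j \in finset.pblock P s -> j < k -> j = s))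
  (extends k Q st P).
Proof.
apply: (iffP andP) => -[H1 H2].
  split=> [|s j /(allP H2)/forall_inP H js jk]; first by apply/fintype.subsetP.
  by have := H j js; rewrite jk => /eqP.
split; first by apply/fintype.subsetP.
by apply/allP => s sst; apply/forall_inP => j js; apply/implyP => jk; rewrite (H2 s j).
Qed.

Lemma inv_below k Q st V i : scan_inv k Q st -> V \in Q -> i \in V -> i < k.
Proof.
move=> I VQ; have [a [b [ab bk ->]]] := inv_pair I VQ.
by rewrite !inE => /orP[] /eqP ->//; apply: ltn_trans bk.
Qed.

Lemma scan_inv_open (kk : 'I_n) Q st :
  scan_inv kk Q st -> scan_inv kk.+1 Q (kk :: st).
Proof.
move=> I; split.
- move=> V /(inv_pair I)[a [b [ab bk ->]]]; exists a, b; split=> //.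
  exact: ltn_trans bk _.
- exact: inv_triv I.
- move=> i; rewrite ltnS leq_eqVlt => /predU1P[/val_inj ->|/(inv_cov I)[h|h]].
  + by left; rewrite inE eqxx.
  + by left; rewrite inE h orbT.
  + by right.
- move=> s V; rewrite inE => /predU1P[->|/(inv_stk I)]; last exact.
  by move=> VQ; apply/negP => /(inv_below I VQ); rewrite ltnn.
- move=> s; rewrite inE => /predU1P[->//|/(inv_lt I) sk].
  exact: ltn_trans sk _.
- have := inv_sort I; have := inv_lt I; case: st {I} => [//|s st] /= H ->.
  by rewrite andbT H// inE eqxx.
- exact: inv_nc I.
- move=> V a c s VQ aV cV; rewrite inE => /predU1P[->|sst]; last exact: (inv_open I VQ).
  by move=> _; rewrite ltnNge ltnW// (inv_below I VQ).
Qed.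

Lemma sorted_top s st j : sorted (fun a b : 'I_n => b < a) (s :: st) -> j \in st -> j < s.
Proof.
move=> /= so jst.
have tr : transitive (fun a b : 'I_n => b < a).
  by move=> a b c ab bc; apply: ltn_trans bc ab.
by have /allP H := order_path_min tr so; apply: H.
Qed.

Lemma scan_inv_close (kk : 'I_n) Q s st :
  scan_inv kk Q (s :: st) -> scan_inv kk.+1 ([set s; kk] |: Q) st.
Proof.
move=> I; have sk : s < kk by apply: (inv_lt I); rewrite inE eqxx.
have sQ V : V \in Q -> s \notin V by apply: (inv_stk I); rewrite inE eqxx.
have kQ V : V \in Q -> kk \notin V.
  by move=> VQ; apply/negP => /(inv_below I VQ); rewrite ltnn.
have newQ V i : V \in Q -> i \in V -> i \in [set s; kk] -> False.
  move=> VQ iV; rewrite !inE => /orP[] /eqP ii.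
    by move: (sQ _ VQ); rewrite -ii iV.
  by move: (kQ _ VQ); rewrite -ii iV.
have below i : i \in [set s; kk] -> i <= kk.
  by rewrite !inE => /orP[] /eqP -> //; apply: ltnW.
have tops j : j \in st -> j < s by apply: sorted_top; exact: inv_sort I.
have stst j : j \in st -> j \in s :: st by move=> h; rewrite inE h orbT.
split.
- move=> V; rewrite !inE => /predU1P[->|/(inv_pair I)[a [b [ab bk ->]]]].
    by exists s, kk; split.
  by exists a, b; split=> //; apply: ltn_trans bk _.
- move=> V W i; rewrite !inE => /predU1P[->|VQ] /predU1P[->|WQ] //.
  + by move=> h1 h2; case: (newQ _ _ WQ h2 h1).
  + by move=> h1 h2; case: (newQ _ _ VQ h1 h2).
  + exact: (inv_triv I).
- move=> i; rewrite ltnS leq_eqVlt => /predU1P[/val_inj ->|/(inv_cov I)[]].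
  + by right; exists [set s; kk]; rewrite !inE eqxx ?orbT.
  + rewrite inE => /predU1P[->|]; last by left.
    by right; exists [set s; kk]; rewrite !inE eqxx.
  + by move=> [V VQ iV]; right; exists V => //; rewrite !inE VQ orbT.
- move=> j V jst; rewrite !inE => /predU1P[->|VQ]; last exact: (inv_stk I (stst _ jst)).
  rewrite !inE negb_or; apply/andP; split; apply/eqP => jj.
    by have := tops _ jst; rewrite jj ltnn.
  by have := inv_lt I (stst _ jst); rewrite jj ltnn.
- by move=> j /stst/(inv_lt I) h; apply: ltn_trans h _.
- by have := inv_sort I => /=; case: (st) => //= ? ? /andP[].
- move=> V W a b c d; rewrite !inE => /predU1P[->|VQ] /predU1P[->|WQ]; last exact: (inv_nc I).
  + by rewrite eqxx.
  + move=> _ aV bW cV dW ab bc cd; have dk := inv_below I WQ dW.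
    move: aV cV; rewrite !inE => /orP[] /eqP aE /orP[] /eqP cE;
      rewrite ?aE ?cE in ab bc cd; lia.
  + move=> _ aV bW cV dW ab bc cd; have ck := inv_below I VQ cV.
    move: bW; rewrite !inE => /orP[] /eqP bE; rewrite bE in ab bc; last lia.
    by apply: (inv_open I VQ aV cV (s := s)) => //; rewrite inE eqxx.
- move=> V a c j; rewrite !inE => /predU1P[->|VQ]; last first.
    by move=> aV cV jst; apply: (inv_open I VQ aV cV (stst _ jst)).
  rewrite !inE => /orP[] /eqP -> cc jst aj jc.
    by have := ltn_trans aj (tops _ jst); rewrite ltnn.
  have := inv_lt I (stst _ jst) => jk.
  by have := ltn_trans aj jk; rewrite ltnn.
Qed.

Lemma extends_open (kk : 'I_n) Q st P : scan_inv kk Q st -> nc_pairing P ->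
  extends kk Q st P && opener P kk = extends kk.+1 Q (kk :: st) P.
Proof.
move=> I ncP; have /andP[/noncrossing_partition pP /forallP oc] := ncP.
apply/andP/extendsP => [[/extendsP[QP sP] /andP[ne /forall_inP mn]]|[QP sP]].
  split=> // s j; rewrite inE => /predU1P[->|sst] js.
    by rewrite ltnS => jk; apply: val_inj; apply/eqP; rewrite eqn_leq jk mn.
  rewrite ltnS leq_eqVlt => /predU1P[/val_inj jk|]; last exact: sP.
  have sk := inv_lt I sst.
  have := mn s; rewrite -jk (same_block pP js) mem_block// => /(_ erefl).
  by rewrite jk leqNgt sk.
split; first by apply/extendsP; split=> // s j sst js jk;
  apply: (sP s j) => //; rewrite ?inE ?sst ?orbT// ltnS ltnW.
have /orP[//|/andP[ne /forall_inP mx]] := oc kk.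
have [p pk pne] := other_in_block pP ne.
have := sP kk p; rewrite inE eqxx ltnS mx// => /(_ erefl pk erefl) pE.
by rewrite pE eqxx in pne.
Qed.

(** By non-crossingness a closer is paired with the innermost open position. *)
Lemma extends_close (kk : 'I_n) Q s st P : scan_inv kk Q (s :: st) -> nc_pairing P ->
  extends kk Q (s :: st) P && ~~ opener P kk = extends kk.+1 ([set s; kk] |: Q) st P.
Proof.
move=> I ncP; have /andP[ncrP /forallP oc] := ncP; have pP := noncrossing_partition ncrP.
have sk : s < kk by apply: (inv_lt I); rewrite inE eqxx.
have tops j : j \in st -> j < s by apply: sorted_top; exact: inv_sort I.
apply/andP/extendsP => [[/extendsP[QP sP] no]|[QP sP]].
  have [p pk bk] : exists2 p : 'I_n, p < kk & finset.pblock P kk = [set p; kk].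
    by apply: closer_block => //; have := oc kk; rewrite (negbTE no).
  have pb : finset.pblock P p = [set p; kk].
    by rewrite -bk; apply: same_block => //; rewrite bk !inE eqxx.
  have ps : p = s.
    have [|[V VQ pV]] := inv_cov I pk; last first.
      have := inv_below I VQ (i := kk); rewrite -(block_def pP (QP _ VQ) pV) pb.
      by rewrite !inE eqxx orbT ltnn => /(_ erefl).
    rewrite inE => /predU1P[//|pst].
    have plt := tops _ pst.
    have sne : finset.pblock P s != [set s].
      by have /orP[] := oc s => /andP[].
    have [q qs qne] := other_in_block pP sne.
    have qk : kk <= q.
      rewrite leqNgt; apply/negP => qk; move/eqP: qne; apply.
      by apply: sP qs qk; rewrite inE eqxx.
    have qk' : kk < q.
      rewrite ltn_neqAle qk andbT; apply/eqP => /val_inj kq.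
      move: qs; rewrite -kq => ks.
      have := same_block pP ks; rewrite bk => bs.
      have := mem_block s pP; rewrite -bs !inE => /orP[] /eqP sE.
        by rewrite sE ltnn in plt.
      by rewrite sE ltnn in sk.
    move: ncrP => /andP[_ /forall_inP H].
    have /forall_inP H' := H _ (block_in kk pP).
    have /implyP H'' := H' _ (block_in s pP).
    have : finset.pblock P kk != finset.pblock P s.
      apply/eqP => e; have := mem_block s pP; rewrite -e bk !inE => /orP[] /eqP sE.
        by rewrite sE ltnn in plt.
      by rewrite sE ltnn in sk.
    move=> /H''/negP[]; apply/exists_inP; exists p; first by rewrite bk !inE eqxx.
    apply/exists_inP; exists s; first exact: mem_block.
    apply/exists_inP; exists kk; first exact: mem_block.
    by apply/exists_inP; exists q => //; rewrite plt sk qk'.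
  split.
    move=> V; rewrite !inE => /predU1P[->|/QP//].
    by rewrite -ps -bk; apply: block_in.
  move=> j i jst ij; rewrite ltnS leq_eqVlt => /predU1P[/val_inj ik|ik]; last first.
    by apply: (sP j i) => //; rewrite inE jst orbT.
  have := mem_block j pP; rewrite -(same_block pP ij) ik bk ps !inE => /orP[] /eqP jE.
    by have := tops _ jst; rewrite jE ltnn.
  by have := ltn_trans (tops _ jst) sk; rewrite jE ltnn.
have bV : [set s; kk] \in P by apply: QP; rewrite !inE eqxx.
have bk : finset.pblock P kk = [set s; kk].
  by apply: block_def => //; rewrite !inE eqxx orbT.
have bs : finset.pblock P s = [set s; kk].
  by apply: block_def => //; rewrite !inE eqxx.
split; last first.
  rewrite /opener negb_and; apply/orP; right.
  apply/negP => /forall_inP /(_ s); rewrite bk !inE eqxx leqNgt sk => /(_ erefl).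
  by [].
apply/extendsP; split=> [V VQ|j i]; first by apply: QP; rewrite !inE VQ orbT.
rewrite inE => /predU1P[->|jst] ij ik; last by apply: sP ij _ => //; apply: ltnW.
by move: ij ik; rewrite bs !inE => /orP[] /eqP -> //; rewrite ltnn.
Qed.

Lemma extends_close0 (kk : 'I_n) Q P : scan_inv kk Q [::] -> nc_pairing P ->
  extends kk Q [::] P && ~~ opener P kk = false.
Proof.
move=> I ncP; have /andP[ncrP /forallP oc] := ncP; have pP := noncrossing_partition ncrP.
apply/negP => /andP[/extendsP[QP _] no].
have [p pk bk] : exists2 p : 'I_n, p < kk & finset.pblock P kk = [set p; kk].
  by apply: closer_block => //; have := oc kk; rewrite (negbTE no).
have pb : finset.pblock P p = [set p; kk].
  by rewrite -bk; apply: same_block => //; rewrite bk !inE eqxx.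
have [//|[V VQ pV]] := inv_cov I pk.
have := inv_below I VQ (i := kk); rewrite -(block_def pP (QP _ VQ) pV) pb.
by rewrite !inE eqxx orbT ltnn => /(_ erefl).
Qed.

Lemma extends_full_nil Q P : scan_inv n Q [::] ->
  nc_pairing P && extends n Q [::] P = (P == Q).
Proof.
move=> I; apply/andP/eqP => [[/andP[/noncrossing_partition pP _] /extendsP[QP _]]|->].
  apply/setP => V; apply/idP/idP => [VP|]; last exact: QP.
  have [V0|[x xV]] := set_0Vmem V.
    by move: VP; rewrite V0; case/and3P: pP => _ _ /negbTE ->.
  have [//|[W WQ xW]] := inv_cov I (ltn_ord x).
  by rewrite -(block_def pP VP xV) (block_def pP (QP _ WQ) xW).
have pQ : finset.partition Q [set: 'I_n].
  apply/and3P; split.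
  - apply/eqP/setP => x; rewrite !inE; have [//|[W WQ xW]] := inv_cov I (ltn_ord x).
    by apply/bigcupP; exists W.
  - apply/finset.trivIsetP => V W VQ WQ VW; rewrite -setI_eq0; apply/eqP/setP => x.
    rewrite !inE; apply/negP => /andP[xV xW].
    by move/eqP: VW; apply; apply: (inv_triv I) xV xW.
  - apply/negP => /(inv_pair I)[a [b [_ _]]] /setP/(_ a).
    by rewrite !inE eqxx.
split; last by apply/extendsP; split.
apply/andP; split.
  apply/andP; split=> //; apply/forall_inP => V VQ; apply/forall_inP => W WQ.
  apply/implyP => VW; apply/negP => /exists_inP[a aV] /exists_inP[b bW].
  move=> /exists_inP[c cV] /exists_inP[d dW] /and3P[ab bc cd].
  exact: (inv_nc I VQ WQ VW aV bW cV dW ab bc cd).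
apply/forallP => m; rewrite /opener /closer.
have [a [b [ab _ bE]]] := inv_pair I (block_in m pQ).
have := mem_block m pQ; rewrite bE !inE => mab.
have -> : [set a; b] != [set m].
  apply/eqP => /setP e; have := e a; have := e b; rewrite !inE !eqxx orbT => /esym/eqP bm /esym/eqP am.
  by rewrite bm am ltnn in ab.
have /orP[/eqP ->|/eqP ->] := mab; apply/orP; [left|right]; rewrite /=;
  apply/forall_inP => x; rewrite !inE => /orP[] /eqP -> //; exact: ltnW.
Qed.

Lemma extends_full_cons Q s st P : scan_inv n Q (s :: st) ->
  nc_pairing P && extends n Q (s :: st) P = false.
Proof.
move=> I; apply/negP => /andP[/andP[/noncrossing_partition pP /forallP oc]].
move=> /extendsP[_ sP].
have sne : finset.pblock P s != [set s] by have /orP[] := oc s => /andP[].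
have [q qs qne] := other_in_block pP sne.
by move/eqP: qne; apply; apply: sP qs _ => //; rewrite inE eqxx.
Qed.

Lemma scan_inv0 : scan_inv 0 finset.set0 [::].
Proof.
split=> //.
- by move=> V; rewrite inE.
- by move=> V W i; rewrite inE.
- by move=> V W a b c d; rewrite inE.
Qed.

Definition cut_blocks P k : {set {set 'I_n}} :=
  [set V in P | [exists i in V, i < k] && [exists j in V, k <= j]].

(** The height of the stack of the string evaluator. *)
Definition depth P k : nat := #|cut_blocks P k|.

Lemma depth_step P (kk : 'I_n) : finset.partition P [set: 'I_n] ->
  depth P kk.+1 + (closer P kk && ~~ opener P kk) = depth P kk + opener P kk.
Proof.
rewrite /depth => pP; set V := finset.pblock P kk.
have VP : V \in P := block_in kk pP.
have kV : kk \in V := mem_block kk pP.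
have other W : W \in P -> W != V -> (W \in cut_blocks P kk.+1) = (W \in cut_blocks P kk).
  move=> WP WV; rewrite !inE WP /=.
  have kW i : i \in W -> i != kk.
    by move=> iW; apply: contraNneq WV => ik; rewrite -(block_def pP WP iW) ik.
  congr (_ && _); apply/exists_inP/exists_inP => -[i iW ik]; exists i => //.
  - by rewrite ltn_neqAle kW// -ltnS.
  - by rewrite ltnS ltnW.
  - exact: ltnW.
  - by rewrite ltn_neqAle eq_sym kW.
have D : cut_blocks P kk.+1 :\ V = cut_blocks P kk :\ V.
  apply/setP => W; rewrite 2!in_setD1; have [//|WV] := eqVneq W V.
  have [WP|WP] := boolP (W \in P); first by rewrite other.
  by rewrite !inE (negbTE WP).
rewrite [in LHS](cardsD1 V) [in RHS](cardsD1 V) D.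
have V0 : (V \in cut_blocks P kk) = [exists i in V, i < kk].
  rewrite inE VP /=; have -> : [exists j in V, kk <= j] = true.
    by apply/exists_inP; exists kk.
  by rewrite andbT.
have V1 : (V \in cut_blocks P kk.+1) = [exists j in V, kk < j].
  rewrite inE VP /=; have -> : [exists i in V, i < kk.+1] = true.
    by apply/exists_inP; exists kk.
  by [].
rewrite V0 V1 /opener /closer -/V.
have -> : [forall j in V, kk <= j] = ~~ [exists i in V, i < kk].
  by rewrite negb_exists_in; apply: eq_forallb_in => i _; rewrite leqNgt.
have -> : [forall j in V, j <= kk] = ~~ [exists i in V, kk < i].
  by rewrite negb_exists_in; apply: eq_forallb_in => i _; rewrite leqNgt.
have [VE|Vne] /= := eqVneq V [set kk].
  have -> : [exists i in V, i < kk] = false.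
    by apply/negbTE/negP => /exists_inP[j]; rewrite VE inE => /eqP ->; rewrite ltnn.
  have -> : [exists i in V, kk < i] = false.
    by apply/negbTE/negP => /exists_inP[j]; rewrite VE inE => /eqP ->; rewrite ltnn.
  by [].
have : [exists i in V, i < kk] || [exists i in V, kk < i].
  have [p pV pk] := other_in_block pP Vne.
  have [ltp|ltp|/val_inj e] := ltngtP p kk; last by rewrite e eqxx in pk.
    by apply/orP; left; apply/exists_inP; exists p.
  by apply/orP; right; apply/exists_inP; exists p.
by case: [exists i in V, i < kk]; case: [exists i in V, kk < i] => //=;
  rewrite ?addn0 ?add0n ?addn1 ?add1n.
Qed.

Lemma depth0 P : depth P 0 = 0.
Proof.
by apply: eq_card0 => V; rewrite !inE; apply/negP => /and3P[_ /exists_inP[]].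
Qed.

Lemma depth_full P : depth P n = 0.
Proof.
apply: eq_card0 => V; rewrite !inE; apply/negP => /and3P[_ _ /exists_inP[i _]].
by rewrite leqNgt ltn_ord.
Qed.

End PairPartitions.

(** * Sums over non-crossing partitions as Fock space expectations *)

Section FockMachine.
Context {R : realType} {B : cstarAlgType R} (eta : B -> B).
Hypothesis eta_lin : linear eta.
Implicit Types (st bs : seq B) (b c cur : B).

(** Vacuum expectation of a word in full Fock space over [B]: [None] stands for
    creation plus annihilation, [Some b] for multiplication by [b], and [cur :: st] is
    the elementary tensor reached so far. *)
Fixpoint fock (st : seq B) (cur : B) (w : seq (option B)) : B :=
  match w with
  | [::] => if st is [::] then cur else 0
  | Some b :: w' => fock st (cur * b) w'
  | None :: w' =>
      fock (cur :: st) 1 w' +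
      (if st is c :: st' then fock st' (c * eta cur) w' else 0)
  end.

(** The word [S b_1 S b_2 ... S] with [n] letters [S]; missing arguments
    count as [1]. *)
Fixpoint alternating_word (n : nat) (bs : seq B) : seq (option B) :=
  if n is m.+1 then
    None :: (if bs is b :: bs' then Some b :: alternating_word m bs' else alternating_word m [::])
  else [::].

Let F := semicircular_cumulants eta.

Lemma letter_open n (P : {set {set 'I_n}}) m : opener P m -> letter_at B P m = LOpen B.
Proof. by rewrite /opener /letter_at => /andP[/negbTE -> ->]. Qed.

Lemma letter_close n (P : {set {set 'I_n}}) m :
  ~~ opener P m -> closer P m -> letter_at B P m = LClose B.
Proof.
by rewrite /opener /closer /letter_at => + /andP[ne ->]; rewrite ne (negbTE ne) /= => /negbTE ->.
Qed.

Lemma letter_other n (P : {set {set 'I_n}}) m : finset.partition P [set: 'I_n] ->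
  ~~ opener P m -> ~~ closer P m ->
  letter_at B P m = LOne B \/ letter_at B P m = LComma B /\ (0 < depth P m)%N.
Proof.
move=> pP; rewrite /opener /closer /letter_at; case: eqP => [_|ne] /=; first by left.
move=> no nc; right; rewrite (negbTE no) (negbTE nc); split=> //.
rewrite /depth; apply/card_gt0P; exists (finset.pblock P m); rewrite inE block_in//=.
move: no nc; rewrite !negb_forall_in => /exists_inP[i iV im] /exists_inP[j jV mj].
apply/andP; split; apply/exists_inP; first by exists i => //; rewrite ltnNge.
by exists j => //; rewrite ltnW// ltnNge.
Qed.

Definition eval_rest (stk : seq (seq B * B)) args cur (ls : seq (letter B)) bs :=
  eval_string F stk args (cur * head 1 bs) (interleave ls (behead bs)).

Lemma eval_letter stk args cur l (ls : seq (letter B)) bs : (forall b, l <> LArg b) ->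
  eval_string F stk args cur (interleave (l :: ls) bs) =
  match l with
  | LOpen => eval_rest ((args, cur) :: stk) [::] 1 ls bs
  | LComma => eval_rest stk (rcons args cur) 1 ls bs
  | LOne => eval_rest stk args (cur * F [::]) ls bs
  | LClose => if stk is (args', cur') :: stk' then
       eval_rest stk' args' (cur' * F (rcons args cur)) ls bs else 0
  | LArg _ => 0
  end.
Proof.
rewrite /eval_rest; case: l => [||||b H] //; last by case: (H b).
- by case: bs => [|b bs] /=; rewrite ?mulr1//; case: ls.
- by case: bs => [|b bs] /=; case: stk => [//|[a' c'] stk]; rewrite /= ?mulr1//; case: ls.
- by case: bs => [|b bs] /=; rewrite ?mulr1//; case: ls.
- by case: bs => [|b bs] /=; rewrite ?mulr1//; case: ls.
Qed.

Lemma letter_not_arg n (P : {set {set 'I_n}}) m b : letter_at B P m <> LArg b.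
Proof. by rewrite /letter_at; do 3?case: ifP. Qed.

(** A state that can only evaluate to [0]: a pending factor vanishes, or an
    unfinished cumulant already has an argument, and so has order above [2]. *)
Fixpoint doomed (stk : seq (seq B * B)) (args : seq B) (cur : B) : bool :=
  (cur == 0) || (if stk is (args', cur') :: stk' then
     (args != [::]) || doomed stk' args' cur' else false).

Lemma doomed_mul stk args cur b : doomed stk args cur -> doomed stk args (cur * b).
Proof.
case: stk => [|[a c] stk] /=; first by rewrite !orbF => /eqP ->; rewrite mul0r.
by case/orP => [/eqP ->|->]; rewrite ?mul0r ?eqxx ?orbT.
Qed.

Lemma eta0 : eta 0 = 0. Proof. exact: lin0. Qed.

(** A block that is not a pair produces a vanishing factor or a cumulant of order
    above [2].  The depth shows that the evaluation ends with an empty stack, so that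
    the factor [0] does reach the result. *)
Lemma doomed_eval n (P : {set {set 'I_n}}) j k stk args cur bs :
  finset.partition P [set: 'I_n] -> (k + j = n)%N -> size stk = depth P k ->
  doomed stk args cur ||
    has (fun m => ~~ (opener P m || closer P m)) (drop k (enum 'I_n)) ->
  eval_string F stk args cur
    (interleave [seq letter_at B P m | m <- drop k (enum 'I_n)] bs) = 0.
Proof.
move=> pP; elim: j k stk args cur bs => [|j IH] k stk args cur bs.
  rewrite addn0 => ->; rewrite depth_full drop_oversize ?size_enum_ord// orbF.
  by case: stk => //= _ /orP[/eqP ->|//].
move=> kj sz; have kn : (k < n)%N by lia.
pose kk := Ordinal kn.
have dE : drop k (enum 'I_n) = kk :: drop k.+1 (enum 'I_n).
  by rewrite (drop_nth kk) ?size_enum_ord// (nth_ord_enum kk kk).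
rewrite dE [map _ _]/= eval_letter; last by move=> b; apply: letter_not_arg.
have step : (depth P k.+1 + (closer P kk && ~~ opener P kk)
   = depth P k + opener P kk)%N := depth_step kk pP.
have IH' stk' args' cur' : size stk' = depth P k.+1 ->
    doomed stk' args' cur' ||
      has (fun m => ~~ (opener P m || closer P m)) (drop k.+1 (enum 'I_n)) ->
    eval_rest stk' args' cur' [seq letter_at B P m | m <- drop k.+1 (enum 'I_n)] bs = 0.
  move=> h1 h2; apply: IH => //; first by lia.
  by case/orP: h2 => [/doomed_mul ->//|->]; rewrite orbT.
have [op|nop] := boolP (opener P kk).
  rewrite (letter_open op) /= op /= => h; apply: IH' => /=.
    by move: step; rewrite op andbF /=; lia.
  by case/orP: h => [->|->]; rewrite !orbT.
have [cl|ncl] := boolP (closer P kk).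
  rewrite (letter_close nop cl) /= cl orbT /=.
  move: step; rewrite nop cl (negbTE nop) /= => step.
  case: stk sz => [|[a' c'] stk] /= sz h; first by [].
  apply: IH'; first by lia.
  case/orP: h => [h|->]; last by rewrite orbT.
  apply/orP; left; case/orP: h => [/eqP ->|/orP[h|h]].
  - have -> : F (rcons args 0) = 0.
      by rewrite /F; case: args => [|? [|? ?]] //=; rewrite ?eta0.
    by rewrite mulr0; case: stk {sz} => [|[? ?] ?] /=; rewrite eqxx.
  - have -> : F (rcons args cur) = 0 by move: h; rewrite /F; case: args => [|? [|? ?]].
    by rewrite mulr0; case: stk {sz} => [|[? ?] ?] /=; rewrite eqxx.
  - exact: doomed_mul.
have stepE : depth P k.+1 = depth P k.
  by move: step; rewrite (negbTE nop) (negbTE ncl) /=; lia.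
have [->|[-> cp]] := letter_other pP nop ncl => h.
  apply: IH'; first by rewrite stepE.
  by rewrite /F /= mulr0; case: (stk) => [|[? ?] ?] /=; rewrite eqxx.
apply: IH'; first by rewrite stepE.
move: sz cp; rewrite -[val kk]/k => <-; case: (stk) => [//|[? ?] ?] _ /=.
by apply/orP; left; apply/orP; right; apply/orP; left; case: (args).
Qed.

(** Summing over the completions of a scan state runs through both choices for
    each next letter, exactly as [fock] does; for the bijection it is enough that a
    completed scan has a single completion, itself ([extends_full_nil]). *)
Lemma fock_sum n j k Q (st : seq 'I_n) (cs : seq B) cur bs :
  (k + j = n)%N -> scan_inv (n := n) k Q st -> size cs = size st ->
  \sum_(P : {set {set 'I_n}} | nc_pairing P && extends k Q st P)
     eval_string F [seq ([::], c) | c <- cs] [::] cur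
       (interleave [seq letter_at B P m | m <- drop k (enum 'I_n)] bs)
  = fock cs cur (alternating_word j bs).
Proof.
elim: j k Q st cs cur bs => [|j IH] k Q st cs cur bs.
  rewrite addn0 => -> I; rewrite drop_oversize ?size_enum_ord//=.
  case: st I => [|s st] I; case: cs => [|c cs]//= _.
    by rewrite (eq_bigl (pred1 Q)) ?big_pred1_eq// => P; rewrite extends_full_nil.
  by rewrite big_pred0// => P; rewrite extends_full_cons.
move=> kj I sz; have kn : (k < n)%N by lia.
pose kk := Ordinal kn.
have dE : drop k (enum 'I_n) = kk :: drop k.+1 (enum 'I_n).
  by rewrite (drop_nth kk) ?size_enum_ord// (nth_ord_enum kk kk).
have swE st' cur' : fock st' cur'
    (if bs is b :: bs' then Some b :: alternating_word j bs' else alternating_word j [::])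
    = fock st' (cur' * head 1 bs) (alternating_word j (behead bs)).
  by case: bs => [|b bs] //=; rewrite mulr1.
rewrite [alternating_word _ _]/= [RHS]/= (bigID (fun P => opener P kk)) /=; congr (_ + _).
  rewrite swE -(IH k.+1 Q (kk :: st) (cur :: cs)) /=;
    [|by lia|exact: (@scan_inv_open _ kk Q st I)|by rewrite sz].
  apply: eq_big => [P|P /andP[_ op]].
    by have [ncP|] := boolP (nc_pairing P); rewrite //= (extends_open (kk := kk)).
  by rewrite dE [map _ (_ :: _)]/= eval_letter ?(letter_open op)//= => b;
    rewrite -(letter_open op); apply: letter_not_arg.
case: st I sz => [|s st] I; case: cs => [|c cs]//= sz.
  rewrite big_pred0// => P; have [ncP|] := boolP (nc_pairing P) => //=.
  by rewrite (extends_close0 (kk := kk)).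
rewrite swE -(IH k.+1 ([set s; kk] |: Q) st cs) /=;
    [|by lia|exact: (@scan_inv_close _ kk Q s st I)|by case: sz].
apply: eq_big => [P|P /andP[/andP[ncP _] op]].
  by have [ncP|] := boolP (nc_pairing P); rewrite //= (extends_close (kk := kk)).
have cl : closer P kk.
  by have /andP[_ /forallP/(_ kk)] := ncP; rewrite (negbTE op).
by rewrite dE [map _ (_ :: _)]/= eval_letter ?(letter_close op cl).
Qed.

Lemma nc_sum_fock n bs :
  \sum_(P : {set {set 'I_n}} | noncrossing P) partition_eval F P bs
  = fock [::] 1 (alternating_word n bs).
Proof.
rewrite -(fock_sum (n := n) (k := 0) (Q := finset.set0) (st := [::]) (cs := [::])) //;
  last exact: scan_inv0.
rewrite (bigID (@nc_pairing n)) /= [X in _ + X]big1; last first.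
  move=> P /andP[ncP npP]; have pP := noncrossing_partition ncP.
  rewrite /partition_eval -[enum _]drop0; apply: (doomed_eval (j := n)) => //.
    by rewrite depth0.
  move: npP; rewrite /nc_pairing ncP /= drop0 => /forallPn[m hm].
  by rewrite orbC; apply/orP; left; apply/hasP; exists m; rewrite ?mem_enum.
rewrite addr0; apply: eq_big => [P|P _]; last by rewrite drop0.
rewrite andb_idl; last by case/andP.
rewrite andb_idr// => _; apply/extendsP; split=> // V; by rewrite inE.
Qed.

End FockMachine.

(** * Moments of a semicircular element *)

Section SplitSum.
Context {B : Type} {V : nmodType}.
Implicit Types (w r : seq (option B)).

(** Sum of [f r1 r2] over the decompositions of a word as [r1 ++ None :: r2]. *)
Fixpoint splitsum w (f : seq (option B) -> seq (option B) -> V) : V :=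
  if w is x :: w' then
    (if x is None then f [::] w' else 0) + splitsum w' (fun r1 r2 => f (x :: r1) r2)
  else 0.

Lemma eq_splitsum w f g :
  (forall r1 r2, (size r1 + size r2).+1 = size w -> f r1 r2 = g r1 r2) ->
  splitsum w f = splitsum w g.
Proof.
elim: w f g => [//|x w IH] f g fg /=; congr (_ + _).
  by case: x fg => // fg; apply: fg.
by apply: IH => r1 r2 sz; apply: fg => /=; rewrite addSn sz.
Qed.

Lemma splitsumD w f g :
  splitsum w (fun r1 r2 => f r1 r2 + g r1 r2) = splitsum w f + splitsum w g.
Proof.
elim: w f g => [|[b|] w IH] f g /=; first by rewrite addr0.
  by rewrite !add0r IH.
by rewrite IH addrACA.
Qed.

Lemma splitsum_assoc w (f : seq (option B) -> seq (option B) -> seq (option B) -> V) :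
  splitsum w (fun s1 s2 => splitsum s1 (fun r1 r3 => f r1 r3 s2)) =
  splitsum w (fun r1 r2 => splitsum r2 (fun r3 s2 => f r1 r3 s2)).
Proof.
elim: w f => [//|x w IH] f /=; rewrite splitsumD addrA.
congr (_ + _); last exact: (IH (fun r1 r3 s2 => f (x :: r1) r3 s2)).
case: x => [b|] /=; last by rewrite add0r.
by rewrite add0r; elim: w {IH} => [//|[?|] w IH'] /=; rewrite add0r.
Qed.

End SplitSum.

Lemma splitsum_morph (B : Type) (V V' : nmodType) (h : V -> V') w
    (f : seq (option B) -> seq (option B) -> V) :
  h 0 = 0 -> (forall a b, h (a + b) = h a + h b) ->
  h (splitsum w f) = splitsum w (fun r1 r2 => h (f r1 r2)).
Proof.
move=> h0 hD; elim: w f => [//|x w IH] f /=.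
by rewrite hD IH; case: x => [?|]; rewrite ?h0.
Qed.

Section FockWords.
Context {R : realType} {B : cstarAlgType R} (eta : B -> B).
Hypothesis eta_lin : linear eta.
Implicit Types (st bs l : seq B) (b c cur : B) (w : seq (option B)).

Let fock_levels l w := if l is cur :: st then fock eta st cur w else 0.

(** Additivity in each tensor factor, stated for all of them at once since
    a step of the machine moves the factors. *)
Lemma fock_levelsD l1 a b l2 w :
  fock_levels (l1 ++ (a + b) :: l2) w =
  fock_levels (l1 ++ a :: l2) w + fock_levels (l1 ++ b :: l2) w.
Proof.
have eD := linD eta_lin.
elim: w l1 a b l2 => [|[d|] w IH] l1 a b l2.
- by case: l1 => [|x [|y l1]] /=; [case: l2 | |]; rewrite ?addr0.
- case: l1 => [|x l1] /=; last exact: (IH (x * d :: l1)).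
  by rewrite mulrDl; apply: (IH [::]).
case: l1 => [|x l1] /=.
  rewrite -[fock _ _ _ _]/(fock_levels ([:: 1] ++ (a + b) :: l2) w) IH /= addrACA.
  congr (_ + _); case: l2 => [|c l2] /=; first by rewrite addr0.
  by rewrite eD mulrDr; apply: (IH [::]).
rewrite -[fock _ _ _ _]/(fock_levels ([:: 1, x & l1] ++ (a + b) :: l2) w) IH /= addrACA.
congr (_ + _); case: l1 => [|c l1] /=; first by rewrite mulrDl; apply: (IH [::]).
exact: (IH (c * eta x :: l1)).
Qed.

Lemma fockD st a b w : fock eta st (a + b) w = fock eta st a w + fock eta st b w.
Proof. exact: (fock_levelsD [::]). Qed.

Lemma fock0 st w : fock eta st 0 w = 0.
Proof. by apply: (addrI (fock eta st 0 w)); rewrite -fockD !addr0. Qed.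

Lemma fock_levels_mul l a b w :
  fock_levels (rcons l (a * b)) w = a * fock_levels (rcons l b) w.
Proof.
elim: w l a b => [|[d|] w IH] l a b.
- by case: l => [|x [|y l]] /=; rewrite ?mulr0.
- case: l => [|x l] /=; last exact: (IH (x * d :: l)).
  by rewrite -mulrA; apply: (IH [::]).
case: l => [|x l] /=; first by rewrite !addr0; apply: (IH [:: 1]).
rewrite mulrDr; congr (_ + _); first exact: (IH [:: 1, x & l]).
case: l => [|c l] /=; first by rewrite -mulrA; apply: (IH [::]).
exact: (IH (c * eta x :: l)).
Qed.

Lemma fock_mull a b w : fock eta [::] (a * b) w = a * fock eta [::] b w.
Proof. exact: (fock_levels_mul [::]). Qed.

Lemma fock_mulr st cur w b : fock eta st cur (rcons w (Some b)) = fock eta st cur w * b.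
Proof.
elim: w st cur => [|[d|] w IH] st cur /=.
- by case: st; rewrite ?mul0r.
- exact: IH.
- by rewrite mulrDl IH; congr (_ + _); case: st; rewrite ?mul0r.
Qed.

Let m w := fock eta [::] 1 w.

(** First return: the level on top of [c] disappears at some letter [None] of the
    word, and what was read before that letter is a closed excursion, which contributes
    its own vacuum expectation. *)
Lemma fock_pop st c cur w :
  fock eta (c :: st) cur w =
  splitsum w (fun r1 r2 => fock eta st (c * eta (cur * m r1)) r2).
Proof.
have [N] := ubnP (size w); elim: N st c cur w => [//|N IH] st c cur [//|[b|] w] /= wN.
  rewrite add0r IH//; apply: eq_splitsum => r1 r2 _.
  by rewrite /m /= mul1r -[b in RHS]mulr1 fock_mull mulrA.
rewrite addrC {2}/m /= mulr1; congr (_ + _).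
rewrite IH//.
under [RHS]eq_splitsum => s1 s2 sz.
  rewrite addr0 IH; last by move: wN; rewrite -sz; lia.
  rewrite (splitsum_morph (h := fun x => fock eta st (c * eta (cur * x)) s2)).
    over.
  - by rewrite mulr0 lin0// mulr0 fock0.
  - by move=> a b; rewrite mulrDr linD// mulrDr fockD.
rewrite (splitsum_assoc w (fun r1 r3 s2 => fock eta st (c * eta (cur *
   fock eta [::] (1 * eta (1 * m r1)) r3)) s2)).
apply: eq_splitsum => r1 r2 sz; rewrite IH; last by move: wN; rewrite -sz; lia.
apply: eq_splitsum => r3 s2 _.
by rewrite !mul1r -[eta (m r1)]mulr1 fock_mull mulr1 mulrA.
Qed.

(** Schwinger-Dyson recursion of the semicircular moments. *)
Lemma fock_cons_None w :
  fock eta [::] 1 (None :: w) =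
  splitsum w (fun r1 r2 => eta (fock eta [::] 1 r1) * fock eta [::] 1 r2).
Proof.
rewrite /= addr0 fock_pop; apply: eq_splitsum => r1 r2 _.
by rewrite !mul1r -[eta (m r1)]mulr1 fock_mull mulr1.
Qed.

End FockWords.

Section ProbSpace.
Context {R : realType} {B : cstarAlgType R} (M : cstar_prob_space B).
Implicit Types (x y : M) (b c : B).

Lemma cexp_incl b : cexp M (incl M b) = b.
Proof.
by have := cexp_bimod b (1 : M) 1; rewrite !mulr1 cexp1 rmorph1 !mulr1.
Qed.

Lemma cexp_mull b x : cexp M (incl M b * x) = b * cexp M x.
Proof. by have := cexp_bimod b x 1; rewrite rmorph1 !mulr1. Qed.

Lemma cexp_mulr x b : cexp M (x * incl M b) = cexp M x * b.
Proof. by have := cexp_bimod 1 x b; rewrite rmorph1 !mul1r. Qed.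

End ProbSpace.

Section Words.
Context {R : realType} {B : cstarAlgType R}.
Implicit Types (b c cur : B) (w : seq (option B)) (bs : seq B).

Section Eval.
Context (M : cstar_prob_space B) (S : M).

Fixpoint word_eval w : M :=
  match w with
  | [::] => 1
  | Some b :: w' => incl M b * word_eval w'
  | None :: w' => S * word_eval w'
  end.

Lemma word_eval_cat w1 w2 : word_eval (w1 ++ w2) = word_eval w1 * word_eval w2.
Proof. by elim: w1 => [|[b|] w IH] /=; rewrite ?mul1r// IH mulrA. Qed.

Lemma moment_word_eval bs : moment S bs = cexp M (word_eval (alternating_word (size bs).+1 bs)).
Proof.
rewrite /moment; congr (cexp M _).
have foldE (y : M) : foldl (fun m b => m * incl M b * S) (y * S) bs
   = y * word_eval (alternating_word (size bs).+1 bs).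
  elim: bs y => [|b bs IH] y /=; first by rewrite mulr1.
  by rewrite IH /= !mulrA.
by have := foldE 1; rewrite !mul1r.
Qed.

End Eval.

(** Every word evaluates to [b0], or to [b0 S b_1 S ... b_n S b'] with
    [bs = [:: b_1; ...; b_n]], to which the definition of moments applies. *)
Fixpoint normal_form w : B * option (seq B * B) :=
  match w with
  | [::] => (1, None)
  | Some b :: w' => let: (b0, r) := normal_form w' in (b * b0, r)
  | None :: w' => let: (b0, r) := normal_form w' in
      (1, Some (if r is Some (bs, b1) then (b0 :: bs, b1) else ([::], b0)))
  end.

Definition normal_value (f : seq B -> B) w : B :=
  let: (b0, r) := normal_form w in
  if r is Some (bs, b1) then b0 * f bs * b1 else b0.

Lemma cexp_normal (M : cstar_prob_space B) (S : M) w :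
  cexp M (word_eval S w) = normal_value (moment S) w.
Proof.
have evwE : word_eval S w = let: (b0, r) := normal_form w in
    if r is Some (bs, b1) then incl M b0 * word_eval S (alternating_word (size bs).+1 bs) * incl M b1
    else incl M b0.
  elim: w => [|[b|] w /= ->]; first by rewrite /= rmorph1.
  - by case: (normal_form w) => b0 [[bs b1]|]; rewrite rmorphM // !mulrA.
  - by case: (normal_form w) => b0 [[bs b1]|]; rewrite /= rmorph1 mul1r ?mulr1 ?mulrA.
rewrite evwE /normal_value; case: (normal_form w) => b0 [[bs b1]|].
  by rewrite cexp_bimod moment_word_eval.
exact: cexp_incl.
Qed.

Lemma fock_normal (eta : B -> B) w : linear eta ->
  fock eta [::] 1 w = normal_value (fun bs => fock eta [::] 1 (alternating_word (size bs).+1 bs)) w.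
Proof.
move=> eta_lin.
have fE st cur : fock eta st cur w = let: (b0, r) := normal_form w in
    if r is Some (bs, b1) then
      fock eta st (cur * b0) (rcons (alternating_word (size bs).+1 bs) (Some b1))
    else fock eta st (cur * b0) [::].
  elim: w st cur => [|[b|] w IH] st cur /=; first by rewrite mulr1.
  - by rewrite IH; case: (normal_form w) => b0 [[bs b1]|]; rewrite mulrA.
  - rewrite IH; case: (normal_form w) IH => b0 [[bs b1]|] IH; rewrite mulr1 /=;
      congr (_ + _); by case: st => [|c st] //; rewrite IH.
rewrite fE /normal_value; case: (normal_form w) => b0 [[bs b1]|]; rewrite mul1r//.
by rewrite fock_mulr -[b0 in LHS]mulr1 fock_mull.
Qed.

Lemma same_distribution_word_eval (M N : cstar_prob_space B) (X : M) (Y : N) w :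
  same_distribution X Y -> cexp M (word_eval X w) = cexp N (word_eval Y w).
Proof.
move=> XY; rewrite !cexp_normal /normal_value.
by case: (normal_form w) => b0 [[bs b1]|] //; rewrite XY.
Qed.

End Words.

Section SemicircularWords.
Context {R : realType} {B : cstarAlgType R} (M : cstar_prob_space B) (S : M).
Context (eta : B -> B).
Hypothesis eta_lin : linear eta.
Hypothesis S_semi : semicircular eta S.
Implicit Types (b c cur : B) (w : seq (option B)) (x y : M).

Lemma cexp_word_eval w : cexp M (word_eval S w) = fock eta [::] 1 w.
Proof.
rewrite cexp_normal (fock_normal _ eta_lin) /normal_value.
case: (normal_form w) => b0 [[bs b1]|] //.
by rewrite S_semi.2 nc_sum_fock.
Qed.

(** Image of the free difference quotient of the word under
    [u (x) v |-> eta (E (x u)) v]. *)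
Fixpoint word_deriv w x : M :=
  match w with
  | [::] => 0
  | Some b :: w' => word_deriv w' (x * incl M b)
  | None :: w' => incl M (eta (cexp M x)) * word_eval S w' + word_deriv w' (x * S)
  end.

Lemma word_derivE w x :
  word_deriv w x = splitsum w (fun r1 r2 => incl M (eta (cexp M (x * word_eval S r1))) * word_eval S r2).
Proof.
elim: w x => [//|[b|] w IH] x /=; rewrite IH ?add0r ?mulr1.
  by apply: eq_splitsum => r1 r2 _; rewrite mulrA.
by congr (_ + _); apply: eq_splitsum => r1 r2 _; rewrite mulrA.
Qed.

Lemma semicircular_word w : cexp M (S * word_eval S w) = cexp M (word_deriv w 1).
Proof.
rewrite -[S * _]/(word_eval S (None :: w)) cexp_word_eval fock_cons_None// word_derivE.
rewrite (splitsum_morph (h := cexp M)); [|exact: linear0|exact: linearD].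
by apply: eq_splitsum => r1 r2 _; rewrite mul1r cexp_mull !cexp_word_eval.
Qed.

Lemma word_deriv_cat w1 w2 x :
  word_deriv (w1 ++ w2) x = word_deriv w1 x * word_eval S w2 + word_deriv w2 (x * word_eval S w1).
Proof.
elim: w1 x => [|[b|] w IH] x /=; first by rewrite mul0r add0r mulr1.
  by rewrite IH !mulrA.
by rewrite IH word_eval_cat mulrDl !mulrA addrA.
Qed.

Lemma word_derivD w x y : word_deriv w (x + y) = word_deriv w x + word_deriv w y.
Proof.
elim: w x y => [|[b|] w IH] x y /=; rewrite ?addr0// mulrDl IH//.
by rewrite [cexp M _]linearD (linD eta_lin) [incl M _]linearD mulrDl addrACA.
Qed.

Lemma word_deriv0 w : word_deriv w 0 = 0.
Proof. by apply: (addrI (word_deriv w 0)); rewrite -word_derivD !addr0. Qed.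

End SemicircularWords.

(** * The Schwinger-Dyson equation *)

(** Noncommutative polynomials over [B] in two variables; they have to be formal
    since the derivative below depends on the expression and not on its value. *)
Inductive term (B : Type) : Type :=
  | TConst of B
  | TVar of bool
  | TAdd of term B & term B
  | TMul of term B & term B.
Arguments TVar {B}.

Section Terms.
Context {R : realType} {B : cstarAlgType R} (M : cstar_prob_space B) (Y S : M).
Context (eta : B -> B).
Hypothesis eta_lin : linear eta.
Implicit Types (b c : B) (x y q : M) (t s : term B) (v : bool).

Let Z v : M := if v then Y else S.

Fixpoint term_eval t : M :=
  match t with
  | TConst b => incl M b
  | TVar v => Z v
  | TAdd s t => term_eval s + term_eval t
  | TMul s t => term_eval s * term_eval t
  end.

(** Image of the free difference quotient in [S] under
    [u (x) v |-> eta (E (x u)) v]: each occurrence of [S] is in turn replaced by [eta E]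
    of [x] times what precedes it. *)
Fixpoint term_deriv t x : M :=
  match t with
  | TConst _ => 0
  | TVar v => if v then 0 else incl M (eta (cexp M x))
  | TAdd s t => term_deriv s x + term_deriv t x
  | TMul s t => term_deriv s x * term_eval t + term_deriv t (x * term_eval s)
  end.

Fixpoint over v t : bool :=
  match t with
  | TConst _ => true
  | TVar u => u == v
  | TAdd s t | TMul s t => over v s && over v t
  end.

Lemma term_derivD t x y : term_deriv t (x + y) = term_deriv t x + term_deriv t y.
Proof.
elim: t x y => [b|[]|s IHs t IHt|s IHs t IHt] x y /=.
- by rewrite addr0.
- by rewrite addr0.
- by rewrite [cexp M _]linearD (linD eta_lin) [incl M _]linearD.
- by rewrite IHs IHt addrACA.
- by rewrite IHs !mulrDl IHt addrACA.
Qed.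

Lemma term_deriv0 t : term_deriv t 0 = 0.
Proof. by apply: (addrI (term_deriv t 0)); rewrite -term_derivD !addr0. Qed.

Lemma term_derivN t x : term_deriv t (- x) = - term_deriv t x.
Proof. by apply/eqP; rewrite -addr_eq0 -term_derivD addNr term_deriv0. Qed.

Lemma gen_one v : gen_star_alg (Z v) 1.
Proof. by rewrite -(rmorph1 (incl M)); apply: gen_base. Qed.

Lemma gen_zero v : gen_star_alg (Z v) 0.
Proof. by rewrite -(rmorph0 (incl M)); apply: gen_base. Qed.

Lemma gen_sub v x y : gen_star_alg (Z v) x -> gen_star_alg (Z v) y ->
  gen_star_alg (Z v) (x - y).
Proof. by move=> gx gy; apply: gen_add => //; rewrite -scaleN1r; apply: gen_scale. Qed.

Lemma gen_term_eval v t : over v t -> gen_star_alg (Z v) (term_eval t).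
Proof.
elim: t => [b|u|s IHs t IHt|s IHs t IHt] /=.
- by move=> _; apply: gen_base.
- by move=> /eqP ->; apply: gen_elt.
- by move=> /andP[/IHs ? /IHt ?]; apply: gen_add.
- by move=> /andP[/IHs ? /IHt ?]; apply: gen_mul.
Qed.

Lemma gen_term_deriv t x : over false t -> gen_star_alg S x -> gen_star_alg S (term_deriv t x).
Proof.
elim: t x => [b|[]|s IHs t IHt|s IHs t IHt] x //=.
- by move=> _ _; apply: (gen_zero false).
- by move=> _ _; apply: gen_base.
- by move=> /andP[? ?] gx; apply: gen_add; [apply: IHs|apply: IHt].
- move=> /andP[os ot] gx; apply: gen_add.
    by apply: gen_mul; [apply: IHs|apply: (gen_term_eval (v := false))].
  by apply: IHt => //; apply: gen_mul => //; apply: (gen_term_eval (v := false)).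
Qed.

Lemma term_deriv_over_true t x : over true t -> term_deriv t x = 0.
Proof.
elim: t x => [b|[]|s IHs t IHt|s IHs t IHt] x //= /andP[os ot].
  by rewrite IHs// IHt// addr0.
by rewrite IHs// IHt// mul0r addr0.
Qed.

(** The derivative only sees the values [E (x u)] with [u] generated by [S]. *)
Lemma term_deriv_orth t x : over false t ->
  (forall u, gen_star_alg S u -> cexp M (x * u) = 0) -> term_deriv t x = 0.
Proof.
elim: t x => [b|[]|s IHs t IHt|s IHs t IHt] x //=.
- by move=> _ /(_ 1 (gen_one false)); rewrite mulr1 => ->; rewrite lin0// raddf0.
- by move=> /andP[os ot] H; rewrite IHs// IHt// addr0.
- move=> /andP[os ot] H; rewrite IHs// mul0r add0r IHt// => u gu.
  by rewrite -mulrA; apply: H; apply: gen_mul => //; apply: (gen_term_eval (v := false)).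
Qed.

Fixpoint expand t : seq (seq (option B)) :=
  match t with
  | TConst b => [:: [:: Some b]]
  | TVar _ => [:: [:: None]]
  | TAdd s t => expand s ++ expand t
  | TMul s t => [seq w1 ++ w2 | w1 <- expand s, w2 <- expand t]
  end.

Lemma term_eval_expand v t : over v t -> term_eval t = \sum_(w <- expand t) word_eval (Z v) w.
Proof.
elim: t => [b|u|s IHs t IHt|s IHs t IHt] /=.
- by rewrite big_seq1 /= mulr1.
- by move=> /eqP ->; rewrite big_seq1 /= mulr1.
- by move=> /andP[/IHs -> /IHt ->]; rewrite big_cat.
- move=> /andP[/IHs -> /IHt ->]; rewrite big_allpairs_dep mulr_suml; apply: eq_bigr => w1 _.
  by rewrite mulr_sumr; apply: eq_bigr => w2 _; rewrite word_eval_cat.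
Qed.

Section OnlyS.
Hypothesis S_semi : semicircular eta S.

Lemma word_deriv_sum w (T : Type) (r : seq T) (F : T -> M) :
  word_deriv S eta w (\sum_(i <- r) F i) = \sum_(i <- r) word_deriv S eta w (F i).
Proof.
by elim/big_rec2: _ => [|i a b _ <-]; [apply: word_deriv0 | apply: word_derivD].
Qed.

Lemma term_deriv_expand t x : over false t -> term_deriv t x = \sum_(w <- expand t) word_deriv S eta w x.
Proof.
elim: t x => [b|[]|s IHs t IHt|s IHs t IHt] x //=.
- by rewrite big_seq1.
- by rewrite big_seq1 /= mulr1 addr0.
- by move=> /andP[/IHs -> /IHt ->]; rewrite big_cat.
- move=> /andP[os ot]; rewrite IHs// IHt// !(term_eval_expand (v := false))// big_allpairs_dep.
  rewrite mulr_suml mulr_sumr [X in _ + X](eq_bigr (fun w2 => \sum_(w1 <- expand s)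
     word_deriv S eta w2 (x * word_eval S w1))); last by move=> w2 _; rewrite -word_deriv_sum.
  rewrite exchange_big /= -big_split /=; apply: eq_bigr => w1 _.
  rewrite mulr_sumr -big_split /=; apply: eq_bigr => w2 _.
  by rewrite word_deriv_cat.
Qed.

Lemma semicircular_term t : over false t -> cexp M (S * term_eval t) = cexp M (term_deriv t 1).
Proof.
move=> ot; rewrite (term_eval_expand (v := false))// term_deriv_expand// mulr_sumr !raddf_sum.
by apply: eq_bigr => w _; apply: semicircular_word.
Qed.

Lemma semicircular_centered : cexp M S = 0.
Proof.
by have := semicircular_term (t := TConst 1) isT; rewrite /= rmorph1 mulr1 raddf0.
Qed.

End OnlyS.

Section Free.
Hypothesis S_semi : semicircular eta S.
Hypothesis YS_free : free_pair Y S.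

Implicit Types (w : seq (bool * M)) (l : seq (bool * term B)) (L : seq (term B)).

Definition centered_word w :=
  sorted (fun p p' : bool * M => p.1 != p'.1) w /\
  (forall p, p \in w -> gen_star_alg (Z p.1) p.2 /\ cexp M p.2 = 0).

Definition wprod w : M := \prod_(p <- w) p.2.

Lemma free_word w : w != [::] -> centered_word w -> cexp M (wprod w) = 0.
Proof.
move=> w0 [so H]; apply: YS_free => //; first by rewrite lt0n size_eq0.
Qed.

Definition alt_after v w := if w is p :: _ then v != p.1 else true.

Lemma centered_cons v x w : gen_star_alg (Z v) x -> cexp M x = 0 ->
  alt_after v w -> centered_word w -> centered_word ((v, x) :: w).
Proof.
move=> gx x0 a [so H]; split; first by case: w a so {H} => //= p w -> ->.
by move=> p; rewrite inE => /predU1P[->//|/H].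
Qed.

Lemma centered_behead (p : bool * M) w : centered_word (p :: w) -> alt_after p.1 w /\ centered_word w.
Proof.
move=> [so H]; split; first by case: w so {H} => //= p' w /andP[].
split; first by case: w so {H} => //= p' w /andP[].
by move=> p' qw; apply: H; rewrite inE qw orbT.
Qed.

Lemma wprod_cons v x w : wprod ((v, x) :: w) = x * wprod w.
Proof. by rewrite /wprod big_cons. Qed.

Lemma cexp_center v x : gen_star_alg (Z v) x ->
  gen_star_alg (Z v) (x - incl M (cexp M x)) /\ cexp M (x - incl M (cexp M x)) = 0.
Proof.
move=> gx; split; first by apply: gen_sub => //; apply: gen_base.
by rewrite linearB /= cexp_incl subrr.
Qed.

Lemma free_left v x w : gen_star_alg (Z v) x -> w != [::] -> alt_after v w ->
  centered_word w -> cexp M (x * wprod w) = 0.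
Proof.
move=> gx w0 a cw; have [gc c0] := cexp_center gx.
have -> : x * wprod w = wprod ((v, x - incl M (cexp M x)) :: w) + incl M (cexp M x) * wprod w.
  by rewrite wprod_cons -mulrDl subrK.
rewrite linearD /= cexp_mull (free_word w0 cw) mulr0 addr0.
by apply: free_word => //; apply: centered_cons.
Qed.

Lemma free_right v u w : gen_star_alg (Z v) u -> w != [::] ->
  (last (v, 0) w).1 != v -> centered_word w -> cexp M (wprod w * u) = 0.
Proof.
move=> gu w0 a cw; have [gc c0] := cexp_center gu.
have -> : wprod w * u = wprod (rcons w (v, u - incl M (cexp M u))) + wprod w * incl M (cexp M u).
  by rewrite /wprod -cats1 big_cat big_seq1 -mulrDr subrK.
rewrite linearD /= cexp_mulr (free_word w0 cw) mul0r addr0.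
apply: free_word; first by case: (w).
case: cw => so H; split; last first.
  by move=> p; rewrite mem_rcons inE => /predU1P[->//|/H].
by case: w w0 a so {H} => [//|p w] _ /= a so; rewrite rcons_path so.
Qed.

Definition term_prod L : term B := foldr (@TMul B) (TConst 1) L.

Lemma term_eval_cat L1 L2 :
  term_eval (term_prod (L1 ++ L2)) = term_eval (term_prod L1) * term_eval (term_prod L2).
Proof.
by elim: L1 => [|t L IH] /=; [rewrite rmorph1 mul1r | rewrite IH mulrA].
Qed.

Lemma term_deriv_cat L1 L2 x : term_deriv (term_prod (L1 ++ L2)) x =
  term_deriv (term_prod L1) x * term_eval (term_prod L2) +
  term_deriv (term_prod L2) (x * term_eval (term_prod L1)).
Proof.
elim: L1 x => [|t L IH] x /=; first by rewrite mul0r add0r rmorph1 mulr1.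
by rewrite IH term_eval_cat mulrDl !mulrA addrA.
Qed.

Definition wterm l : seq (bool * M) := [seq (p.1, term_eval p.2) | p <- l].
Definition well_typed l := all (fun p => over p.1 p.2) l.

Lemma term_eval_unzip l : term_eval (term_prod (unzip2 l)) = wprod (wterm l).
Proof.
elim: l => [|[v t] l IH] /=; first by rewrite /wprod big_nil rmorph1.
by rewrite IH wprod_cons.
Qed.

(** After a nonempty alternating centered prefix, what precedes an
    occurrence of [S] is an alternating centered word times an element generated by [S],
    and has expectation [0] by freeness. *)
Lemma term_deriv_prefix l w : well_typed l -> w != [::] -> centered_word (w ++ wterm l) ->
  term_deriv (term_prod (unzip2 l)) (wprod w) = 0.
Proof.
elim: l w => [//|[v t] l IH] w /= /andP[ot ol] w0 cw.
have cw' : centered_word (rcons w (v, term_eval t) ++ wterm l) by rewrite cat_rcons.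
have -> : wprod w * term_eval t = wprod (rcons w (v, term_eval t)).
  by rewrite /wprod -cats1 big_cat big_seq1.
rewrite IH//; last by case: (w).
rewrite addr0; case: v ot cw {cw'} => /= ot cw; first by rewrite term_deriv_over_true// mul0r.
rewrite term_deriv_orth ?mul0r// => u gu; case: cw => so H.
apply: (free_right (v := false)) => //.
  by case: w w0 so {H} => [//|p w] _ /=; rewrite cat_path /= => /and3P[].
split; first by case: w w0 so {H} => [//|p w] _ /=; rewrite cat_path => /andP[].
by move=> p pw; apply: H; rewrite mem_cat pw.
Qed.

Definition schwinger_dyson_for q L :=
  cexp M (q * S * term_eval (term_prod L)) = cexp M (q * term_deriv (term_prod L) 1).

(** Both sides vanish by freeness unless the first factor [t]
    is generated by [S]; then both reduce to [E [q E (S t) ...]], by the equation for words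
    in [S] alone. *)
Lemma schwinger_dyson_for_centered q l : gen_star_alg Y q -> well_typed l ->
  centered_word (wterm l) -> schwinger_dyson_for q (unzip2 l).
Proof.
rewrite /schwinger_dyson_for => gq; have gS : gen_star_alg (Z false) S by apply: gen_elt.
have S0 := semicircular_centered S_semi.
case: l => [|[[] t] l] /= ol cw.
- rewrite mulr0 raddf0 rmorph1 mulr1.
  have -> : S = wprod [:: (false, S)] by rewrite /wprod big_seq1.
  by apply: (free_left (v := true)) => //; apply: centered_cons => //; split.
- have [ot ol'] := andP ol.
  rewrite term_deriv_over_true// mul0r add0r mul1r.
  have -> : term_eval t = wprod [:: (true, term_eval t)] by rewrite /wprod big_seq1.
  rewrite (term_deriv_prefix ol') // mulr0 raddf0 -mulrA.
  have -> : S * (wprod [:: (true, term_eval t)] * term_eval (term_prod (unzip2 l))) =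
      wprod ((false, S) :: wterm ((true, t) :: l)).
    by rewrite term_eval_unzip /= !wprod_cons [wprod [::]]big_nil mulr1.
  by apply: (free_left (v := true)) => //; apply: centered_cons.
- have [ot ol'] := andP ol.
  rewrite mul1r; have -> : term_eval t = wprod [:: (false, term_eval t)] by rewrite /wprod big_seq1.
  rewrite (term_deriv_prefix ol') // addr0.
  have -> : wprod [:: (false, term_eval t)] = term_eval t by rewrite /wprod big_seq1.
  rewrite term_eval_unzip; have [a cw'] := centered_behead cw.
  have key y : gen_star_alg (Z false) y ->
      cexp M (q * (y * wprod (wterm l))) = cexp M (q * incl M (cexp M y) * wprod (wterm l)).
    move=> gy; have [gc c0] := cexp_center gy.
    have -> : q * (y * wprod (wterm l)) = q * wprod ((false, y - incl M (cexp M y)) :: wterm l)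
        + q * incl M (cexp M y) * wprod (wterm l).
      by rewrite wprod_cons -(mulrA q (incl _ _)) -mulrDr -mulrDl subrK.
    rewrite linearD /= (free_left (v := true)) ?add0r//.
    by apply: centered_cons.
  have -> : q * S * (term_eval t * wprod (wterm l)) = q * ((S * term_eval t) * wprod (wterm l)).
    by rewrite !mulrA.
  rewrite !key; last 1 first.
  + by apply: gen_mul => //; apply: (gen_term_eval (v := false)).
  + by rewrite semicircular_term.
  + by apply: gen_term_deriv => //; apply: (gen_one false).
Qed.

Lemma schwinger_dyson_for_add q L1 L2 s t u : term_eval u = term_eval s + term_eval t ->
  (forall x, term_deriv u x = term_deriv s x + term_deriv t x) ->
  schwinger_dyson_for q (L1 ++ s :: L2) -> schwinger_dyson_for q (L1 ++ t :: L2) ->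
  schwinger_dyson_for q (L1 ++ u :: L2).
Proof.
move=> eu du; rewrite /schwinger_dyson_for !term_eval_cat !term_deriv_cat /= eu du.
have -> : q * S * (term_eval (term_prod L1) * ((term_eval s + term_eval t) * term_eval (term_prod L2))) =
   q * S * (term_eval (term_prod L1) * (term_eval s * term_eval (term_prod L2))) +
   q * S * (term_eval (term_prod L1) * (term_eval t * term_eval (term_prod L2))).
  by rewrite mulrDl !mulrDr.
rewrite linearD /= => -> ->; rewrite -linearD /=; congr (cexp M _).
rewrite (mulrDr (1 * _)) term_derivD; ncring R M.
Qed.

Lemma schwinger_dyson_for_congr q L1 L2 L2' : term_eval (term_prod L2) = term_eval (term_prod L2') ->
  (forall x, term_deriv (term_prod L2) x = term_deriv (term_prod L2') x) ->
  schwinger_dyson_for q (L1 ++ L2) <-> schwinger_dyson_for q (L1 ++ L2').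
Proof. by move=> e d; rewrite /schwinger_dyson_for !term_eval_cat !term_deriv_cat e d. Qed.

Lemma schwinger_dyson_for_merge q L1 s t L2 :
  schwinger_dyson_for q (L1 ++ TMul s t :: L2) <-> schwinger_dyson_for q (L1 ++ s :: t :: L2).
Proof.
apply: schwinger_dyson_for_congr => [|x] /=; first by rewrite mulrA.
by rewrite mulrDl !mulrA addrA.
Qed.

Definition center t := TAdd t (TConst (- cexp M (term_eval t))).

Lemma not_alt_split l : ~~ sorted (fun p p' : bool * term B => p.1 != p'.1) l ->
  exists l1 v s t l2, l = l1 ++ (v, s) :: (v, t) :: l2.
Proof.
elim: l => [//|[v s] [|[u t] l] IH] //=.
rewrite negb_and negbK => /orP[/eqP ->|/IH[l1 [v' [s' [t' [l2 ->]]]]]].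
  by exists [::], u, s, t, l.
by exists ((v, s) :: l1), v', s', t', l2.
Qed.

Lemma wterm_centered l : well_typed l -> all (fun p => cexp M (term_eval p.2) == 0) l ->
  forall p, p \in wterm l -> gen_star_alg (Z p.1) p.2 /\ cexp M p.2 = 0.
Proof.
elim: l => [//|[v t] l IH] /= /andP[ot ol] /andP[/eqP t0 l0] p.
rewrite inE => /predU1P[->|]; last exact: IH.
by split=> //=; apply: gen_term_eval.
Qed.

(** Freeness only speaks of centered factors.  Splitting a
    factor as [c = (c - E c) + E c] gives a list with one more centered factor, and one
    where [E c] is absorbed by a neighbour, which is shorter: whence a double induction. *)
Lemma schwinger_dyson_for_well_typed q l : gen_star_alg Y q -> well_typed l ->
  schwinger_dyson_for q (unzip2 l).
Proof.
move=> gq; have [N] := ubnP (size l); elim: N l => [//|N IH] l lN ol.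
have [so|] := boolP (sorted (fun p p' : bool * term B => p.1 != p'.1) l); last first.
  move=> /not_alt_split[l1 [v [s [t [l2 lE]]]]].
  move: lN ol; rewrite lE /unzip2 map_cat /= size_cat /= => lN ol.
  apply/schwinger_dyson_for_merge.
  rewrite -[TMul s t :: _]/(unzip2 ((v, TMul s t) :: l2)) -[X in X ++ _]/(unzip2 l1).
  rewrite -map_cat; apply: IH; first by rewrite size_cat /=; lia.
  by move: ol; rewrite /well_typed !all_cat /= => /and4P[-> -> -> ->].
suff main l2 l1 : (size (l1 ++ l2) < N.+1)%N -> well_typed (l1 ++ l2) ->
    sorted (fun p p' : bool * term B => p.1 != p'.1) (l1 ++ l2) ->
    all (fun p => cexp M (term_eval p.2) == 0) l1 -> schwinger_dyson_for q (unzip2 (l1 ++ l2)).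
  by apply: (main l [::]).
elim: l2 l1 => [|[v c] l2 IHl2] l1 {}lN {}ol {}so H.
  rewrite cats0 in lN ol so *.
  apply: schwinger_dyson_for_centered => //; split.
    by rewrite /wterm sorted_map.
  exact: wterm_centered.
rewrite /unzip2 map_cat /=.
have oc : over v c by move: ol; rewrite /well_typed all_cat /= => /and3P[].
have [wt1 wt2] : well_typed l1 /\ well_typed l2.
  by move: ol; rewrite /well_typed all_cat /= => /and3P[].
apply: (@schwinger_dyson_for_add q _ _ (center c) (TConst (cexp M (term_eval c)))).
- by rewrite /= -addrA -raddfD addNr raddf0 addr0.
- by move=> x /=; rewrite !addr0.
- rewrite -[center c :: _]/(unzip2 ((v, center c) :: l2)) -map_cat -cat_rcons.
  apply: IHl2.
  + by move: lN; rewrite !size_cat size_rcons /=; lia.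
  + by rewrite /well_typed cat_rcons all_cat /= oc; apply/andP; split.
  + move: so; rewrite cat_rcons; case: (l1) => [|p l1'] /=; first by case: (l2).
    by rewrite !cat_path /=; case: (l2).
  + by rewrite all_rcons H andbT /= [cexp M _]linearD /= cexp_incl subrr.
case: l2 {IHl2 so ol} wt2 lN => [|[u d] l2] wt2 lN.
  case/lastP: l1 wt1 lN {H} => [|l1 [u d]] wt1 lN.
    rewrite /schwinger_dyson_for /= rmorph1 mulr1 mul0r addr0 mulr0 raddf0 cexp_mulr.
    have -> : S = wprod [:: (false, S)] by rewrite /wprod big_seq1.
    rewrite (free_left (v := true)) ?mul0r//.
    by apply: centered_cons => //; [exact: gen_elt|exact: semicircular_centered].
  rewrite -cats1 map_cat -catA /=; apply/schwinger_dyson_for_merge.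
  set e := TConst _.
  rewrite -[TMul d e :: _]/(unzip2 [:: (u, TMul d e)]) -map_cat; apply: IH.
    by move: lN; rewrite !size_cat size_rcons /=; lia.
  by move: wt1; rewrite /well_typed -cats1 !all_cat /= !andbT => /andP[-> ->].
rewrite [map _ (_ :: _)]/=; apply/schwinger_dyson_for_merge; set e := TConst _.
rewrite -[TMul e d :: _]/(unzip2 ((u, TMul e d) :: l2)) -map_cat; apply: IH.
  by move: lN; rewrite !size_cat /=; lia.
by rewrite /well_typed all_cat; apply/andP; split.
Qed.

Lemma schwinger_dyson q t : gen_star_alg Y q ->
  cexp M (q * S * term_eval t) = cexp M (q * term_deriv t 1).
Proof.
move=> gq.
suff main L : (forall l1, well_typed l1 -> schwinger_dyson_for q (unzip2 l1 ++ L)) ->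
    forall l1, well_typed l1 -> schwinger_dyson_for q (unzip2 l1 ++ t :: L).
  have := main [::] _ [::] isT; rewrite /schwinger_dyson_for /= rmorph1 !mulr1 addr0; apply.
  by move=> l1 wt1; rewrite cats0; apply: schwinger_dyson_for_well_typed.
elim: t L => [b|v|s IHs t IHt|s IHs t IHt] L H l1 wt1.
- have := H (rcons l1 (true, TConst b)); rewrite {1}/well_typed all_rcons => /(_ wt1).
  by rewrite /unzip2 map_rcons cat_rcons.
- have := H (rcons l1 (v, TVar v)); rewrite {1}/well_typed all_rcons /= eqxx => /(_ wt1).
  by rewrite /unzip2 map_rcons cat_rcons.
- by apply: (@schwinger_dyson_for_add q _ _ s t) => //; [apply: IHs|apply: IHt].
- by apply/schwinger_dyson_for_merge; apply: IHs => //; apply: IHt.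
Qed.

End Free.
End Terms.

Lemma same_distribution_term (R : realType) (B : cstarAlgType R)
    (M N : cstar_prob_space B) (X S : M) (Y T : N) (t : term B) :
  same_distribution X Y -> over true t -> cexp M (term_eval X S t) = cexp N (term_eval Y T t).
Proof.
move=> XY ot; rewrite !(term_eval_expand _ _ ot) !raddf_sum.
by apply: eq_bigr => w _; apply: same_distribution_word_eval.
Qed.

(** * Resolvents far from the real axis *)

Lemma expr_small_mul (R : realType) (q C d : R) :
  0 <= q < 1 -> 0 <= C -> 0 < d -> exists n, C * q ^+ n <= d.
Proof.
move=> q01 C0 d0; have C1 : 0 < C + 1 by lra.
have [n hn] := expr_small q01 (divr_gt0 d0 C1); exists n.
move: hn; rewrite ler_pdivlMr// => hn; have /andP[q0 _] := q01.
have := exprn_ge0 n q0; lra.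
Qed.

Section NeumannIteration.
Context {R : realType} {A : cstarAlgType R}.
Implicit Types (a x y : A) (K : R).

Definition add_imag (K : R) a : A := a + ('i * K%:C) *: 1.

Lemma i_neq0 K : 0 < K -> ('i * K%:C : R[i]) != 0.
Proof.
by move=> K0; rewrite mulf_neq0 ?neq0Ci// (fmorph_eq0 (real_complex R)) gt_eqF.
Qed.

Lemma nrm_kappa K x : 0 < K -> nrm (('i * K%:C)^-1 *: x) = K^-1 * nrm x.
Proof.
move=> K0; have -> : ('i * K%:C)^-1 *: x = - ('i *: (K^-1%:C *: x)).
  rewrite scalerA -scaleNr; congr (_ *: _).
  apply: (mulfI (i_neq0 K0)); rewrite mulfV ?i_neq0// mulrN mulrACA mulii -rmorphM.
  by rewrite mulfV ?gt_eqF// rmorph1 mulr1 opprK.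
by rewrite nrmN nrmZi nrmZp// invr_ge0 ltW.
Qed.

Lemma resolvent_fixpoint x K : 0 < K -> add_imag K x \is a GRing.unit ->
  (add_imag K x)^-1 = ('i * K%:C)^-1 *: (1 - x * (add_imag K x)^-1).
Proof.
move=> K0 au; have := mulrV au; rewrite {1}/add_imag; set r := _^-1 => e.
have -> : 1 - x * r = ('i * K%:C) *: r by rewrite -e; ncring R A.
by rewrite scalerA mulVf ?scale1r// i_neq0.
Qed.

(** The Neumann series of [(x + i K)^-1], as iterates of
    [r = (i K)^-1 (1 - x r)]. *)
Fixpoint neumann_iter (K : R) x n : A :=
  if n is m.+1 then ('i * K%:C)^-1 *: (1 - x * neumann_iter K x m) else 0.

Lemma neumann_iterP x K n : 0 < K -> 2 * nrm x <= K -> add_imag K x \is a GRing.unit ->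
  nrm (neumann_iter K x n - (add_imag K x)^-1) <= 2^-1 ^+ n * nrm (add_imag K x)^-1.
Proof.
move=> K0 xK au; elim: n => [|n IH] /=; first by rewrite sub0r nrmN mul1r.
rewrite {1}resolvent_fixpoint//.
set r := _^-1 in IH *; set u := neumann_iter _ _ _ in IH *.
have -> : ('i * K%:C)^-1 *: (1 - x * u) - ('i * K%:C)^-1 *: (1 - x * r)
    = - (('i * K%:C)^-1 *: (x * (u - r))) by ncring R A.
rewrite nrmN nrm_kappa// exprS -mulrA ler_pdivrMl//.
apply: le_trans (nrmM _ _) _; rewrite (mulrA K).
apply: ler_pM => //; rewrite ?nrm_ge0//; lra.
Qed.

End NeumannIteration.

Section ProbSpaceBounds.
Context {R : realType} {B : cstarAlgType R} (M : cstar_prob_space B).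

Lemma incl_lin : linear (incl M).
Proof. by move=> c x y; rewrite linearP. Qed.

Lemma incl_pos (b : B) : cstar_pos b -> cstar_pos (incl M b).
Proof. by move=> [c ->]; exists (incl M c); rewrite rmorphM /= incl_star. Qed.

Lemma cexp_lin : linear (cexp M).
Proof. by move=> c x y; rewrite linearP. Qed.

Lemma nrm_incl (b : B) : nrm (incl M b) <= 2 * nrm b.
Proof.
by have := pos_bound incl_lin incl_pos b; rewrite rmorph1 nrm1 mulr1.
Qed.

Lemma nrm_cexp (x : M) : nrm (cexp M x) <= 2 * nrm x.
Proof.
by have := pos_bound cexp_lin (@cexp_pos _ _ M) x; rewrite cexp1 nrm1 mulr1.
Qed.

Lemma cexp_star (x : M) : cexp M (star x) = star (cexp M x).
Proof. exact: pos_star cexp_lin (@cexp_pos _ _ M) x. Qed.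

Lemma inclA (c : R[i]) : incl M (c%:A) = c%:A.
Proof. by rewrite linearZ /= rmorph1. Qed.

Lemma inclN1 : incl M (- 1) = - 1.
Proof. by rewrite (linN incl_lin) rmorph1. Qed.

Lemma im_incl (b : B) : cstar_im (incl M b) = incl M (cstar_im b).
Proof. by rewrite !cstar_imE -incl_star !(linZ incl_lin) (linB incl_lin). Qed.

Lemma im_ge_incl e (b : B) : im_ge e b -> im_ge e (incl M b).
Proof.
rewrite /im_ge im_incl => /(pos_npos incl_pos).
by rewrite raddfB /= inclA.
Qed.

Lemma im_ge_sub_sa e (a X : M) : star X = X -> im_ge e a -> im_ge e (a - X).
Proof. by move=> Xs; rewrite /im_ge imD imN (im_sa0 Xs) oppr0 addr0. Qed.

Lemma im_ge_resolvent e (b : B) (X : M) : star X = X -> im_ge e b -> im_ge e (incl M b - X).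
Proof. by move=> Xs eb; apply: im_ge_sub_sa => //; apply: im_ge_incl. Qed.

Lemma im_cauchy e (b : B) (X : M) : 0 < e -> star X = X -> im_ge e b ->
  npos (cstar_im (- cauchy_transform X b)).
Proof.
move=> e0 Xs eb; have := im_inv e0 (im_ge_resolvent Xs eb).
move=> /(pos_npos (@cexp_pos _ _ M)).
rewrite imN; congr npos; rewrite (linN cexp_lin); congr (- _).
by rewrite !cstar_imE !(linZ cexp_lin) (linB cexp_lin) cexp_star.
Qed.

Lemma nrm_cauchy e (b : B) (X : M) : 0 < e -> star X = X -> im_ge e b ->
  nrm (cauchy_transform X b) <= 2 / e.
Proof.
move=> e0 Xs eb; apply: le_trans (nrm_cexp _) _.
by rewrite ler_pM2l//; apply: im_ge_bound => //; apply: im_ge_resolvent.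
Qed.

Lemma cauchy_lip e (b b' : B) (X : M) : 0 < e -> star X = X -> im_ge e b -> im_ge e b' ->
  nrm (cauchy_transform X b - cauchy_transform X b') <= 4 / e ^+ 2 * nrm (b - b').
Proof.
move=> e0 Xs eb eb'; have h := im_ge_resolvent Xs eb; have h' := im_ge_resolvent Xs eb'.
rewrite /cauchy_transform -raddfB; apply: le_trans (nrm_cexp _) _.
rewrite resolvent_sub; [|exact: im_ge_unit h|exact: im_ge_unit h'].
have -> : incl M b' - X - (incl M b - X) = incl M (b' - b).
  by rewrite (linB (@incl_lin)); ncring R M.
have h2 := nrmM_le (nrmM_le (im_ge_bound e0 h) (nrm_incl (b' - b))) (im_ge_bound e0 h').
apply: le_trans (ler_wpM2l _ h2) _; first by [].
rewrite nrmBC le_eqVlt; apply/orP; left; apply/eqP; field; lra.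
Qed.

End ProbSpaceBounds.

Section Subordination.
Context {R : realType} {B : cstarAlgType R} (N : cstar_prob_space B) (Y S : N).
Context (eta : B -> B).
Hypothesis eta_lin : linear eta.
Hypothesis eta_pos : forall b, cstar_pos b -> cstar_pos (eta b).
Hypothesis Y_sa : star Y = Y.
Hypothesis S_semi : semicircular eta S.
Hypothesis YS_free : free_pair Y S.
Implicit Types (b w : B) (x q : N) (K e : R).

Let S_sa : star S = S := S_semi.1.

Fixpoint neumann_term (K : R) (t : term B) n : term B :=
  if n is m.+1 then
    TMul (TConst ((('i * K%:C)^-1)%:A))
      (TAdd (TConst 1) (TMul (TConst (- 1)) (TMul t (neumann_term K t m))))
  else TConst 0.

Lemma term_eval_neumann (M : cstar_prob_space B) (X T : M) K t n :
  term_eval X T (neumann_term K t n) = neumann_iter K (term_eval X T t) n.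
Proof.
elim: n => [|n IH] /=; first by rewrite raddf0.
by rewrite IH inclA inclN1 rmorph1 mulN1r mulr_algl.
Qed.

Lemma over_neumann v K t n : over v t -> over v (neumann_term K t n).
Proof. by move=> vt; elim: n => [//|n IH] /=; rewrite vt IH. Qed.

(** The terms [t n] approximate the resolvent [r], and their
    derivatives [D n x] approximate [eta (E (x r)) r]: the recursion defining [t n] makes
    [D n] satisfy a contractive recursion of which the limit is the fixed point. *)
Lemma schwinger_dyson_resolvent q b K :
    gen_star_alg Y q -> 0 < K -> 2 * nrm (incl N b - Y - S) <= K ->
    add_imag K (incl N b - Y - S) \is a GRing.unit ->
  let r := (add_imag K (incl N b - Y - S))^-1 in
  cexp N (q * S * r) = cexp N (q * (incl N (eta (cexp N r)) * r)).
Proof.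
move=> gq K0 AK; set A := _ - S in AK *; move=> au r.
pose tA : term B := TAdd (TConst b) (TMul (TConst (- 1)) (TAdd (TVar true) (TVar false))).
have tAE : term_eval Y S tA = A.
  by rewrite /= /A inclN1; ncring R N.
pose t n := neumann_term K tA n.
pose u n := neumann_iter K A n.
have tu n : term_eval Y S (t n) = u n by rewrite term_eval_neumann tAE.
have un n : nrm (u n - r) <= 2^-1 ^+ n * nrm r by apply: neumann_iterP.
pose D n x := term_deriv Y S eta (t n) x.
pose Dr x := incl N (eta (cexp N x)) : N.
have DrD x y : Dr (x + y) = Dr x + Dr y.
  by rewrite /Dr raddfD (linD eta_lin) raddfD.
have DrZ c x : Dr (c *: x) = c *: Dr x.
  by rewrite /Dr linearZ /= (linZ eta_lin) linearZ.
set k := ('i * K%:C)^-1.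
have DS n x : D n.+1 x = k *: (Dr x * u n) - D n (k *: (x * A)).
  rewrite /D /= -/(t n) mul0r !add0r inclN1 inclA -/k.
  have -> : x * k%:A * -1 * (incl N b + -1 * (Y + S)) = - (k *: (x * A)).
    by rewrite /A; ncring R N.
  have -> : x * k%:A * -1 * -1 = k *: x by ncring R N.
  rewrite (term_derivN Y S eta_lin) -[incl _ (eta _)]/(Dr (k *: x)) DrZ tu; ncring R N.
have [L L0 DrL] : exists2 L, 0 <= L & forall x, nrm (Dr x) <= L * nrm x.
  exists (2 * (2 * nrm (eta 1) * 2)); first by rewrite !mulr_ge0// nrm_ge0.
  move=> x; apply: le_trans (nrm_incl _ _) _; rewrite -!mulrA ler_pM2l//.
  apply: le_trans (pos_bound eta_lin eta_pos _) _; rewrite -!mulrA ler_pM2l//.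
  by apply: ler_wpM2l; [exact: nrm_ge0|exact: nrm_cexp].
have rE : r = k *: (1 - A * r) by apply: resolvent_fixpoint.
have Dinf x : Dr (x * r) * r = k *: (Dr x * r) - Dr (k *: (x * A) * r) * r.
  have xr : x * r = k *: x - k *: (x * A) * r.
    by rewrite {1}rE; ncring R N.
  rewrite {1}xr -scaleN1r DrD !DrZ; ncring R N.
(* The first summand bounds the error for [n = 0]; the second one absorbs, at the rate
   [3 / 4], the inhomogeneous term of the recursion [DS]. *)
pose C := L * nrm r * nrm r + 4 * (L * nrm r / K).
have r0 := nrm_ge0 r.
have C0 : 0 <= C by rewrite addr_ge0// !mulr_ge0// invr_ge0 ltW.
have dn n x : nrm (D n x - Dr (x * r) * r) <= C * (3 / 4) ^+ n * nrm x.
  elim: n x => [|n IH] x.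
    rewrite /D /= sub0r nrmN expr0 mulr1.
    apply: le_trans (nrmM _ _) _; apply: le_trans (ler_wpM2r r0 (DrL _)) _.
    apply: le_trans (ler_wpM2r r0 (ler_wpM2l L0 (nrmM _ _))) _.
    have -> : L * (nrm x * nrm r) * nrm r = L * nrm r * nrm r * nrm x by ring.
    rewrite ler_wpM2r ?nrm_ge0// lerDl !mulr_ge0// invr_ge0 ltW//.
  rewrite DS Dinf.
  have -> : k *: (Dr x * u n) - D n (k *: (x * A)) -
     (k *: (Dr x * r) - Dr (k *: (x * A) * r) * r) =
     k *: (Dr x * (u n - r)) - (D n (k *: (x * A)) - Dr (k *: (x * A) * r) * r).
    by ncring R N.
  apply: le_trans (nrmB _ _) _.
  have h1 : nrm (k *: (Dr x * (u n - r))) <= C * (3 / 4) ^+ n / 4 * nrm x.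
    rewrite nrm_kappa//.
    apply: le_trans (ler_wpM2l _ (nrmM_le (DrL x) (un n))) _.
      by rewrite invr_ge0 ltW.
    have -> : K^-1 * (L * nrm x * (2^-1 ^+ n * nrm r)) =
       (L * nrm r / K) * 2^-1 ^+ n * nrm x by field; lra.
    apply: ler_wpM2r; first exact: nrm_ge0.
    have hn : 2^-1 ^+ n <= (3 / 4) ^+ n :> R by apply: lerXn2r; rewrite ?nnegrE; lra.
    have hp : 0 <= L * nrm r / K by rewrite !mulr_ge0// invr_ge0 ltW.
    have := ler_wpM2l hp hn; have : 0 <= (3 / 4) ^+ n :> R by rewrite exprn_ge0//; lra.
    have : 0 <= L * nrm r * nrm r by rewrite !mulr_ge0.
    by rewrite /C; nra.
  have h2 : nrm (D n (k *: (x * A)) - Dr (k *: (x * A) * r) * r)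
      <= C * (3 / 4) ^+ n / 2 * nrm x.
    apply: le_trans (IH _) _; rewrite nrm_kappa//.
    rewrite -!mulrA; apply: ler_wpM2l => //; apply: ler_wpM2l.
      by rewrite exprn_ge0//; lra.
    rewrite ler_pdivrMl//; apply: le_trans (nrmM _ _) _.
    by have := ler_wpM2r (nrm_ge0 x) AK; nra.
  by rewrite exprS; have := lerD h1 h2; lra.
apply/eqP; rewrite -subr_eq0; apply/eqP/nrm_small => d d0.
pose C' := 2 * (nrm q * nrm S * nrm r) + 2 * (nrm q * C).
have C'0 : 0 <= C' by rewrite addr_ge0// !mulr_ge0// nrm_ge0.
have [n hn] : exists n, C' * (3 / 4) ^+ n <= d by apply: expr_small_mul => //; lra.
apply: le_trans hn; rewrite -raddfB.
have -> : q * S * r - q * (Dr r * r) =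
    - (q * S * (u n - r)) + q * (D n 1 - Dr (1 * r) * r) + (q * S * u n - q * D n 1).
  by rewrite mul1r; ncring R N.
rewrite raddfD /= raddfB /= -tu /D (schwinger_dyson eta_lin S_semi YS_free) // subrr addr0 tu.
apply: le_trans (nrm_cexp _) _.
have e1 : nrm (- (q * S * (u n - r))) <= nrm q * nrm S * (2^-1 ^+ n * nrm r).
  by rewrite nrmN; apply: nrmM_le (un n); apply: nrmM.
have e2 : nrm (q * (D n 1 - Dr (1 * r) * r)) <= nrm q * (C * (3 / 4) ^+ n).
  by apply: nrmM_le => //; have := dn n 1; rewrite nrm1 mulr1.
apply: le_trans (ler_wpM2l _ (nrmD_le e1 e2)) _; first by [].
have hn : 2^-1 ^+ n <= (3 / 4) ^+ n :> R by apply: lerXn2r; rewrite ?nnegrE; lra.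
have hp : 0 <= nrm q * nrm S * nrm r by rewrite !mulr_ge0// nrm_ge0.
by have := ler_wpM2l hp hn; rewrite /C'; nra.
Qed.

End Subordination.

(** * Subordination far from the real axis *)

Lemma nrm_small_expr (R : realType) (A : cstarAlgType R) (x : A) (C q : R) :
  0 <= q < 1 -> 0 <= C -> (forall n, nrm x <= C * q ^+ n) -> x = 0.
Proof.
move=> q01 C0 H; apply: nrm_small => d d0.
by have [n hn] := expr_small_mul q01 C0 d0; apply: le_trans hn.
Qed.

Section LargeSpectralParameter.
Context {R : realType} {B : cstarAlgType R}.
Implicit Types (M N P : cstar_prob_space B) (b : B) (K e m : R).

Lemma incl_add_imag N K b : incl N (add_imag K b) = add_imag K (incl N b).
Proof. by rewrite /add_imag (linD (@incl_lin _ _ N)) inclA. Qed.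

Lemma add_imag_im_ge K b : im_ge 0 b -> im_ge K (add_imag K b).
Proof. by move=> /(im_ge_shift K); rewrite add0r. Qed.

Lemma add_imag_resolvent N (X : N) K b : incl N (add_imag K b) - X = add_imag K (incl N b - X).
Proof. by rewrite incl_add_imag /add_imag; ncring R N. Qed.

Lemma half_itv : 0 <= (2^-1 : R) < 1.
Proof. by apply/andP; split; lra. Qed.

Section OneSpace.
Context (N : cstar_prob_space B) (Y S : N) (eta : B -> B).
Hypothesis eta_lin : linear eta.
Hypothesis eta_pos : forall b, cstar_pos b -> cstar_pos (eta b).
Hypothesis Y_sa : star Y = Y.
Hypothesis S_semi : semicircular eta S.
Hypothesis YS_free : free_pair Y S.

Let S_sa : star S = S := S_semi.1.

Lemma YS_sa : star (Y + S) = Y + S.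
Proof. by rewrite starD Y_sa S_sa. Qed.

(** [(b + i K - Y)^-1] is a limit of polynomials in [Y]. *)
Lemma cexp_resolvent_orth (z : N) b K :
    (forall q, gen_star_alg Y q -> cexp N (q * z) = 0) ->
    0 < K -> 2 * nrm (incl N b - Y) <= K -> add_imag K (incl N b - Y) \is a GRing.unit ->
  cexp N ((add_imag K (incl N b - Y))^-1 * z) = 0.
Proof.
move=> H K0 AK au; pose tA : term B := TAdd (TConst b) (TMul (TConst (- 1)) (TVar true)).
have tAE : term_eval Y S tA = incl N b - Y by rewrite /= inclN1; ncring R N.
set r := _^-1; have r0 := nrm_ge0 r; have z0 := nrm_ge0 z.
apply: (nrm_small_expr half_itv (C := 2 * nrm r * nrm z)) => [|n].
  by rewrite !mulr_ge0.
have gq : gen_star_alg Y (neumann_iter K (incl N b - Y) n).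
  rewrite -tAE -term_eval_neumann; apply: (gen_term_eval Y S (v := true)); exact: over_neumann.
have -> : cexp N (r * z) = - cexp N ((neumann_iter K (incl N b - Y) n - r) * z).
  by rewrite mulrBl (linB (@cexp_lin _ _ N)) (H _ gq) sub0r opprK.
rewrite nrmN; apply: le_trans (nrm_cexp _) _.
have := nrmM_le (neumann_iterP n K0 AK au) (lexx (nrm z)); rewrite -/r; lra.
Qed.

Lemma eta_bound b : nrm (eta b) <= 2 * nrm (eta 1) * nrm b.
Proof. exact: pos_bound. Qed.

Lemma im_eta_cauchy e b : 0 < e -> im_ge e b ->
  npos (cstar_im (- eta (cauchy_transform (Y + S) b))).
Proof.
move=> e0 eb; have := pos_npos eta_pos (im_cauchy e0 YS_sa eb).
congr npos; rewrite -(linN eta_lin).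
by rewrite !cstar_imE !(linZ eta_lin) (linB eta_lin) (pos_star eta_lin eta_pos).
Qed.

(** With [Q = (w - eta g - Y)^-1] and [R = (w - Y - S)^-1],
    the difference of the two sides is [E [Q (eta g - S) R]], up to sign, and
    [E [Q S R] = E [Q eta (E R) R]] by the Schwinger-Dyson equation. *)
Lemma subordination_large m : exists2 K0, 1 <= K0 &
  forall K b, K0 <= K -> nrm b <= m -> im_ge 0 b ->
  let g := cauchy_transform (Y + S) (add_imag K b) in
  g = cauchy_transform Y (add_imag K (b - eta g)).
Proof.
pose L := nrm (eta 1); have L0 : 0 <= L := nrm_ge0 _.
have Y0 := nrm_ge0 Y; have S0 := nrm_ge0 S.
(* twice a bound for the norms of [b - Y - S] and of [b - eta g - Y], as [nrm g <= 2] *)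
exists (1 + 2 * (2 * (`|m| + 4 * L) + nrm Y + nrm S)).
  by rewrite lerDl mulr_ge0// !addr_ge0// mulr_ge0// addr_ge0// mulr_ge0.
move=> K b KK bm b0 g.
have m0 : 0 <= `|m| := normr_ge0 _; have mm : m <= `|m| := ler_norm _.
have K1 : 1 <= K by lra.
have K0 : 0 < K by lra.
have gK : nrm g <= 2.
  apply: le_trans (nrm_cauchy K0 YS_sa (add_imag_im_ge K b0)) _.
  by rewrite ler_pdivrMr//; lra.
have egL : nrm (eta g) <= 4 * L.
  by apply: le_trans (eta_bound g) _; rewrite -/L; have := ler_wpM2l L0 gK; lra.
have ig : im_ge 0 (b - eta g).
  by apply: im_geD => //; apply: im_eta_cauchy (add_imag_im_ge K b0).
have u1 : add_imag K (incl N b - (Y + S)) \is a GRing.unit.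
  rewrite -add_imag_resolvent; apply: (im_ge_unit K0); apply: im_ge_resolvent; first exact: YS_sa.
  exact: add_imag_im_ge.
have u2 : add_imag K (incl N (b - eta g) - Y) \is a GRing.unit.
  rewrite -add_imag_resolvent; apply: (im_ge_unit K0); apply: im_ge_resolvent => //.
  exact: add_imag_im_ge.
have gE : g = cexp N (add_imag K (incl N b - Y - S))^-1.
  rewrite /g /cauchy_transform add_imag_resolvent; congr (cexp N (add_imag K _)^-1).
  by ncring R N.
have AE : incl N b - Y - S = incl N b - (Y + S) by ncring R N.
rewrite [RHS]/cauchy_transform add_imag_resolvent gE; apply/esym/eqP; rewrite -subr_eq0.
rewrite -(linB (@cexp_lin _ _ N)) -gE AE resolvent_sub//.
have -> : add_imag K (incl N b - (Y + S)) - add_imag K (incl N (b - eta g) - Y) =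
    incl N (eta g) - S by rewrite (linB (@incl_lin _ _ N)) /add_imag; ncring R N.
rewrite -mulrA; apply/eqP; apply: cexp_resolvent_orth => //.
  move=> q gq; rewrite mulrBl mulrBr (linB (@cexp_lin _ _ N)) -AE.
  have A1 : 2 * nrm (incl N b - Y - S) <= K.
    have := nrmB (incl N b - Y) S; have := nrmB (incl N b) Y; have := nrm_incl N b; lra.
  rewrite mulrA [in X in _ - X]mulrA
    (schwinger_dyson_resolvent eta_lin eta_pos S_semi YS_free gq K0 A1); last by rewrite AE.
  by rewrite -gE mulrA subrr.
have := nrmB (incl N (b - eta g)) Y; have := nrm_incl N (b - eta g).
have := nrmB b (eta g); lra.
Qed.

End OneSpace.

Lemma same_distribution_large M N (X : M) (Y : N) m :
    star X = X -> star Y = Y -> same_distribution X Y ->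
  exists2 K0, 1 <= K0 & forall K b, K0 <= K -> nrm b <= m -> im_ge 0 b ->
    cauchy_transform X (add_imag K b) = cauchy_transform Y (add_imag K b).
Proof.
move=> Xs Ys XY; have X0 := nrm_ge0 X; have Y0 := nrm_ge0 Y.
exists (1 + 2 * (2 * `|m| + nrm X + nrm Y)).
  by rewrite lerDl mulr_ge0// !addr_ge0// mulr_ge0.
move=> K b KK bm b0.
have m0 : 0 <= `|m| := normr_ge0 _; have mm : m <= `|m| := ler_norm _.
have K0 : 0 < K by lra.
pose tA : term B := TAdd (TConst b) (TMul (TConst (- 1)) (TVar true)).
have unit_ P (Z : P) : star Z = Z -> add_imag K (incl P b - Z) \is a GRing.unit.
  move=> Zs; rewrite -add_imag_resolvent; apply: (im_ge_unit K0).
  by apply: im_ge_resolvent => //; apply: add_imag_im_ge.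
have appr P (Z : P) n : star Z = Z -> 2 * (2 * `|m| + nrm Z) <= K ->
    nrm (cexp P (term_eval Z Z (neumann_term K tA n)) - cauchy_transform Z (add_imag K b))
    <= 2 * nrm (add_imag K (incl P b - Z))^-1 * 2^-1 ^+ n.
  move=> Zs ZK; rewrite /cauchy_transform add_imag_resolvent -(linB (@cexp_lin _ _ P)).
  apply: le_trans (nrm_cexp _) _; rewrite term_eval_neumann.
  have -> : term_eval Z Z tA = incl P b - Z by rewrite /= inclN1; ncring R P.
  have A1 : 2 * nrm (incl P b - Z) <= K.
    have := nrmB (incl P b) Z; have := nrm_incl P b; lra.
  by have := neumann_iterP n K0 A1 (unit_ P Z Zs); lra.
apply/eqP; rewrite -subr_eq0; apply/eqP.
set rX := nrm (add_imag K (incl M b - X))^-1; set rY := nrm (add_imag K (incl N b - Y))^-1.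
apply: (nrm_small_expr half_itv (C := 2 * rX + 2 * rY)) => [|n].
  by rewrite addr_ge0// mulr_ge0// nrm_ge0.
have hX : 2 * (2 * `|m| + nrm X) <= K by lra.
have hY : 2 * (2 * `|m| + nrm Y) <= K by lra.
have := appr M X n Xs hX; have := appr N Y n Ys hY; rewrite -/rX -/rY.
rewrite -(same_distribution_term X Y XY); last exact: over_neumann.
set c := cexp M _; set x := cauchy_transform X _; set y := cauchy_transform Y _ => h1 h2.
have -> : x - y = (c - y) - (c - x) by ncring R B.
by apply: le_trans (nrmB _ _) _; lra.
Qed.

End LargeSpectralParameter.

Section FlowLarge.
Context {R : realType} {B : cstarAlgType R}.
Context (N1 N0 : cstar_prob_space B) (Y1 S1 : N1) (Y0 S0 : N0) (eta1 eta0 rho : B -> B).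
Hypothesis eta1_lin : linear eta1.
Hypothesis eta1_pos : forall b, cstar_pos b -> cstar_pos (eta1 b).
Hypothesis eta0_lin : linear eta0.
Hypothesis eta0_pos : forall b, cstar_pos b -> cstar_pos (eta0 b).
Hypothesis rho_lin : linear rho.
Hypothesis rho_pos : forall b, cstar_pos b -> cstar_pos (rho b).
Hypothesis eta1E : forall b, eta1 b = eta0 b + rho b.
Hypothesis Y1_sa : star Y1 = Y1.
Hypothesis Y0_sa : star Y0 = Y0.
Hypothesis S1_semi : semicircular eta1 S1.
Hypothesis S0_semi : semicircular eta0 S0.
Hypothesis YS1_free : free_pair Y1 S1.
Hypothesis YS0_free : free_pair Y0 S0.
Hypothesis Y10 : same_distribution Y1 Y0.

Let F1 := cauchy_transform (Y1 + S1).
Let F0 := cauchy_transform (Y0 + S0).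

Lemma flow_im e b : 0 < e -> im_ge e b -> im_ge e (b - rho (F1 b)).
Proof.
move=> e0 eb; apply: im_geD => //.
have := pos_npos rho_pos (im_cauchy e0 (YS_sa Y1_sa S1_semi) eb).
congr npos; rewrite -(linN rho_lin).
by rewrite !cstar_imE !(linZ rho_lin) (linB rho_lin) (pos_star rho_lin rho_pos).
Qed.

(** Both sides solve [g = G_Y0 (w' - eta0 g)] with [w' = b + i K - rho g1], whose
    right-hand side is a contraction in [g] far from the real axis. *)
Lemma flow_large b : im_ge 0 b -> exists K0, forall K, K0 <= K ->
  F1 (add_imag K b) = F0 (add_imag K b - rho (F1 (add_imag K b))).
Proof.
move=> b0; pose m1 := nrm b + 4 * nrm (eta1 1); pose m := nrm b + 4 * nrm (rho 1).
have nb := nrm_ge0 b; have nr := nrm_ge0 (rho 1).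
have n1 := nrm_ge0 (eta1 1); have n0 := nrm_ge0 (eta0 1).
have [Ka Ka1 Ha] := subordination_large eta1_lin eta1_pos Y1_sa S1_semi YS1_free (nrm b).
have [Kb Kb1 Hb] := subordination_large eta0_lin eta0_pos Y0_sa S0_semi YS0_free m.
have [Kc Kc1 Hc] := same_distribution_large m1 Y1_sa Y0_sa Y10.
(* [4 / K ^ 2] is a Lipschitz constant of [G_Y0], and [2 nrm (eta0 1)] one of [eta0]. *)
exists (Ka + Kb + Kc + 8 * nrm (eta0 1)) => K HK.
have K1 : 1 <= K by lra.
have K0 : 0 < K by lra.
set w := add_imag K b; set g1 := F1 w; set w' := w - rho g1; set g0 := F0 w'.
have iw : im_ge K w by apply: add_imag_im_ge.
have iw' : im_ge K w' by apply: flow_im.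
have sa1 := YS_sa Y1_sa S1_semi; have sa0 := YS_sa Y0_sa S0_semi.
have bound2 (N : cstar_prob_space B) (Z : N) (u : B) : star Z = Z -> im_ge K u ->
    nrm (cauchy_transform Z u) <= 2.
  move=> Zs iu; apply: le_trans (nrm_cauchy K0 Zs iu) _.
  by rewrite ler_pdivrMr//; lra.
have g1n : nrm g1 <= 2 by apply: bound2.
have wE : w' = add_imag K (b - rho g1) by rewrite /w' /w /add_imag; ncring R B.
have b'0 : im_ge 0 (b - rho g1).
  have := im_ge_shift (- K) iw'; rewrite subrr wE; congr im_ge.
  by rewrite /add_imag rmorphN; ncring R B.
have b'm : nrm (b - rho g1) <= m.
  have := nrmB b (rho g1); have := pos_bound rho_lin rho_pos g1.
  by have := ler_wpM2l nr g1n; rewrite /m; lra.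
have ig1 : im_ge 0 (b - eta1 g1).
  by apply: im_geD => //; apply: (im_eta_cauchy eta1_lin eta1_pos Y1_sa S1_semi K0).
have e1 : g1 = cauchy_transform Y0 (w' - eta0 g1).
  have -> : w' - eta0 g1 = add_imag K (b - eta1 g1).
    by rewrite eta1E /w' /w /add_imag; ncring R B.
  rewrite -Hc //; last 2 first.
  - by lra.
  - have := nrmB b (eta1 g1); have := pos_bound eta1_lin eta1_pos g1.
    by have := ler_wpM2l n1 g1n; rewrite /m1; lra.
  by apply: Ha => //; lra.
have e0 : g0 = cauchy_transform Y0 (w' - eta0 g0).
  rewrite {1}/g0 wE {1}/F0 Hb //; last by lra.
  by rewrite -/F0 -wE -/g0 wE; congr cauchy_transform; rewrite /add_imag; ncring R B.
have i1 : im_ge K (w' - eta0 g1).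
  have -> : w' - eta0 g1 = add_imag K (b - eta1 g1).
    by rewrite eta1E /w' /w /add_imag; ncring R B.
  exact: add_imag_im_ge.
have i0 : im_ge K (w' - eta0 g0).
  by apply: im_geD => //; apply: (im_eta_cauchy eta0_lin eta0_pos Y0_sa S0_semi K0).
have := cauchy_lip K0 Y0_sa i1 i0; rewrite -e1 -e0.
have -> : w' - eta0 g1 - (w' - eta0 g0) = eta0 (g0 - g1).
  by rewrite (linB eta0_lin); ncring R B.
have := pos_bound eta0_lin eta0_pos (g0 - g1); rewrite (nrmBC g0 g1).
set x := nrm (g1 - g0) => h1 h2.
have x0 : 0 <= x := nrm_ge0 _.
apply/eqP; rewrite -subr_eq0; apply/eqP/nrm_eq0; rewrite -/x.
have h3 : K ^+ 2 * x <= 8 * nrm (eta0 1) * x.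
  have K2 : 0 < K ^+ 2 by rewrite exprn_gt0.
  have := ler_wpM2l (ltW K2) h2.
  have -> : K ^+ 2 * (4 / K ^+ 2 * nrm (eta0 (g0 - g1))) = 4 * nrm (eta0 (g0 - g1)).
    by field; lra.
  lra.
have h4 : 8 * nrm (eta0 1) + 1 <= K ^+ 2.
  have : K <= K ^+ 2 by rewrite expr2 ler_peMr// ltW.
  lra.
by have := ler_wpM2r x0 h4; lra.
Qed.

End FlowLarge.

(** * Analytic functions of a real parameter *)

Section Analytic.
Context {R : realType}.
Implicit Types (A : cstarAlgType R) (h C D e K : R).

Definition jet A (a : nat -> A) n h : A := \sum_(k < n) (h ^+ k)%:C *: a k.

(** The bound on the remainders of every order makes [f] the sum of the power
    series with coefficients [a] near [0], and is easier to propagate through algebraic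
    operations than the sum itself. *)
Definition has_expansion A (f : R -> A) (a : nat -> A) C D : Prop :=
  (forall n, nrm (a n) <= C * D ^+ n) /\
  (forall n h, `|h| * D < 1 -> nrm (f h - jet a n h) <= C * (D * `|h|) ^+ n).

Definition analytic0 A (f : R -> A) : Prop :=
  exists a C D, [/\ 0 <= C, 1 <= D & has_expansion f a C D].

Lemma jetS A (a : nat -> A) n h : jet a n.+1 h = jet a n h + (h ^+ n)%:C *: a n.
Proof. by rewrite /jet big_ord_recr. Qed.

Lemma has_expansion_weak A (f : R -> A) a C D C' D' :
  0 <= C -> 1 <= D -> C <= C' -> D <= D' -> has_expansion f a C D -> has_expansion f a C' D'.
Proof.
move=> C0 D1 CC DD [h1 h2]; have D0 : 0 <= D by lra.
split=> [n|n h hD].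
  apply: le_trans (h1 n) _; apply: ler_pM => //; first exact: exprn_ge0.
  by apply: lerXn2r; rewrite ?nnegrE; lra.
have h0 := normr_ge0 h; have hh := ler_wpM2l h0 DD.
apply: le_trans (h2 n h _) _; first by lra.
apply: ler_pM => //; first by rewrite exprn_ge0// mulr_ge0.
by apply: lerXn2r; rewrite ?nnegrE ?mulr_ge0//; lra.
Qed.

Lemma analytic0_ext A (f g : R -> A) : (forall h, f h = g h) -> analytic0 f -> analytic0 g.
Proof.
move=> fg [a [C [D [C0 D1 [h1 h2]]]]]; exists a, C, D; split=> //; split=> // n h.
by rewrite -fg; apply: h2.
Qed.

Lemma analytic0_affine A (x y : A) : analytic0 (fun h => x + h%:C *: y).
Proof.
have nx := nrm_ge0 x; have ny := nrm_ge0 y.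
pose a (n : nat) : A := match n with 0%N => x | 1%N => y | _ => 0 end.
exists a, (nrm x + nrm y), 1.
split; [lra|by []|split=> [[|[|n]]|[|[|n]] h]]; rewrite ?expr1n ?mulr1 ?mul1r /=.
- by rewrite lerDl.
- by rewrite lerDr.
- by rewrite nrm0 addr_ge0.
- move=> h1; rewrite /jet big_ord0 subr0; apply: le_trans (nrmD _ _) _.
  by rewrite lerD2l nrmZr ler_piMl// ltW.
- move=> h1; rewrite /jet big_ord1 /= expr0 rmorph1 scale1r addrAC subrr add0r.
  by rewrite nrmZr expr1 mulrC ler_wpM2r// lerDr.
- move=> h1; have -> : jet a n.+2 h
      = x + h%:C *: y.
    rewrite /jet 2!big_ord_recl big1 /=; last by move=> i _; rewrite scaler0.
    by rewrite expr0 expr1 rmorph1 scale1r addr0.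
  by rewrite subrr nrm0 mulr_ge0// ?addr_ge0// exprn_ge0.
Qed.

Lemma analytic0_add A (f g : R -> A) : analytic0 f -> analytic0 g ->
  analytic0 (fun h => f h + g h).
Proof.
move=> [a [C [D [C0 D1 Hf]]]] [a' [C' [D' [C0' D1' Hg]]]].
have [h1 h2] := has_expansion_weak (D' := D + D') C0 D1 (lexx C) ltac:(lra) Hf.
have [k1 k2] := has_expansion_weak (D' := D + D') C0' D1' (lexx C') ltac:(lra) Hg.
exists (fun n => a n + a' n), (C + C'), (D + D'); split; [lra|lra|split=> [n|n h hD]].
  by rewrite mulrDl; apply: nrmD_le.
have -> : f h + g h - jet (fun n0 => a n0 + a' n0) n h = (f h - jet a n h) + (g h - jet a' n h).
  have -> : jet (fun n0 => a n0 + a' n0) n h = jet a n h + jet a' n h.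
    by rewrite /jet -big_split /=; apply: eq_bigr => i _; rewrite scalerDr.
  by ncring R A.
by rewrite mulrDl; apply: nrmD_le; [apply: h2|apply: k2].
Qed.

Lemma analytic0_lin A A' (T : A -> A') L (f : R -> A) : linear T -> 0 <= L ->
  (forall x, nrm (T x) <= L * nrm x) -> analytic0 f -> analytic0 (fun h => T (f h)).
Proof.
move=> Tl L0 TL [a [C [D [C0 D1 [h1 h2]]]]].
exists (fun n => T (a n)), (L * C), D; split=> //; first exact: mulr_ge0.
split=> [n|n h hD].
  by apply: le_trans (TL _) _; rewrite -mulrA ler_wpM2l.
have -> : T (f h) - jet (fun n0 => T (a n0)) n h = T (f h - jet a n h).
  rewrite (linB Tl); congr (_ - _); rewrite /jet.
  elim/big_rec2: _ => [|i u v _ ->]; first by rewrite lin0.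
  by rewrite (linD Tl) (linZ Tl).
by apply: le_trans (TL _) _; rewrite -mulrA ler_wpM2l// h2.
Qed.

Section Inverse.
Context {A : cstarAlgType R} (a : nat -> A).

(** The coefficients of the inverse power series, in a list because each of them
    depends on all the previous ones. *)
Fixpoint inv_seq n : seq A :=
  if n is m.+1 then
    rcons (inv_seq m)
      (if m is 0%N then (a 0%N)^-1
       else - (a 0%N)^-1 * \sum_(j < m) a (m - j)%N * nth 0 (inv_seq m) j)
  else [::].

Definition inv_coef n := nth 0 (inv_seq n.+1) n.

Lemma size_inv_seq n : size (inv_seq n) = n.
Proof. by elim: n => //= n IH; rewrite size_rcons IH. Qed.

Lemma nth_inv_seq n j : (j < n)%N -> nth 0 (inv_seq n) j = inv_coef j.
Proof.
elim: n => [//|n IH]; rewrite ltnS leq_eqVlt => /predU1P[->//|jn].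
by rewrite /= nth_rcons size_inv_seq jn IH.
Qed.

Lemma inv_coef0 : inv_coef 0 = (a 0%N)^-1.
Proof. by []. Qed.

Lemma inv_coefS n :
  inv_coef n.+1 = - (a 0%N)^-1 * \sum_(j < n.+1) a (n.+1 - j)%N * inv_coef j.
Proof.
rewrite {1}/inv_coef -[inv_seq n.+2]/(rcons (inv_seq n.+1) _) nth_rcons size_inv_seq ltnn eqxx.
by congr (_ * _); apply: eq_bigr => j _; congr (_ * _); exact: nth_inv_seq (ltn_ord j).
Qed.

Lemma inv_coef_conv n : a 0%N \is a GRing.unit ->
  \sum_(j < n.+1) a (n - j)%N * inv_coef j = (if n is 0%N then 1 else 0).
Proof.
move=> au; rewrite big_ord_recr /= subnn; case: n => [|n].
  by rewrite big_ord0 add0r inv_coef0 mulrV.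
by rewrite inv_coefS mulNr mulrN mulVKr// subrr.
Qed.

(** Truncated form of the identity [f * f^-1 = 1] between power series. *)
Lemma jet_inv n h : a 0%N \is a GRing.unit ->
  \sum_(j < n.+1) (h ^+ j)%:C *: (jet a (n.+1 - j)%N h * inv_coef j) = 1.
Proof.
move=> au; elim: n => [|n IH].
  rewrite big_ord1 [jet _ _ _]big_ord1 !expr0 !rmorph1 !scale1r inv_coef0; exact: mulrV.
have step : \sum_(j < n.+2) (h ^+ j)%:C *: (jet a (n.+2 - j)%N h * inv_coef j) =
   \sum_(j < n.+2) (h ^+ j)%:C *: (jet a (n.+1 - j)%N h * inv_coef j)
   + (h ^+ n.+1)%:C *: (\sum_(j < n.+2) a (n.+1 - j)%N * inv_coef j).
  rewrite scaler_sumr -big_split /=; apply: eq_bigr => j _.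
  have jn : (j <= n.+1)%N by rewrite -ltnS.
  rewrite subSn// jetS mulrDl scalerDr; congr (_ + _).
  by rewrite -scalerAl scalerA -rmorphM -exprD subnKC.
rewrite step inv_coef_conv// scaler0 addr0 big_ord_recr /= subnn.
by rewrite [jet a 0 h]big_ord0 mul0r scaler0 addr0.
Qed.

End Inverse.

(** The majorant that controls the coefficients of an inverse series. *)
Lemma geometric_majorant s D n : 0 <= s -> 0 <= D ->
  s * \sum_(j < n) D ^+ (n - j) * (D * (1 + s)) ^+ j <= (D * (1 + s)) ^+ n.
Proof.
move=> s0 D0; set E := D * (1 + s); have E0 : 0 <= E by rewrite mulr_ge0//; lra.
elim: n => [|n IH]; first by rewrite big_ord0 mulr0 expr0 ler01.
rewrite big_ord_recr /= subSnn expr1.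
have -> : \sum_(i < n) D ^+ (n.+1 - i) * E ^+ i = D * \sum_(i < n) D ^+ (n - i) * E ^+ i.
  rewrite mulr_sumr; apply: eq_bigr => i _.
  by rewrite subSn ?exprS ?mulrA// ltnW.
have -> : E ^+ n.+1 = D * E ^+ n + s * (D * E ^+ n) by rewrite exprS /E; ring.
rewrite mulrDr; apply: lerD => //.
by have := ler_wpM2l D0 IH; rewrite mulrCA.
Qed.

Lemma analytic0_inv A (f : R -> A) r Mb : 0 < r -> analytic0 f ->
  (forall h, `|h| < r -> f h \is a GRing.unit /\ nrm (f h)^-1 <= Mb) ->
  analytic0 (fun h => (f h)^-1).
Proof.
move=> r0 [a [C [D [C0 D1 [h1 h2]]]]] fu.
have [f0u f0M] := fu 0 ltac:(by rewrite normr0).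
have M0 : 0 <= Mb := le_trans (nrm_ge0 _) f0M.
have a0 : a 0%N = f 0.
  apply/esym/eqP; rewrite -subr_eq0; apply/eqP/nrm_eq0/eqP; rewrite eq_le nrm_ge0 andbT.
  have := h2 1%N 0; rewrite normr0 mul0r mulr0 expr1 mulr0 => /(_ ltr01).
  by rewrite /jet big_ord1 /= expr0 rmorph1 scale1r.
have a0u : a 0%N \is a GRing.unit by rewrite a0.
have s0 : 0 <= Mb * C by rewrite mulr_ge0.
have D0 : 0 <= D by lra.
(* growth rate of the coefficients of the inverse; [r^-1] is added to it below to stay
   where [f h] is invertible *)
pose E := D * (1 + Mb * C).
have E1 : D <= E by rewrite /E; have := mulr_ge0 D0 s0; lra.
have E0 : 0 <= E by lra.
have ir : 0 < r^-1 by rewrite invr_gt0.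
have EE : E <= E + r^-1 by lra.
have bn n : nrm (inv_coef a n) <= Mb * E ^+ n.
  have [m] := ubnP n; elim: m n => [//|m IH] [|n] nm.
    by rewrite inv_coef0 expr0 mulr1 a0.
  rewrite inv_coefS mulNr nrmN.
  have G := geometric_majorant n.+1 s0 D0; rewrite -/E in G.
  apply: nrmM_le; first by rewrite a0.
  apply: le_trans (nrm_sum _ _) _; apply: le_trans G.
  rewrite mulr_sumr; apply: ler_sum => j _.
  have IHj : nrm (inv_coef a j) <= Mb * E ^+ j by apply: IH; have := ltn_ord j; lia.
  apply: le_trans (nrmM_le (h1 _) IHj) _.
  by rewrite le_eqVlt; apply/orP; left; apply/eqP; ring.
exists (inv_coef a), Mb, (E + r^-1); split=> //; first by lra.
split=> [n|n h hD].
  by apply: le_trans (bn n) _; apply: ler_wpM2l => //; apply: lerXn2r; rewrite ?nnegrE; lra.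
have h0 := normr_ge0 h.
have hr : `|h| < r.
  have : `|h| * r^-1 < 1 by have := mulr_ge0 h0 E0; lra.
  by rewrite ltr_pdivrMr// mul1r.
have hE : `|h| * D < 1.
  by have := ler_wpM2l h0 E1; have := mulr_ge0 h0 (ltW ir); lra.
have [fhu fhM] := fu h hr.
have hfin : Mb * (E * `|h|) ^+ n <= Mb * ((E + r^-1) * `|h|) ^+ n.
  have p1 : 0 <= E * `|h| by rewrite mulr_ge0.
  have p2 : E * `|h| <= (E + r^-1) * `|h| by apply: ler_wpM2r.
  by apply: ler_wpM2l => //; apply: lerXn2r; rewrite ?nnegrE// (le_trans p1).
apply: le_trans hfin.
case: n => [|n]; first by rewrite /jet big_ord0 subr0 expr0 mulr1.
have -> : (f h)^-1 - jet (inv_coef a) n.+1 h =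
  (f h)^-1 * \sum_(j < n.+1) (h ^+ j)%:C *: ((jet a (n.+1 - j)%N h - f h) * inv_coef a j).
  have -> : \sum_(j < n.+1) (h ^+ j)%:C *: ((jet a (n.+1 - j)%N h - f h) * inv_coef a j)
    = 1 - f h * jet (inv_coef a) n.+1 h.
    rewrite -(jet_inv n h a0u) /jet mulr_sumr -sumrB; apply: eq_bigr => j _.
    by rewrite -scalerAr mulrBl scalerBr.
  by rewrite mulrBr mulr1 mulKr.
apply: nrmM_le => //; apply: le_trans (nrm_sum _ _) _.
have G := geometric_majorant n.+1 s0 D0; rewrite -/E in G.
have hn : 0 <= `|h| ^+ n.+1 by rewrite exprn_ge0.
rewrite exprMn; apply: le_trans (ler_wpM2r hn G).
rewrite mulr_sumr mulr_suml; apply: ler_sum => j _.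
have jn : (j <= n.+1)%N by apply: ltnW.
rewrite nrmZr normrX.
have hj : 0 <= `|h| ^+ j by rewrite exprn_ge0.
have h2j := h2 (n.+1 - j)%N h hE; rewrite nrmBC in h2j.
apply: le_trans (ler_wpM2l hj (nrmM_le h2j (bn j))) _.
rewrite exprMn -[in X in _ <= _ * X](subnKC jn) exprD.
by rewrite le_eqVlt; apply/orP; left; apply/eqP; ring.
Qed.

Lemma analytic0_zero A (f : R -> A) e : 0 < e -> analytic0 f ->
  (forall h, 0 < h < e -> f h = 0) -> exists2 r, 0 < r & forall h, `|h| < r -> f h = 0.
Proof.
move=> e0 [a [C [D [C0 D1 [h1 h2]]]]] f0; have D0 : 0 < D by lra.
have an n : a n = 0.
  have [m] := ubnP n; elim: m n => [//|m IH] n nm.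
  apply: nrm_small => d d0.
  pose c := C * D ^+ n.+1 + 1.
  have c0 : 0 < c by rewrite ltr_wpDl// mulr_ge0// exprn_ge0// ltW.
  pose h := Num.min (e / 2) (Num.min (D^-1 / 2) (d / c)).
  have iD : 0 < D^-1 by rewrite invr_gt0.
  have hp : 0 < h by rewrite !lt_min !divr_gt0.
  have he : h < e by apply: le_lt_trans (_ : h <= e / 2) _; [rewrite ge_min lexx|lra].
  have hD : h * D < 1.
    have : h <= D^-1 / 2 by rewrite !ge_min lexx orbT.
    by move=> hh; have := ler_wpM2r (ltW D0) hh; rewrite mulrAC mulVf ?gt_eqF//; lra.
  have hd : h <= d / c by rewrite !ge_min lexx !orbT.
  have := h2 n.+1 h; rewrite gtr0_norm// => /(_ hD).
  rewrite f0 ?hp// jetS /jet big1 ?add0r ?sub0r; last first.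
    by move=> i _; rewrite IH ?scaler0//; have := ltn_ord i; lia.
  rewrite nrmN nrmZp ?exprn_ge0 ?(ltW hp)// exprMn [h ^+ n.+1]exprS.
  have hn : 0 < h ^+ n by rewrite exprn_gt0.
  have -> : C * (D ^+ n.+1 * (h * h ^+ n)) = h ^+ n * (C * D ^+ n.+1 * h) by ring.
  rewrite ler_pM2l// => /le_trans; apply.
  apply: le_trans (_ : c * h <= d); last by rewrite mulrC -ler_pdivlMr.
  by rewrite ler_wpM2r ?(ltW hp)// /c lerDl.
exists D^-1; first by rewrite invr_gt0.
move=> h hr; have hD : `|h| * D < 1 by rewrite -ltr_pdivlMr// mul1r.
apply: nrm_small => d d0.
have q01 : 0 <= D * `|h| < 1 by rewrite mulr_ge0 ?(ltW D0)//= mulrC.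
have C1 : 0 < C + 1 by lra.
have [n hn] := expr_small q01 (divr_gt0 d0 C1).
have := h2 n h hD; rewrite /jet big1 ?subr0; last by move=> i _; rewrite an scaler0.
move=> /le_trans; apply; move: hn; rewrite ler_pdivlMr// => hn.
have /andP[q0 _] := q01; have := exprn_ge0 n q0; lra.
Qed.

(** Let [k] be the infimum of the [K] from which on [f] vanishes.  The
    expansion at [k] vanishes, since it does on the right of [k]; so [f] vanishes on the left of
    [k] too, unless [k = 0]. *)
Lemma analytic_halfline A (f : R -> A) K1 :
  (forall K, 0 <= K -> analytic0 (fun h => f (K + h))) ->
  (forall K, K1 <= K -> f K = 0) -> f 0 = 0.
Proof.
move=> an f1.
pose E : set R := fun K => 0 <= K /\ forall K', K <= K' -> f K' = 0.
have E1 : E (Num.max 0 K1).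
  by split=> [|K']; [rewrite le_max lexx|rewrite ge_max => /andP[_ /f1]].
have lbE : lbound E 0 by move=> K [].
have hE : has_inf E by split; [exists (Num.max 0 K1) | exists 0].
set k := inf E.
have k0 : 0 <= k by apply: lb_le_inf => //; exists (Num.max 0 K1).
have fk K : k < K -> f K = 0.
  move=> kK; have Kk : 0 < K - k by rewrite subr_gt0.
  have [K' [K'0 H] lt] := inf_adherent Kk hE.
  by apply: H; move: lt; rewrite -/k; lra.
have [r r0 fr] : exists2 r, 0 < r & forall h, `|h| < r -> f (k + h) = 0.
  by apply: (analytic0_zero ltr01 (an k k0)) => h /andP[h0 _]; apply: fk; rewrite ltrDl.
have fall K : k - r / 2 <= K -> f K = 0.
  move=> hK; have [kK|Kk] := ltP k K; first exact: fk.
  have -> : K = k + (K - k) by ring.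
  by apply: fr; rewrite ler0_norm; lra.
have E2 : E (Num.max 0 (k - r / 2)).
  by split=> [|K']; [rewrite le_max lexx|rewrite ge_max => /andP[_ /fall]].
have : k <= Num.max 0 (k - r / 2) by apply: ge_inf E2; exists 0.
rewrite le_max => /orP[kz|kr]; first by apply: fall; lra.
by exfalso; lra.
Qed.

End Analytic.

(** * The flow equation and the derivative in the spectral parameter *)

Section Flow.
Context {R : realType} {B : cstarAlgType R}.

Lemma analytic0_cauchy (N : cstar_prob_space B) (Z : N) (u : R -> B) r e :
  star Z = Z -> 0 < r -> 0 < e -> analytic0 u -> (forall h, `|h| < r -> im_ge e (u h)) ->
  analytic0 (fun h => cauchy_transform Z (u h)).
Proof.
move=> Zs r0 e0 ua ui.
apply: (analytic0_lin (@cexp_lin _ _ N) (L := 2)) => //; first exact: nrm_cexp.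
apply: (analytic0_inv (f := fun h => incl N (u h) - Z) (Mb := e^-1) r0).
  apply: (@analytic0_ext _ _ (fun h => incl N (u h) + (- Z + h%:C *: 0))).
    by move=> h; rewrite scaler0 addr0.
  apply: analytic0_add; last exact: analytic0_affine.
  by apply: (analytic0_lin (@incl_lin _ _ N) (L := 2)) => //; exact: nrm_incl.
move=> h hr; have ih := im_ge_resolvent Zs (ui h hr).
by split; [exact: im_ge_unit ih | exact: im_ge_bound].
Qed.

Section FlowEquation.
Context (N1 N0 : cstar_prob_space B) (Y1 S1 : N1) (Y0 S0 : N0) (eta1 eta0 rho : B -> B).
Hypothesis eta1_lin : linear eta1.
Hypothesis eta1_pos : forall b, cstar_pos b -> cstar_pos (eta1 b).
Hypothesis eta0_lin : linear eta0.
Hypothesis eta0_pos : forall b, cstar_pos b -> cstar_pos (eta0 b).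
Hypothesis rho_lin : linear rho.
Hypothesis rho_pos : forall b, cstar_pos b -> cstar_pos (rho b).
Hypothesis eta1E : forall b, eta1 b = eta0 b + rho b.
Hypothesis Y1_sa : star Y1 = Y1.
Hypothesis Y0_sa : star Y0 = Y0.
Hypothesis S1_semi : semicircular eta1 S1.
Hypothesis S0_semi : semicircular eta0 S0.
Hypothesis YS1_free : free_pair Y1 S1.
Hypothesis YS0_free : free_pair Y0 S0.
Hypothesis Y10 : same_distribution Y1 Y0.

Let F1 := cauchy_transform (Y1 + S1).
Let F0 := cauchy_transform (Y0 + S0).

(** [flow_large] continued analytically along [b + i K] down to [K = 0]. *)
Lemma flow_equation e b : 0 < e -> im_ge e b -> F1 b = F0 (b - rho (F1 b)).
Proof.
move=> e0 eb; have sa1 := YS_sa Y1_sa S1_semi; have sa0 := YS_sa Y0_sa S0_semi.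
have b0 : im_ge 0 b by apply: im_ge_weak eb; apply: ltW.
have [K1 HK1] := flow_large eta1_lin eta1_pos eta0_lin eta0_pos rho_lin rho_pos eta1E
  Y1_sa Y0_sa S1_semi S0_semi YS1_free YS0_free Y10 b0.
pose f K := F1 (add_imag K b) - F0 (add_imag K b - rho (F1 (add_imag K b))).
have addi0 : add_imag 0 b = b by rewrite /add_imag rmorph0 mulr0 scale0r addr0.
suff : f 0 = 0 by rewrite /f addi0 => /eqP; rewrite subr_eq0 => /eqP.
apply: (@analytic_halfline _ _ f K1) => [K K0|K KK]; last first.
  by apply/eqP; rewrite subr_eq0; apply/eqP; exact: HK1.
have e2 : 0 < e / 2 by rewrite divr_gt0.
have iu h : `|h| < e / 2 -> im_ge (e / 2) (add_imag (K + h) b).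
  move=> he; apply: im_ge_weak (im_ge_shift (K + h) eb).
  by have := ler_norm (- h); rewrite normrN; lra.
have au : analytic0 (fun h => add_imag (K + h) b).
  apply: (@analytic0_ext _ _ (fun h => add_imag K b + h%:C *: ('i *: 1))).
    by move=> h; rewrite /add_imag rmorphD; ncring R B.
  exact: analytic0_affine.
have aF1 : analytic0 (fun h => F1 (add_imag (K + h) b)) by apply: analytic0_cauchy au iu.
have neg_lin T : linear T -> linear (fun x : B => - T x : B).
  by move=> Tl c x y; rewrite Tl; ncring R B.
have rho_b x : nrm (- rho x) <= 2 * nrm (rho 1) * nrm x by rewrite nrmN; apply: pos_bound.
have cL : 0 <= 2 * nrm (rho 1) by rewrite mulr_ge0// nrm_ge0.
have aw : analytic0 (fun h => add_imag (K + h) b - rho (F1 (add_imag (K + h) b))).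
  by apply: analytic0_add => //; apply: (analytic0_lin (neg_lin _ rho_lin) cL rho_b).
have aF0 : analytic0 (fun h => F0 (add_imag (K + h) b - rho (F1 (add_imag (K + h) b)))).
  apply: (analytic0_cauchy sa0 e2 e2 aw) => h hr.
  exact: (flow_im rho_lin rho_pos Y1_sa S1_semi e2 (iu h hr)).
apply: analytic0_add => //.
have id_lin : linear (fun x : B => x) by [].
apply: (analytic0_lin (neg_lin _ id_lin) (L := 1)) => //.
by move=> x; rewrite nrmN mul1r.
Qed.

End FlowEquation.

Lemma cp_pos (f : B -> B) : completely_positive f -> forall a, cstar_pos a -> cstar_pos (f a).
Proof.
move=> [_ cp] a [c ->].
have /cp[d] : mx_pos (const_mx (star c * c) : 'M[B]_1).
  exists (const_mx c); apply/matrixP => i j.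
  by rewrite !mxE big_ord1 !mxE.
move=> /matrixP/(_ ord0 ord0); rewrite !mxE big_ord1 !mxE => ->.
by exists (d ord0 ord0).
Qed.

Lemma cstar_normE (x : cstar_space B) : `|x| = (nrm (x : B))%:C.
Proof. exact: cnormE. Qed.

Section Differential.
Context (N : cstar_prob_space B) (Z : N).

Lemma opp_comb c (x y : B) : - (c *: x + y) = c *: (- x) + - y.
Proof. by ncring R B. Qed.

Definition dcauchy (b : B) (h : cstar_space B) : cstar_space B :=
  - cexp N ((incl N b - Z)^-1 * incl N h * (incl N b - Z)^-1).

Lemma dcauchy_lin b : linear (dcauchy b : cstar_space B -> cstar_space B).
Proof.
move=> c x y; rewrite /dcauchy.
set r := _^-1.
have -> : r * incl N (c *: x + y) * r = c *: (r * incl N x * r) + r * incl N y * r.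
  by rewrite (@incl_lin _ _ N); ncring R N.
rewrite (@cexp_lin _ _ N); exact: (opp_comb c).
Qed.

HB.instance Definition _ b := GRing.isLinear.Build R[i] (cstar_space B) (cstar_space B) _
  (dcauchy b) (dcauchy_lin b).

Hypothesis Z_sa : star Z = Z.

Lemma dcauchy_bound e b h : 0 < e -> im_ge e b -> nrm (dcauchy b h : B) <= 4 / e ^+ 2 * nrm (h : B).
Proof.
move=> e0 eb; have hb := im_ge_bound e0 (im_ge_resolvent Z_sa eb).
rewrite /dcauchy nrmN; apply: le_trans (nrm_cexp _) _.
have h2 := nrmM_le (nrmM_le hb (nrm_incl N h)) hb.
apply: le_trans (ler_wpM2l _ h2) _; first by [].
by rewrite le_eqVlt; apply/orP; left; apply/eqP; field; lra.
Qed.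

(** The second order remainder of the resolvent is [r h r h r'], with
    [r = (b - Z)^-1] and [r' = (b + h - Z)^-1]. *)
Lemma cauchy_expansion e b (h : B) : 0 < e -> im_ge e b -> nrm h <= e / 2 ->
  nrm (cauchy_transform Z (b + h) - cauchy_transform Z b - (dcauchy b h : B))
   <= 16 / e ^+ 3 * nrm h ^+ 2.
Proof.
move=> e0 eb he; have e2 : 0 < e / 2 by rewrite divr_gt0.
have ib := im_ge_resolvent Z_sa eb.
have ibh : im_ge (e / 2) (b + h).
  by have := im_ge_pert eb he; congr im_ge; field.
have ih := im_ge_resolvent Z_sa ibh.
have bb := im_ge_bound e0 ib; have bh := im_ge_bound e2 ih.
rewrite /cauchy_transform /dcauchy.
set a := incl N b - Z in ib bb *; set a' := incl N (b + h) - Z in ih bh *.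
have e1 := resolvent_sub (im_ge_unit e0 ib) (im_ge_unit e2 ih).
have a'a : a' - a = incl N h by rewrite /a' /a (linD (@incl_lin _ _ N)); ncring R N.
rewrite a'a in e1.
have E1 : a'^-1 - a^-1 + a^-1 * incl N h * a^-1 = a^-1 * incl N h * (a^-1 * incl N h * a'^-1).
  by rewrite -e1 mulrBr -e1; ncring R N.
have -> : cexp N a'^-1 - cexp N a^-1 - (- cexp N (a^-1 * incl N h * a^-1)) =
    cexp N (a^-1 * incl N h * (a^-1 * incl N h * a'^-1)).
  by rewrite -E1 (linD (@cexp_lin _ _ N)) (linB (@cexp_lin _ _ N)); ncring R B.
apply: le_trans (nrm_cexp _) _.
have h1 := nrmM_le bb (nrm_incl N h).
have h2 := nrmM_le h1 (nrmM_le h1 bh).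
apply: le_trans (ler_wpM2l _ h2) _; first by [].
by rewrite le_eqVlt; apply/orP; left; apply/eqP; field; lra.
Qed.

Lemma dcauchy_continuous e b : 0 < e -> im_ge e b -> continuous (dcauchy b).
Proof.
move=> e0 eb; apply: bounded_linear_continuous; apply/bounded_funP => r.
exists ((4 / e ^+ 2)%:C * r) => x xr; rewrite cstar_normE.
apply: le_trans (_ : (4 / e ^+ 2)%:C * `|x| <= _).
  by rewrite cstar_normE -rmorphM lecR; apply: dcauchy_bound.
by apply: ler_wpM2l => //; rewrite ler0c divr_ge0// exprn_ge0// ltW.
Qed.

(** Stated for a function that coincides with the Cauchy transform only
    near [b], as [G eta] does. *)
Lemma cauchy_differentiable (f : cstar_space B -> cstar_space B) e b : 0 < e -> im_ge e b ->
  (forall b', im_ge (e / 2) b' -> f b' = cauchy_transform Z b') ->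
  differentiable f (b : cstar_space B) /\ ('d f (b : cstar_space B) : _ -> _) = dcauchy b.
Proof.
move=> e0 eb fZ; have cD := dcauchy_continuous e0 eb.
have fb : f b = cauchy_transform Z b by apply: fZ; apply: im_ge_weak eb; lra.
have fE : f \o shift (b : cstar_space B) = cst (f b) + dcauchy b +o_ (0 : cstar_space B) id.
  apply/eqaddoP => d0 /gt0_complex[d dp ->].
  near=> h; rewrite !cstar_normE -rmorphM lecR.
  have hn : nrm (h : B) < Num.min (e / 2) (d * e ^+ 3 / 16).
    rewrite -ltcR -cstar_normE; near: h; apply: nbhs0_lt.
    by rewrite ltcR lt_min !divr_gt0// mulr_gt0// exprn_gt0.
  move: hn; rewrite lt_min => /andP[h1 h2].
  have := cauchy_expansion e0 eb (ltW h1).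
  set u := (X in nrm X <= _); set v := (X in _ -> nrm X <= _).
  have -> : v = u.
    transitivity (f ((h : B) + b) - (f b + (dcauchy b h : B)) : B); first by [].
    have ibh : im_ge (e / 2) (b + (h : B)).
      by have := im_ge_pert eb (ltW h1); congr im_ge; field.
    rewrite fb fZ; last by rewrite addrC.
    by rewrite (addrC (h : B) b) opprD addrA.
  move=> /le_trans; apply.
  have n0 := nrm_ge0 (h : B); rewrite expr2 mulrA ler_wpM2r//.
  rewrite -ler_pdivlMl; last by rewrite divr_gt0// exprn_gt0.
  apply: le_trans (ltW h2) _; rewrite le_eqVlt; apply/orP; left; apply/eqP.
  by field; lra.
have dE := diff_unique cD fE.
by split=> //; apply/diff_locallyP; rewrite dE; split.
Unshelve. all: by end_near.
Qed.

End Differential.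

End Flow.

(** * The derivative in the variance *)

Section FlowFunction.
Context {R : realType} {B : cstarAlgType R} (M : cstar_prob_space B) (X : M).
Context (G : (B -> B) -> B -> B).
Hypothesis G_flow : semicircular_flow X G.

Lemma flow_cauchy eta : completely_positive eta -> exists (N : cstar_prob_space B) (Z : N),
  star Z = Z /\ forall e b, 0 < e -> im_ge e b -> G eta b = cauchy_transform Z b.
Proof.
move=> /G_flow[N [Y [S [Y_sa _ S_semi _ GE]]]]; exists N, (Y + S); split.
  exact: YS_sa Y_sa S_semi.
by move=> e b e0 eb; apply: GE; apply/im_posE; exists e.
Qed.

Lemma flow_step eta1 eta0 rho (t e : R) b :
  completely_positive eta1 -> completely_positive eta0 -> completely_positive rho ->
  0 <= t -> (forall x, eta1 x = eta0 x + t%:C *: rho x) -> 0 < e -> im_ge e b ->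
  let c := b - t%:C *: rho (G eta1 b) in im_ge e c /\ G eta1 b = G eta0 c.
Proof.
move=> cp1 cp0 cpr t0 eta1E e0 eb.
have [N1 [Y1 [S1 [Y1_sa XY1 S1_semi free1 G1]]]] := G_flow cp1.
have [N0 [Y0 [S0 [Y0_sa XY0 S0_semi free0 G0]]]] := G_flow cp0.
pose rt x := t%:C *: rho x.
have rt_lin : linear rt.
  by move=> c x y; rewrite /rt cpr.1 scalerDr !scalerA mulrC.
have rt_pos a : cstar_pos a -> cstar_pos (rt a).
  by move=> /(cp_pos cpr)/cstar_posE/(nposZ t0)/cstar_posE.
have XY : same_distribution Y1 Y0 by move=> bs; rewrite -XY1 XY0.
have ic := flow_im rt_lin rt_pos Y1_sa S1_semi e0 eb.
have GE : G eta1 b = cauchy_transform (Y1 + S1) b by apply: G1; apply/im_posE; exists e.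
rewrite /= GE; split=> //; rewrite G0; last by apply/im_posE; exists e.
exact: (flow_equation cp1.1 (cp_pos cp1) cp0.1 (cp_pos cp0) rt_lin rt_pos eta1E
  Y1_sa Y0_sa S1_semi S0_semi free1 free0 XY e0 eb).
Qed.

Lemma flow_bound eta (e : R) b : completely_positive eta -> 0 < e -> im_ge e b ->
  nrm (G eta b) <= 2 / e.
Proof.
move=> /flow_cauchy[N [Z [Zs GE]]] e0 eb; rewrite (GE e)//; exact: nrm_cauchy.
Qed.

Lemma flow_lip eta (e : R) b c : completely_positive eta -> 0 < e ->
  im_ge e b -> im_ge e c -> nrm (G eta b - G eta c) <= 4 / e ^+ 2 * nrm (b - c).
Proof.
move=> /flow_cauchy[N [Z [Zs GE]]] e0 eb ec; rewrite !(GE e)//; exact: cauchy_lip.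
Qed.

(** For [t >= 0] the flow equation goes from [eta] to [eta + t rho], for [t < 0]
    from [eta + t rho] to [eta].  In both cases a first use of the Lipschitz bound shows that
    [rho] is applied to two elements at distance [O (t)], and a second use concludes. *)
Lemma flow_second_order eta rho (e : R) b : completely_positive eta -> completely_positive rho ->
  0 < e -> im_ge e b -> exists C t0 : R, [/\ 0 <= C, 0 < t0 & forall t : R, `|t| <= t0 ->
    completely_positive (fun x => eta x + t%:C *: rho x) ->
    nrm (G (fun x => eta x + t%:C *: rho x) b - G eta (b - t%:C *: rho (G eta b)))
      <= C * t ^+ 2].
Proof.
move=> cpe cpr e0 eb; pose L := 2 * nrm (rho 1).
have L0 : 0 <= L by rewrite mulr_ge0// nrm_ge0.
have rhoL x : nrm (rho x) <= L * nrm x by apply: pos_bound cpr.1 (cp_pos cpr) x.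
have rhoB x y : rho (x - y) = rho x - rho y := linB cpr.1 x y.
have e2 : 0 < e / 2 by rewrite divr_gt0.
(* Lipschitz constant of the Cauchy transforms on [Im b >= e / 2] *)
pose k := 4 / (e / 2) ^+ 2.
have k0 : 0 <= k by rewrite divr_ge0// exprn_ge0// ltW.
have ke : 4 / e ^+ 2 <= k.
  rewrite /k ler_pM2l// lef_pV2 ?posrE ?exprn_gt0//.
  by apply: lerXn2r; rewrite ?nnegrE; lra.
pose t0 := e / 2 / (L * (2 / e) + 1).
have d0 : 0 < L * (2 / e) + 1.
  by rewrite ltr_wpDl// mulr_ge0// divr_ge0// ltW.
exists (k * L * (k * L * (2 / e))), t0; split.
- by do !apply: mulr_ge0 => //; rewrite invr_ge0 ltW.
- by rewrite divr_gt0.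
move=> t tt0 cpt.
have gb := flow_bound cpe e0 eb; set g := G eta b in gb *.
have rg : nrm (rho g) <= L * (2 / e) by apply: le_trans (rhoL g) _; rewrite ler_wpM2l.
have lips x y eta' : completely_positive eta' -> im_ge (e / 2) x -> im_ge (e / 2) y ->
    nrm (G eta' x - G eta' y) <= k * nrm (x - y).
  by move=> cp' ix iy; apply: flow_lip.
have wk (x : B) : im_ge e x -> im_ge (e / 2) x by apply: im_ge_weak; lra.
have [tp|tn] := leP 0 t.
  have [ic GE] := flow_step cpt cpe cpr tp (fun x => erefl) e0 eb.
  have [ic' _] : im_ge e (b - t%:C *: rho g) /\ True.
    split=> //; apply: im_geD => //.
    have [N [Z [Zs GZ]]] := flow_cauchy cpe.
    have := pos_npos (cp_pos cpr) (im_cauchy e0 Zs eb); rewrite -(GZ e)// => h.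
    have := nposZ tp h; congr npos.
    rewrite -scalerN -(linN cpr.1) !cstar_imE !(starZr t) -/g.
    by rewrite (linZ cpr.1) (linZ cpr.1) (linB cpr.1) (pos_star cpr.1 (cp_pos cpr)); ncring R B.
  set gt := G _ b in ic GE *.
  have gtb : nrm gt <= 2 / e := flow_bound cpt e0 eb.
  have rgt : nrm (rho gt) <= L * (2 / e) by apply: le_trans (rhoL gt) _; rewrite ler_wpM2l.
  have h1 : nrm (gt - g) <= k * (t * (L * (2 / e))).
    rewrite GE; apply: le_trans (lips _ _ _ cpe (wk _ ic) (wk _ eb)) _.
    rewrite ler_wpM2l//; have -> : b - t%:C *: rho gt - b = - (t%:C *: rho gt) by ncring R B.
    by rewrite nrmN nrmZp// ler_wpM2l.
  rewrite GE; apply: le_trans (lips _ _ _ cpe (wk _ ic) (wk _ ic')) _.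
  have -> : b - t%:C *: rho gt - (b - t%:C *: rho g) = - (t%:C *: rho (gt - g)).
    by rewrite rhoB; ncring R B.
  rewrite nrmN nrmZp//.
  have h2 := le_trans (rhoL (gt - g)) (ler_wpM2l L0 h1).
  apply: le_trans (ler_wpM2l k0 (ler_wpM2l tp h2)) _.
  by rewrite le_eqVlt; apply/orP; left; apply/eqP; ring.
pose s := - t; have s0 : 0 <= s by rewrite /s; lra.
have sE : t%:C = - s%:C :> R[i] by rewrite /s rmorphN opprK.
set c := b - t%:C *: rho g.
have cE : c = b + s%:C *: rho g by rewrite /c sE; ncring R B.
have ic : im_ge (e / 2) c.
  rewrite cE; have -> : e / 2 = e - e / 2 by lra.
  apply: im_ge_pert => //; rewrite nrmZp//.
  have ss : s <= t0 by move: tt0; rewrite ltr0_norm.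
  apply: le_trans (ler_wpM2l s0 rg) _.
  apply: le_trans (_ : s * (L * (2 / e) + 1) <= _); first by rewrite ler_wpM2l// lerDl.
  by move: ss; rewrite /t0 ler_pdivlMr.
have [ic' GE] : im_ge (e / 2) (c - s%:C *: rho (G eta c)) /\
    G eta c = G (fun x => eta x + t%:C *: rho x) (c - s%:C *: rho (G eta c)).
  by apply: (flow_step cpe cpt cpr s0) => // x; rewrite sE; ncring R B.
have h1 : nrm (g - G eta c) <= k * (s * (L * (2 / e))).
  apply: le_trans (lips _ _ _ cpe (wk _ eb) ic) _; rewrite ler_wpM2l// cE.
  have -> : b - (b + s%:C *: rho g) = - (s%:C *: rho g) by ncring R B.
  by rewrite nrmN nrmZp// ler_wpM2l.
rewrite GE; apply: le_trans (lips _ _ _ cpt (wk _ eb) ic') _.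
have -> : b - (c - s%:C *: rho (G eta c)) = - (s%:C *: rho (g - G eta c)).
  by rewrite rhoB cE; ncring R B.
rewrite nrmN nrmZp//.
have h2 := le_trans (rhoL (g - G eta c)) (ler_wpM2l L0 h1).
apply: le_trans (ler_wpM2l k0 (ler_wpM2l s0 h2)) _.
by rewrite le_eqVlt; apply/orP; left; apply/eqP; rewrite /s; ring.
Qed.

End FlowFunction.

Section Interior.
Context {R : realType} {B : cstarAlgType R}.

Lemma cp_interior_perturb (eta rho : B -> B) :
  completely_positive rho -> cp_interior eta ->
  exists2 t0 : R, 0 < t0 & forall t : R, `|t| <= t0 ->
    completely_positive (fun x => eta x + t%:C *: rho x).
Proof.
move=> cpr [[el [K eK] eh] [e e0 H]].
have rl := cpr.1; have rh := pos_star rl (cp_pos cpr).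
pose L := 2 * nrm (rho 1); have L0 : 0 <= L by rewrite mulr_ge0// nrm_ge0.
have rL x : nrm (rho x) <= L * nrm x by apply: pos_bound (cp_pos cpr) x.
have L1 : 0 < L + 1 by lra.
exists (e / (L + 1)); first by rewrite divr_gt0.
move=> t tt; apply: H; first split.
- by move=> c x y; rewrite el rl; ncring R B.
- exists (K + `|t| * L) => x; have := eK x; rewrite !cnormE -!rmorphM !lecR => h.
  rewrite mulrDl; apply: nrmD_le => //; rewrite nrmZr -mulrA.
  by rewrite ler_wpM2l.
- by move=> x; rewrite eh rh starD starZr.
move=> x; rewrite !cnormE -rmorphM lecR.
have -> : eta x + t%:C *: rho x - eta x = t%:C *: rho x by ncring R B.
rewrite nrmZr; apply: le_trans (ler_wpM2l (normr_ge0 t) (rL x)) _.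
rewrite mulrA; apply: ler_wpM2r; first exact: nrm_ge0.
have tp := normr_ge0 t; move: tt; rewrite ler_pdivlMr// => tt; nra.
Qed.

End Interior.

Local Open Scope classical_set_scope.

Theorem theorem8p3 (R : realType) (B : cstarAlgType R)
    (M : cstar_prob_space B) (X S : M) (eta : B -> B)
    (G : (B -> B) -> B -> B)
    (X_sa : star X = X)
    (eta_cp : completely_positive eta)
    (eta_inv : bijective eta)
    (S_semi : semicircular eta S)
    (XS_free : free_pair X S)
    (G_flow : semicircular_flow X G)
    (G_eta : forall b : B, im_pos b -> G eta b = cauchy_transform (X + S) b) :
  forall (rho : B -> B) (b : B),
    completely_positive rho -> cp_interior eta -> im_pos b ->
    let Geta : cstar_space B -> cstar_space B := G eta in
    let z : cstar_space B := b in
    differentiable Geta z /\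
    exists2 dG : cstar_space B,
      (fun t : R => (t%:C)^-1 *: (G (fun x => eta x + t%:C *: rho x) b - G eta b)
          : cstar_space B) @ 0^' --> dG
      & dG + 'd Geta z (rho (G eta b)) = 0.
Proof.
move=> rho b rho_cp eta_int /im_posE[e e0 eb] Geta z.
have XS_sa : star (X + S) = X + S by apply: YS_sa S_semi.
have [G_diff G_D] : differentiable Geta z /\ ('d Geta z : _ -> _) = dcauchy (X + S) b.
  apply: (cauchy_differentiable XS_sa e0 eb) => b' ib'; apply: G_eta.
  by apply/im_posE; exists (e / 2) => //; rewrite divr_gt0.
split=> //.
set w := rho (G eta b); set D := dcauchy (X + S) b.
exists (- D w); last by rewrite G_D addNr.
have [C [t0 [C0 t0p H2]]] := flow_second_order G_flow eta_cp rho_cp e0 eb.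
have [t1 t1p cpt] := cp_interior_perturb rho_cp eta_int.
pose C2 := C + 16 / e ^+ 3 * nrm w ^+ 2.
have w0 := nrm_ge0 w.
have C20 : 0 <= C2.
  by rewrite addr_ge0// mulr_ge0 ?sqr_ge0// divr_ge0// exprn_ge0// ltW.
have w1 : 0 < nrm w + 1 by lra.
have C21 : 0 < C2 + 1 by lra.
apply/cvgrPdist_le => d0 /gt0_complex[d dp ->].
near=> t.
have t_neq0 : t != 0 by near: t; exact: nbhs_dnbhs_neq.
have : `|t| < Num.min (Num.min t0 t1) (Num.min (e / 2 / (nrm w + 1)) (d / (C2 + 1))).
  by near: t; apply: dnbhs0_lt; rewrite !lt_min t0p t1p !divr_gt0.
rewrite !lt_min => /andP[/andP[tt0 tt1] /andP[tw td]].
have ta := normr_ge0 t.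
have hE : b - t%:C *: w = b + (- (t%:C *: w)) by [].
have hn : nrm (- (t%:C *: w)) <= e / 2.
  rewrite nrmN nrmZr; apply: le_trans (_ : `|t| * (nrm w + 1) <= _).
    by rewrite ler_wpM2l// lerDl.
  by rewrite -ler_pdivlMr// ltW.
have h1 := H2 t (ltW tt0) (cpt t (ltW tt1)); rewrite -/w in h1.
have h2 := cauchy_expansion XS_sa e0 eb hn.
rewrite nrmN nrmZr exprMn real_normK ?num_real// in h2.
have ib : im_ge (e / 2) (b - t%:C *: w).
  by have := im_ge_pert eb hn; congr im_ge; field.
have Gb : G eta b = cauchy_transform (X + S) b by apply: G_eta; apply/im_posE; exists e.
have Gbh : G eta (b - t%:C *: w) = cauchy_transform (X + S) (b - t%:C *: w).
  by apply: G_eta; apply/im_posE; exists (e / 2) => //; rewrite divr_gt0.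
rewrite -Gb -Gbh in h2; set Gt := G _ b in h1 *.
have Dh : (D (- (t%:C *: w)) : B) = - (t%:C *: (D w : B)).
  by rewrite [LHS](linN (dcauchy_lin (X + S) b)) [X in - X](linZ (dcauchy_lin (X + S) b)).
rewrite -/D Dh in h2.
have tC : t%:C != 0 :> R[i] by rewrite (fmorph_eq0 (real_complex R)).
rewrite cstar_normE lecR.
set U := Gt - _ in h1; set V := _ - - _ in h2.
have -> : nrm ((- D w : B) - (t%:C)^-1 *: (Gt - G eta b)) = nrm ((t^-1)%:C *: (U + V)).
  rewrite -nrmN; congr nrm; rewrite fmorphV /U /V.
  by nc_coeffs R B; repeat split; field.
rewrite nrmZr normfV; have t2 : 0 < `|t| by rewrite normr_gt0.
rewrite ler_pdivrMl//.
apply: le_trans (nrmD_le h1 h2) _.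
have -> : C * t ^+ 2 + 16 / e ^+ 3 * (t ^+ 2 * nrm w ^+ 2) = C2 * `|t| * `|t|.
  by rewrite /C2 -[t ^+ 2]real_normK ?num_real//; ring.
rewrite mulrC ler_wpM2l//.
apply: le_trans (_ : (C2 + 1) * `|t| <= _); first by rewrite ler_wpM2r// lerDl.
by rewrite mulrC -ler_pdivlMr// ltW.
Unshelve. all: by end_near.
Qed.
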